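(* For $\tau$ in the upper half plane $\mathbb{H}$ let $\Lambda_\tau=\mathbb{Z}+\mathbb{Z}\tau$. (a) For any $\tau\in\mathbb{H}$ there exists a unique normalized type I developing map $f(z;\tau)$ of the unique solution of $\triangle u+e^u=4\pi\delta_0$ on $\mathbb{C}/\Lambda_\tau$ with the following properties: (i) $\mathrm{ord}_{z=a}f(z;\tau)=0$ for all $a\not\equiv\frac12\pmod{\Lambda_\tau}$; (ii) $\frac{d}{dz}f(z;\tau)|_{z=0}=0$ and $\frac{d^2}{dz^2}f(z;\tau)|_{z=0}\in\mathbb{C}^\times$; (iii) the holomorphic map $f(\cdot;\tau):\mathbb{C}\to\mathbb{P}^1(\mathbb{C})$ is étale outside $\Lambda_\tau$; (iv) $f(z+1;\tau)=-f(z;\tau)$ and $f(z+\tau;\tau)=1/f(z;\tau)$ for all $z\in\mathbb{C}$; (v) $f(-z;\tau)=f(z;\tau)$ for all $z\in\mathbb{C}$; (vi) $f(\frac{\tau}{2};\tau)=1$; (vii) $\mathrm{ord}_{z=1/2}f(z;\tau)=1$; (viii) $\mathrm{ord}_{z=(1/2)+\tau}f(z;\tau)=-1$. (b) The function $f(z;\tau)$ is characterized by (i), (iv), (vi) and (vii): if a meromorphic function $h$ on $\mathbb{C}$ satisfies (i), (iv), (vi) and (vii) for an element $\tau\in\mathbb{H}$, then $h(z)=f(z;\tau)$ for all $z\in\mathbb{C}$. (c) Writing $\wp,\sigma,\eta$ for the Weierstrass functions and quasi-period of $\Lambda_\tau$, $$f(z;\tau)=-e^{\frac14\eta(\tau)(1+\tau)}\,\frac{\sigma(\frac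 z2-\frac14)\,\sigma(\frac z2+\frac14)}{\sigma(\frac z2-\frac14-\frac\tau2)\,\sigma(\frac z2+\frac14+\frac\tau2)} =-e^{\frac14\eta(\tau)(1+\tau)}\,\frac{\sigma^2(\frac14)}{\sigma^2(\frac14+\frac\tau2)}\cdot\frac{\wp(\frac z2)-\wp(\frac14)}{\wp(\frac z2)-\wp(\frac14+\frac\tau2)}$$ $$=\frac{\wp(\frac\tau4)-\wp(\frac14+\frac\tau2)}{\wp(\frac\tau4)-\wp(\frac14)}\cdot\frac{\wp(\frac z2)-\wp(\frac14)}{\wp(\frac z2)-\wp(\frac14+\frac\tau2)}.$$
   Context: The equation $\triangle u+e^u=4\pi\delta_0$ on $E=\mathbb{C}/\Lambda_\tau$ means $\int_E(u\,\triangle h+e^uh)\,dx\,dy=4\pi\,h(0)$ for all $h\in C^\infty(E)$, where $\triangle=\partial_x^2+\partial_y^2$, $\delta_0$ is the Dirac measure at $0$, and $u$ is real-valued and $C^2$ on $E\smallsetminus\{0\}$ with $u,e^u$ integrable; it has a unique solution for every $\tau\in\mathbb{H}$. A developing map of $u$ is a meromorphic function $f$ on $\mathbb{C}$ with $u=\log\frac{8|f'|^2}{(1+|f|^2)^2}$ on $\mathbb{C}\smallsetminus\Lambda_\tau$; it is normalized of type I (with respect to the basis $1,\tau$) if $f(z+1)=-f(z)$ and $f(z+\tau)=1/f(z)$. The map $f:\mathbb{C}\to\mathbb{P}^1(\mathbb{C})$ is étale at a point if it has no critical point there. The quasi-period $\eta(\omega)=\eta(\omega;\Lambda_\tau)$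 is defined by $\zeta(z+\omega)=\zeta(z)+\eta(\omega)$ for $\omega\in\Lambda_\tau$, $\zeta=\sigma'/\sigma$, $\zeta'=-\wp$. *)

(* Defs.v *)
From HB Require Import structures.
From mathcomp Require Import all_boot all_order all_algebra.
From mathcomp Require Import complex.
From mathcomp Require Import all_classical all_reals all_analysis.
Import Order.TTheory GRing.Theory Num.Theory.
Import numFieldNormedType.Exports.

Set Implicit Arguments.
Unset Strict Implicit.
Unset Printing Implicit Defensive.

Local Open Scope classical_set_scope.
Local Open Scope ring_scope.

(* [R[i]] packaged as a [numClosedFieldType]: it then carries the topology and
   the normed module structure of a numeric field over itself, so [derivable]
   and [derive1] on [cplx R -> cplx R] are complex differentiation. *)
Definition cplx (R : realType) : numClosedFieldType := R[i].

Section Complex.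
Context {R : realType}.
Local Notation C := (cplx R).

Definition mkC (x y : R) : C := Complex x y.

Definition cabs (z : C) : R := complex.Re `|z|.

Definition cexp (z : C) : C :=
  mkC (expR (complex.Re z) * cos (complex.Im z))
      (expR (complex.Re z) * sin (complex.Im z)).

Definition lattice (tau : C) : set C :=
  [set w | exists m n : int, w = m%:~R + n%:~R * tau].

End Complex.

Section Weierstrass.
Context {R : realType}.
Local Notation C := (cplx R).
Implicit Types (tau z w : C).

Definition int_box (N : nat) : seq int :=
  [seq k%:Z - N%:Z | k <- iota 0 N.*2.+1].

Definition lattice_box tau (N : nat) : seq C :=
  [seq m%:~R + n%:~R * tau | m <- int_box N, n <- int_box N].

(* The product over the nonzero lattice points converges absolutely, so the
   exhaustion of the lattice by boxes is immaterial. *)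
Definition wsigma tau z : C :=
  limn (fun N => z * \prod_(w <- lattice_box tau N | w != 0)
                       ((1 - z / w) * cexp (z / w + (z / w) ^+ 2 / 2))).

Definition wzeta tau z : C := derive1 (wsigma tau) z / wsigma tau z.

(* Junk value at the lattice points, which are the poles. *)
Definition wp tau z : C := - derive1 (wzeta tau) z.

Definition quasi_period tau w : C :=
  xget 0 [set e : C | forall z, ~ lattice tau z ->
                        wzeta tau (z + w) = wzeta tau z + e].

End Weierstrass.

Section MeanField.
Context {R : realType}.
Local Notation C := (cplx R).
Implicit Types (tau z w : C) (u v h : C -> R).

Definition dx u z : R :=
  derive1 (fun t : R => u (mkC t (complex.Im z))) (complex.Re z).

Definition dy u z : R :=
  derive1 (fun t : R => u (mkC (complex.Re z) t)) (complex.Im z).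

Definition laplacian u z : R := dx (dx u) z + dy (dy u) z.

(* Class C^k in the real sense on the open set U. *)
Fixpoint Ck (k : nat) (U : set C) u : Prop :=
  (forall z, U z -> {for z, continuous u}) /\
  match k with
  | 0%N => True
  | k'.+1 =>
    [/\ forall z, U z ->
          derivable (fun t : R => u (mkC t (complex.Im z))) (complex.Re z) 1,
        forall z, U z ->
          derivable (fun t : R => u (mkC (complex.Re z) t)) (complex.Im z) 1,
        Ck k' U (dx u) & Ck k' U (dy u)]
  end.

Definition fundamental_domain tau : set (R * R) :=
  [set p | exists s t : R, [/\ 0 <= s < 1, 0 <= t < 1 &
                             mkC p.1 p.2 = mkC s 0 + mkC t 0 * tau]].

Definition lebesgue2 := (@lebesgue_measure R \x @lebesgue_measure R)%E.

(* Functions on the torus minus the origin are lattice-periodic functions off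
   the lattice; integrals over the torus are taken over a fundamental
   parallelogram. The values of u on the lattice are irrelevant. *)
Definition is_solution tau u : Prop :=
  [/\ (forall z w, lattice tau w -> ~ lattice tau z -> u (z + w) = u z),
      Ck 2 (~` lattice tau) u,
      lebesgue2.-integrable (fundamental_domain tau)
        (fun p => (u (mkC p.1 p.2))%:E),
      lebesgue2.-integrable (fundamental_domain tau)
        (fun p => (expR (u (mkC p.1 p.2)))%:E) &
      forall h, (forall z w, lattice tau w -> h (z + w) = h z) ->
        (forall k, Ck k [set: C] h) ->
        (\int[lebesgue2]_(p in fundamental_domain tau)
           (u (mkC p.1 p.2) * laplacian h (mkC p.1 p.2) +
            expR (u (mkC p.1 p.2)) * h (mkC p.1 p.2))%:E)%E
        = (4 * pi * h 0)%:E].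

Definition is_the_solution tau u : Prop :=
  is_solution tau u /\
  forall v, is_solution tau v -> forall z, ~ lattice tau z -> v z = u z.

End MeanField.

(* The Riemann sphere; [None] is the point at infinity. *)
Definition P1 (R : realType) : Type := option (cplx R).

Section Sphere.
Context {R : realType}.
Local Notation C := (cplx R).
Implicit Types (tau z w a b : C) (f : C -> P1 R) (p : P1 R).

Definition P1opp p : P1 R := omap (fun w => - w) p.

(* For b = 0 this is meaningful only when a != 0. *)
Definition P1frac a b : P1 R := if b == 0 then None else Some (a / b).

Definition P1inv p : P1 R :=
  if p is Some w then P1frac 1 w else Some 0.

Definition P1scale (c : C) p : P1 R := omap (fun w => c * w) p.

(* f and 1/f in the affine coordinate; junk value 0 at the point sent to
   infinity by the chart. *)
Definition chart0 f : C -> C := fun z => odflt 0 (f z).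
Definition chartoo f : C -> C := chart0 (fun z => P1inv (f z)).

Definition holomorphic0 f a : Prop :=
  \forall z \near a, f z <> None /\ derivable (chart0 f) z 1.
Definition holomorphicoo f a : Prop :=
  \forall z \near a, f z <> Some 0 /\ derivable (chartoo f) z 1.

(* A meromorphic function on C is a holomorphic map C -> P^1 that is not
   identically infinite. *)
Definition meromorphic f : Prop :=
  (forall a, holomorphic0 f a \/ holomorphicoo f a) /\
  exists a, f a <> None.

Definition etale_at f a : Prop :=
  (holomorphic0 f a /\ derive1 (chart0 f) a <> 0) \/
  (holomorphicoo f a /\ derive1 (chartoo f) a <> 0).

Definition has_order f a (n : int) : Prop :=
  exists g : C -> C,
    [/\ \forall z \near a, derivable g z 1, g a <> 0 &
        \forall z \near a^', f z = Some ((z - a) ^ n * g z)].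

(* 8|f'|^2 / (1+|f|^2)^2, which is unchanged when f is replaced by 1/f; the
   latter is used at the poles of f. *)
Definition spherical_density f z : R :=
  let g := if f z is Some _ then chart0 f else chartoo f in
  8 * cabs (derive1 g z) ^+ 2 / (1 + cabs (g z) ^+ 2) ^+ 2.

(* Positivity is part of u = log(...), since [ln] is 0 on nonpositive reals. *)
Definition developing_map tau (u : C -> R) f : Prop :=
  meromorphic f /\
  forall z, ~ lattice tau z ->
    0 < spherical_density f z /\ u z = ln (spherical_density f z).

Definition type_I tau f : Prop :=
  (forall z, f (z + 1) = P1opp (f z)) /\
  (forall z, f (z + tau) = P1inv (f z)).

Definition order_zero_off_half tau f : Prop :=
  forall a, ~ lattice tau (a - 1 / 2) -> has_order f a 0.

Definition typeI_properties tau f : Prop :=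
  order_zero_off_half tau f /\
  (derive1 (chart0 f) 0 = 0 /\ derive1 (derive1 (chart0 f)) 0 <> 0) /\
  (forall z, ~ lattice tau z -> etale_at f z) /\
  type_I tau f /\
  (forall z, f (- z) = f z) /\
  f (tau / 2) = Some 1 /\
  has_order f (1 / 2) 1 /\
  has_order f (1 / 2 + tau) (-1).

(* The meromorphic function (wp(w) - wp(a)) / (wp(w) - wp(b)) of w; the poles
   of wp are removable and the value there is 1. *)
Definition wp_ratio tau a b w : P1 R :=
  if `[< lattice tau w >] then Some 1
  else P1frac (wp tau w - wp tau a) (wp tau w - wp tau b).

End Sphere.

(* Main.v *)
Require Import Defs.
From HB Require Import structures.
From mathcomp Require Import all_boot all_order all_algebra.
From mathcomp Require Import complex.
From mathcomp Require Import all_classical all_reals all_analysis.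
From mathcomp Require Import ring lra zify.
From mathcomp Require Import measurable_realfun.
Import Order.TTheory GRing.Theory Num.Theory.
Import numFieldNormedType.Exports.
Local Open Scope classical_set_scope.
Local Open Scope ring_scope.

(* The numerator [N] and the denominator [D] of the sigma quotient in (c) are
   entire, and up to a common nowhere vanishing factor the translations by [1]
   and [tau] act on [(N, D)] as [(N, -D)] and [(D, N)]; hence [f = N / D]
   satisfies (iv).  Both are combinations of [sigma^2] and [sigma^2 wp] at
   [z / 2], and [wp'(w) = - sigma(2 w) / sigma(w)^4]; so the Wronskian
   [N' D - N D'] is a constant multiple of [wsigma tau], and [f] is critical
   exactly on the lattice.  The quotient of two maps as in (b) extends to a
   zero-free entire function with periods [1] and [2 tau], which is constant by
   Liouville's theorem and equal to 1 at [tau / 2].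

   It remains to see that [v = ln (8 |W|^2 / (|N|^2 + |D|^2)^2)], where [W] is
   the Wronskian, solves the mean field equation.  Off the lattice,
   [laplacian v = - exp v] is Lagrange's identity for [|N|^2 + |D|^2].  Against
   a test function [h], the horizontal integral of [v laplacian h + exp v h] is
   the derivative of the flux of [v dy h - h dy v]; integrating over a period
   parallelogram leaves the jump of the flux across the real axis, where
   [v = ln |z|^2 + smooth] contributes a Poisson kernel of mass [4 pi]. *)

(** Since [u] is by hypothesis the unique solution, it equals [v] off the lattice as soon as [v]
    solves the equation, and [f] develops [v] by construction.

    In (b) the quotient has neither zeros nor poles because (i) and (vii) fix the orders at [1 / 2]
    and off its lattice class, and the translations in (iv), which negate or invert, carry the order
    at [1 / 2] through the whole class.

    The obstacle in the equation is the logarithmic pole of [v]. All lattice points lie at heights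
    [n * Im tau]; on any other horizontal line the [x] part of Green's identity integrates to zero
    over a period, so the strip between two such heights is exhausted from inside. A majorant of
    [|v|] in the height alone, with integrable logarithmic ends, serves both Fubini's theorem and
    dominated convergence.

    The function theory uses no contour integrals: a path integral is the increment of a primitive,
    Goursat's bisection yields primitives of entire functions, and Cauchy's estimate in an
    exponential coordinate gives Liouville's theorem and locally uniform limits. *)

Set Implicit Arguments.
Unset Strict Implicit.
Unset Printing Implicit Defensive.

(** * Pointwise continuity *)

Section ContinuityAt.
Context {K : numFieldType} {T : topologicalType}.
Implicit Types (f g : T -> K) (x : T).

Lemma cont_id (x : K) : {for x, continuous (fun y : K => y)}.
Proof. exact: cvg_id. Qed.

Lemma cont_cst (c : K) x : {for x, continuous (fun _ : T => c)}.
Proof. exact: (@cst_continuous T K c x). Qed.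

Lemma contD f g x : {for x, continuous f} -> {for x, continuous g} ->
  {for x, continuous (fun y => f y + g y)}.
Proof. exact: continuousD. Qed.

Lemma contN f x : {for x, continuous f} -> {for x, continuous (fun y => - f y)}.
Proof. exact: continuousN. Qed.

Lemma contB f g x : {for x, continuous f} -> {for x, continuous g} ->
  {for x, continuous (fun y => f y - g y)}.
Proof. exact: continuousB. Qed.

Lemma contM f g x : {for x, continuous f} -> {for x, continuous g} ->
  {for x, continuous (fun y => f y * g y)}.
Proof. exact: continuousM. Qed.

Lemma contcomp {U V : topologicalType} (h : U -> V) (g : T -> U) x :
  {for x, continuous g} -> {for g x, continuous h} -> {for x, continuous (fun y => h (g y))}.
Proof. by move=> h1 h2; exact: (continuous_comp h1 h2). Qed.

Lemma cont_epsP {V : pseudoMetricNormedZmodType K} (f : T -> V) x : {for x, continuous f} <->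
  forall eps, 0 < eps -> \forall y \near x, `|f x - f y| < eps.
Proof. exact: (@cvgrPdist_lt K V T (nbhs x) _ f (f x)). Qed.

End ContinuityAt.

(** * Differentiation rules over a numeric field *)

Section HasDeriv.
Context {K : numFieldType}.
Implicit Types (f g : K -> K) (x l : K).

(* Caratheodory's form of differentiability: the sum, product and chain rules become statements about continuity. *)
Definition has_deriv f x l := exists phi : K -> K,
  [/\ {for x, continuous phi}, phi x = l & forall y, f y = f x + phi y * (y - x)].

Lemma has_derivP f x l : has_deriv f x l <-> derivable f x 1 /\ derive1 f x = l.
Proof.
split.
- move=> [phi [cphi phix fE]].
  have H : h^-1 *: (f (h *: 1 + x) - f x) @[h --> 0^'] --> l.
    have -> : l = phi (0 + x) by rewrite add0r phix.
    have : phi (h + x) @[h --> 0^'] --> phi (0 + x).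
      have cs : {for 0, continuous (fun h : K => h + x)}.
        by apply: contD; [exact: cont_id|exact: cont_cst].
      have c : {for 0, continuous (fun h : K => phi (h + x))}.
        have cphi0 : {for 0 + x, continuous phi} by rewrite add0r.
        exact: (contcomp cs cphi0).
      by apply: cvg_trans c; apply: cvg_app; exact: cvg_within.
    apply: cvg_trans; apply: near_eq_cvg; near=> h.
    have h0 : h != 0 by near: h; exact: nbhs_dnbhs_neq.
    rewrite /GRing.scale /= mulr1 [f (h + x)]fE addrK [f x + _]addrC addrK mulrCA.
    by rewrite mulVf // mulr1.
  split; first by apply/cvg_ex; exists l.
  rewrite derive1E; exact: cvg_lim H.
- move=> [df d1].
  pose phi y := if y == x then l else (f y - f x) / (y - x).
  have phix : phi x = l by rewrite /phi eqxx.
  exists phi; split => //.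
  + apply/continuous_withinNx; rewrite phix -d1 derive1E.
    have H := df; move/cvgrPdist_lt in H; apply/cvgrPdist_lt => e e0.
    have {}H := H e e0; near=> y.
    have yx : y != x by near: y; exact: nbhs_dnbhs_neq.
    rewrite /phi (negbTE yx).
    suff : `|'D_1 f x - (y - x)^-1 *: (f ((y - x) *: 1 + x) - f x)| < e.
      by rewrite /GRing.scale /= mulr1 subrK [(y-x)^-1 * _]mulrC.
    near: y. rewrite /dnbhs /within /=; near_simpl.
    move: H => /nbhs_ballP [d d0 Hd]; apply/nbhs_ballP; exists d => // y yb yx.
    apply: Hd => /=; last by rewrite subr_eq0.
    by move: yb; rewrite /ball /= sub0r normrN -normrN opprB.
  + move=> y; rewrite /phi; case: eqP => [->|/eqP yx]; first by rewrite subrr mulr0 addr0.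
    by rewrite divfK ?subr_eq0 // addrC subrK.
Unshelve. all: by end_near.
Qed.

Lemma has_deriv_derivable f x l : has_deriv f x l -> derivable f x 1.
Proof. by move=> /has_derivP []. Qed.

Lemma has_derivE f x l : has_deriv f x l -> derive1 f x = l.
Proof. by move=> /has_derivP []. Qed.

Lemma derivable_has_deriv f x : derivable f x 1 -> has_deriv f x (derive1 f x).
Proof. by move=> h; apply/has_derivP. Qed.

Lemma has_deriv_uniq f x l l' : has_deriv f x l -> has_deriv f x l' -> l = l'.
Proof. by move=> /has_derivE <- /has_derivE. Qed.

Lemma has_deriv_near f g x l : (\forall y \near x, f y = g y) ->
  has_deriv f x l -> has_deriv g x l.
Proof.
move=> fg /has_derivP [df dl].
have /near_eq_derivable H : \forall y \near x, f y = g y := fg.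
have H2 : {near x, f =1 g} := fg.
apply/has_derivP; split; first by apply: H => //; exact: oner_neq0.
by rewrite -dl !derive1E; apply/esym/near_eq_derive => //; exact: oner_neq0.
Qed.

Lemma has_deriv_eq f x l l' : has_deriv f x l -> l = l' -> has_deriv f x l'.
Proof. by move=> h <-. Qed.

Lemma has_deriv_cont f x l : has_deriv f x l -> {for x, continuous f}.
Proof.
move=> [phi [cphi _ fE]].
rewrite (_ : f = fun y => f x + phi y * (y - x)); last by apply/funext.
apply: contD; first exact: cont_cst.
by apply: contM; [exact: cphi|apply: contB; [exact: cont_id|exact: cont_cst]].
Qed.

Lemma has_deriv_cst (c x : K) : has_deriv (fun _ => c) x 0.
Proof. by exists (fun _ => 0); split=> [||y]; [exact: cont_cst| |rewrite mul0r addr0]. Qed.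

Lemma has_deriv_id x : has_deriv (fun y => y) x 1.
Proof. by exists (fun _ => 1); split=> [||y]; [exact: cont_cst| |rewrite mul1r addrC subrK]. Qed.

Lemma has_derivD f g x l m : has_deriv f x l -> has_deriv g x m ->
  has_deriv (fun y => f y + g y) x (l + m).
Proof.
move=> [p [cp pl fE]] [q [cq ql gE]]; exists (fun y => p y + q y); split.
- exact: contD.
- by rewrite pl ql.
- by move=> y; rewrite fE gE; ring.
Qed.

Lemma has_derivN f x l : has_deriv f x l -> has_deriv (fun y => - f y) x (- l).
Proof.
move=> [p [cp pl fE]]; exists (fun y => - p y); split.
- exact: contN.
- by rewrite pl.
- by move=> y; rewrite fE; ring.
Qed.

Lemma has_derivB f g x l m : has_deriv f x l -> has_deriv g x m ->
  has_deriv (fun y => f y - g y) x (l - m).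
Proof. by move=> hf hg; apply: has_derivD hf (has_derivN hg). Qed.

Lemma has_derivM f g x l m : has_deriv f x l -> has_deriv g x m ->
  has_deriv (fun y => f y * g y) x (l * g x + f x * m).
Proof.
move=> hf hg; have cg := has_deriv_cont hg.
move: hf hg => [p [cp pl fE]] [q [cq ql gE]].
exists (fun y => p y * g y + f x * q y); split.
- by apply: contD; apply: contM => //; exact: cont_cst.
- by rewrite pl ql.
- move=> y; have e : f x * g y = f x * g x + f x * (q y * (y - x)) by rewrite {1}gE mulrDr.
  by rewrite {1}fE mulrDl e; ring.
Qed.

Lemma has_derivZ (c : K) f x l : has_deriv f x l -> has_deriv (fun y => c * f y) x (c * l).
Proof.
by move=> hf; apply: has_deriv_eq (has_derivM (has_deriv_cst c x) hf) _; rewrite mul0r add0r.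
Qed.

Lemma has_derivV f x l : f x != 0 -> has_deriv f x l ->
  has_deriv (fun y => (f y)^-1) x (- l / f x ^+ 2).
Proof.
move=> fx0 /has_derivP [df dl].
apply/has_derivP; split; first exact: derivableV.
by rewrite derive1E deriveV // -derive1E dl /GRing.scale /= mulNr mulNr mulrC.
Qed.

Lemma has_deriv_comp f g x l m : has_deriv g x l -> has_deriv f (g x) m ->
  has_deriv (fun y => f (g y)) x (m * l).
Proof.
move=> hg; have cg := has_deriv_cont hg; move: hg => [q [cq ql gE]] [p [cp pl fE]].
exists (fun y => p (g y) * q y); split.
- by apply: contM => //; apply: contcomp.
- by rewrite pl ql.
- move=> y; have e : p (g y) * (g y - g x) = p (g y) * (q y * (y - x)).
    by congr (_ * _); rewrite {1}gE addrC addKr.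
  by rewrite fE e mulrA.
Qed.

End HasDeriv.

(** * The real-valued modulus and the topology of the complex plane *)

Section ComplexModulus.
Context {R : realType}.
Local Notation C := (cplx R).
Implicit Types (z w : C).

Lemma normC_cabs z : `|z| = mkC (cabs z) 0.
Proof. by rewrite /cabs normc_def. Qed.

Lemma cabsE z : cabs z = Num.sqrt (complex.Re z ^+ 2 + complex.Im z ^+ 2).
Proof. by rewrite /cabs normc_def. Qed.

Lemma cplx_ext z w : complex.Re z = complex.Re w -> complex.Im z = complex.Im w -> z = w.
Proof. by case: z; case: w => a b c d /= -> ->. Qed.

Lemma mkC_eta z : mkC (complex.Re z) (complex.Im z) = z. Proof. by case: z. Qed.

Lemma ReD z w : complex.Re (z + w) = complex.Re z + complex.Re w. Proof. by case: z; case: w. Qed.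
Lemma ImD z w : complex.Im (z + w) = complex.Im z + complex.Im w. Proof. by case: z; case: w. Qed.
Lemma ReN z : complex.Re (- z) = - complex.Re z. Proof. by case: z. Qed.
Lemma ImN z : complex.Im (- z) = - complex.Im z. Proof. by case: z. Qed.
Lemma ReM z w : complex.Re (z * w) = complex.Re z * complex.Re w - complex.Im z * complex.Im w.
Proof. by case: z; case: w. Qed.
Lemma ImM z w : complex.Im (z * w) = complex.Re z * complex.Im w + complex.Im z * complex.Re w.
Proof. by case: z; case: w => a b c d /=; ring. Qed.

Lemma cabs_ge0 z : 0 <= cabs z. Proof. by rewrite cabsE sqrtr_ge0. Qed.

Lemma cabs_mkC z : `|z| = real_complex R (cabs z). Proof. exact: normC_cabs. Qed.

Lemma cabs_inj (x y : R) : real_complex R x = real_complex R y -> x = y.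
Proof. by case. Qed.

Lemma cabsM z w : cabs (z * w) = cabs z * cabs w.
Proof. by apply: cabs_inj; rewrite rmorphM /= -!cabs_mkC normrM. Qed.

Lemma cabsN z : cabs (- z) = cabs z. Proof. by rewrite /cabs normrN. Qed.

Lemma cabsC z w : cabs (z - w) = cabs (w - z). Proof. by rewrite -cabsN opprB. Qed.

Lemma cabs0 : cabs (0 : C) = 0. Proof. by rewrite /cabs normr0. Qed.
Lemma cabs1 : cabs (1 : C) = 1. Proof. by rewrite /cabs normr1. Qed.

Lemma cabs_eq0 z : (cabs z == 0) = (z == 0).
Proof.
apply/eqP/eqP => [h|->]; last exact: cabs0.
by apply/eqP; rewrite -normr_eq0 cabs_mkC h.
Qed.

Lemma cabs_gt0 z : (0 < cabs z) = (z != 0).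
Proof. by rewrite lt_neqAle cabs_ge0 andbT eq_sym cabs_eq0. Qed.

Lemma cabsV z : cabs z^-1 = (cabs z)^-1.
Proof. by apply: cabs_inj; rewrite fmorphV /= -!cabs_mkC normfV. Qed.

Lemma cabs_div z w : cabs (z / w) = cabs z / cabs w.
Proof. by rewrite cabsM cabsV. Qed.

Lemma cabsX z n : cabs (z ^+ n) = cabs z ^+ n.
Proof. by elim: n => [|n IH]; rewrite ?expr0 ?cabs1 // !exprS cabsM IH. Qed.

Lemma cabsD z w : cabs (z + w) <= cabs z + cabs w.
Proof.
have := ler_normD z w; rewrite !cabs_mkC -rmorphD.
by rewrite lecE /= => /andP[_].
Qed.

Lemma cabsB z w : cabs (z - w) <= cabs z + cabs w.
Proof. by rewrite -(cabsN w); exact: cabsD. Qed.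

Lemma cabs_distD v z w : cabs (z - w) <= cabs (z - v) + cabs (v - w).
Proof. by rewrite -[z - w](subrKA v); exact: cabsD. Qed.

Lemma cabs_lb z w : cabs z - cabs w <= cabs (z - w).
Proof. by rewrite lerBlDr -{1}(subrK w z) cabsD. Qed.

Lemma sqrtr_mono (x y : R) : x <= y -> Num.sqrt x <= Num.sqrt y.
Proof. by move=> xy; rewrite ler_wsqrtr. Qed.

Lemma Re_le_cabs z : `|complex.Re z| <= cabs z.
Proof. by rewrite cabsE -sqrtr_sqr; apply: sqrtr_mono; rewrite lerDl sqr_ge0. Qed.

Lemma Im_le_cabs z : `|complex.Im z| <= cabs z.
Proof. by rewrite cabsE -sqrtr_sqr; apply: sqrtr_mono; rewrite lerDr sqr_ge0. Qed.

Lemma cabs2 z : cabs z ^+ 2 = complex.Re z ^+ 2 + complex.Im z ^+ 2.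
Proof. by rewrite cabsE sqr_sqrtr // addr_ge0 // sqr_ge0. Qed.

Lemma cabs_le_ReIm z : cabs z <= `|complex.Re z| + `|complex.Im z|.
Proof.
rewrite -(@ler_pXn2r _ 2) ?nnegrE ?cabs_ge0 ?addr_ge0 // cabs2.
rewrite [leRHS]sqrrD !real_normK ?num_real //.
by have := mulr_ge0 (normr_ge0 (complex.Re z)) (normr_ge0 (complex.Im z)); lra.
Qed.

Lemma cabs_real (x : R) : cabs (mkC x 0) = `|x|.
Proof. by rewrite cabsE /= expr0n /= addr0 sqrtr_sqr. Qed.

Lemma cabs_imag (x : R) : cabs (mkC 0 x) = `|x|.
Proof. by rewrite cabsE /= expr0n /= add0r sqrtr_sqr. Qed.

Lemma mkC_int (k : int) : (k%:~R : C) = mkC k%:~R 0.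
Proof. by rewrite -(rmorph_int (real_complex R)). Qed.

Lemma mkC_nat (k : nat) : (k%:R : C) = mkC k%:R 0.
Proof. by rewrite -(rmorph_nat (real_complex R)). Qed.

Lemma cabs_nat (k : nat) : cabs (k%:R : C) = k%:R.
Proof. by rewrite mkC_nat cabs_real ger0_norm. Qed.

Lemma cabs_sum (I : Type) (r : seq I) (P : pred I) (F : I -> C) :
  cabs (\sum_(i <- r | P i) F i) <= \sum_(i <- r | P i) cabs (F i).
Proof.
elim/big_rec2: _ => [|i y x _ h]; first by rewrite cabs0.
by apply: le_trans (cabsD _ _) _; rewrite lerD2l.
Qed.

(** A radius is an element of [C], but a positive one is a positive real, so the balls of the
    numeric field are the Euclidean discs. *)
Lemma nearC z (P : set C) :
  (\forall w \near z, P w) <-> exists2 d : R, 0 < d & forall w, cabs (w - z) < d -> P w.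
Proof.
split.
- move=> /nbhs_ballP [[d d'] /= d0 Hd]; move: d0; rewrite ltcE /= => /andP[/eqP di d0].
  exists d => // w wd; apply: Hd; rewrite /ball /= cabs_mkC cabsC ltcE /= wd.
  by rewrite di eqxx.
- move=> [d d0 Hd]; apply/nbhs_ballP; exists (mkC d 0).
    by rewrite /= ltcE /= eqxx.
  move=> w; rewrite /ball /= cabs_mkC ltcE /= => /andP[_]; rewrite cabsC; exact: Hd.
Qed.

Lemma dnearC z (P : set C) :
  (\forall w \near z^', P w) <->
  exists2 d : R, 0 < d & forall w, w != z -> cabs (w - z) < d -> P w.
Proof.
split.
- by move/(nearC z (fun w => w != z -> P w)) => [d d0 Hd]; exists d => // w wz wd; exact: Hd.
- move=> [d d0 Hd]; apply/(nearC z (fun w => w != z -> P w)).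
  by exists d => // w wd wz; exact: Hd.
Qed.

Lemma contC (f : C -> C) z : {for z, continuous f} <->
  forall e : R, 0 < e -> exists2 d : R, 0 < d & forall w, cabs (w - z) < d -> cabs (f w - f z) < e.
Proof.
split.
- move=> /cont_epsP h e e0.
  have /h /nearC [d d0 Hd] : (0 : C) < mkC e 0 by rewrite ltcE /= eqxx.
  exists d => // w /Hd; rewrite cabs_mkC ltcE /= => /andP[_]; by rewrite cabsC.
- move=> h; apply/cont_epsP => -[e e']; rewrite ltcE /= => /andP[/eqP -> e0].
  have [d d0 Hd] := h e e0; apply/nearC; exists d => // w /Hd.
  by rewrite cabs_mkC ltcE /= eqxx cabsC.
Qed.

Lemma contCR (f : C -> R) z : {for z, continuous f} <->
  forall e : R, 0 < e -> exists2 d : R, 0 < d & forall w, cabs (w - z) < d -> `|f w - f z| < e.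
Proof.
split.
- move=> /cont_epsP h e e0.
  by have /nearC [d d0 Hd] := h e e0; exists d => // w /Hd; rewrite distrC.
- move=> h; apply/cont_epsP => e e0.
  by have [d d0 Hd] := h e e0; apply/nearC; exists d => // w /Hd; rewrite distrC.
Qed.

Lemma contRC (f : R -> C) (x : R) : {for x, continuous f} <->
  forall e : R, 0 < e -> exists2 d : R, 0 < d & forall y, `|y - x| < d -> cabs (f y - f x) < e.
Proof.
split.
- move=> /cont_epsP h e e0.
  have /h /nbhs_ballP [d d0 Hd] : (0 : C) < mkC e 0 by rewrite ltcE /= eqxx.
  exists d => // w wd; have := Hd w; rewrite /ball /= distrC => /(_ wd).
  by rewrite cabs_mkC ltcE /= => /andP[_]; rewrite cabsC.
- move=> h; apply/cont_epsP => -[e e']; rewrite ltcE /= => /andP[/eqP -> e0].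
  have [d d0 Hd] := h e e0; apply/nbhs_ballP; exists d => // w; rewrite /ball /= distrC => /Hd.
  by rewrite cabs_mkC ltcE /= eqxx cabsC.
Qed.

(** The weak inequality makes the condition true at [w = z] as well; in the converse, passing to
    [e / 2] makes it strict again. *)
Lemma has_derivC (f : C -> C) z l : has_deriv f z l <->
  forall e : R, 0 < e -> exists2 d : R, 0 < d &
    forall w, cabs (w - z) < d -> cabs (f w - f z - l * (w - z)) <= e * cabs (w - z).
Proof.
split.
- move=> [phi [/contC cphi pl fE]] e e0.
  have [d d0 Hd] := cphi e e0; exists d => // w /Hd /ltW h.
  rewrite fE [f z + _]addrC addrK -mulrBl -pl cabsM.
  by rewrite ler_wpM2r // cabs_ge0.
- move=> h; pose phi y := if y == z then l else (f y - f z) / (y - z).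
  exists phi; split; [|by rewrite /phi eqxx|].
  + apply/contC => e e0; have e20 : 0 < e / 2 by rewrite divr_gt0.
    have [d d0 Hd] := h _ e20; exists d => // w /Hd h1.
    rewrite /phi eqxx; case: eqP => [_|/eqP wz]; first by rewrite subrr cabs0.
    have wz' : w - z != 0 by rewrite subr_eq0.
    have -> : (f w - f z) / (w - z) - l = (f w - f z - l * (w - z)) / (w - z).
      by rewrite [RHS]mulrBl mulfK.
    rewrite cabs_div ltr_pdivrMr ?cabs_gt0 //; apply: le_lt_trans h1 _.
    by rewrite ltr_pM2r ?cabs_gt0 // ltr_pdivrMr // ltr_pMr // ltr1n.
  + move=> y; rewrite /phi; case: eqP => [->|/eqP yx]; first by rewrite subrr mulr0 addr0.
    by rewrite divfK ?subr_eq0 // addrC subrK.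
Qed.

Lemma contC_ReIm (f : C -> C) z : {for z, continuous f} <->
  {for z, continuous (fun w => complex.Re (f w))} /\
  {for z, continuous (fun w => complex.Im (f w))}.
Proof.
split.
- move=> /contC h; split; apply/contCR => e /h [d d0 Hd]; exists d => // w /Hd.
    by apply: le_lt_trans; have := Re_le_cabs (f w - f z); rewrite ReD ReN.
  by apply: le_lt_trans; have := Im_le_cabs (f w - f z); rewrite ImD ImN.
- move=> [/contCR h1 /contCR h2]; apply/contC => e e0.
  have e20 : 0 < e / 2 by rewrite divr_gt0.
  have [d1 d10 H1] := h1 _ e20; have [d2 d20 H2] := h2 _ e20.
  exists (Num.min d1 d2); first by rewrite lt_min d10.
  move=> w; rewrite lt_min => /andP[/H1 ? /H2 ?].
  apply: le_lt_trans (cabs_le_ReIm _) _; rewrite ReD ReN ImD ImN.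
  by rewrite [e]splitr ltrD.
Qed.

Lemma contRR (g : R -> R) (x : R) : {for x, continuous g} <->
  forall e : R, 0 < e -> exists2 d : R, 0 < d & forall y, `|y - x| < d -> `|g y - g x| < e.
Proof.
split.
- move=> /cont_epsP h e /h /nbhs_ballP [d d0 Hd]; exists d => // w wd.
  by have := Hd w; rewrite /ball /= distrC [ `|g x - _|]distrC => /(_ wd).
- move=> h; apply/cont_epsP => e /h [d d0 Hd]; apply/nbhs_ballP; exists d => // w.
  by rewrite /ball /= distrC [ `|g x - _|]distrC; exact: Hd.
Qed.

Lemma has_derivRR (f : R -> R) (x l : R) : has_deriv f x l ->
  forall e : R, 0 < e -> exists2 d : R, 0 < d &
    forall y, `|y - x| < d -> `|f y - f x - l * (y - x)| <= e * `|y - x|.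
Proof.
move=> [phi [/contRR cphi pl fE]] e /cphi [d d0 Hd]; exists d => // y /Hd /ltW h.
by rewrite fE [f x + _]addrC addrK -mulrBl -pl normrM ler_wpM2r.
Qed.

Lemma contRC_ReIm (f : R -> C) (x : R) : {for x, continuous f} <->
  {for x, continuous (fun w : R => complex.Re (f w))} /\
  {for x, continuous (fun w : R => complex.Im (f w))}.
Proof.
split.
- move=> /contRC h; split; apply/contRR => e /h [d d0 Hd]; exists d => // w /Hd.
    by apply: le_lt_trans; have := Re_le_cabs (f w - f x); rewrite ReD ReN.
  by apply: le_lt_trans; have := Im_le_cabs (f w - f x); rewrite ImD ImN.
- move=> [/contRR h1 /contRR h2]; apply/contRC => e e0.
  have e20 : 0 < e / 2 by rewrite divr_gt0.
  have [d1 d10 H1] := h1 _ e20; have [d2 d20 H2] := h2 _ e20.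
  exists (Num.min d1 d2); first by rewrite lt_min d10.
  move=> w; rewrite lt_min => /andP[/H1 ? /H2 ?].
  apply: le_lt_trans (cabs_le_ReIm _) _; rewrite ReD ReN ImD ImN.
  by rewrite [e]splitr ltrD.
Qed.

End ComplexModulus.

(** * Mean value inequality and primitives on the real line *)

Section RealLine.
Context {R : realType}.
Implicit Types (f F : R -> R).

Lemma has_deriv_is_derive (K : numFieldType) (f : K -> K) x l : has_deriv f x l <-> is_derive x 1 f l.
Proof.
split=> [/has_derivP [df dl]|h].
  by apply: DeriveDef => //; rewrite -dl derive1E.
by apply/has_derivP; split; [exact: ex_derive|rewrite derive1E; exact: derive_val].
Qed.

Lemma mvt_real F f (a b : R) : a <= b -> (forall x, a <= x <= b -> has_deriv F x (f x)) ->
  exists2 c, a <= c <= b & F b - F a = f c * (b - a).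
Proof.
move=> ab h.
have [||c] := @MVT_segment R F f a b ab.
- by move=> x; rewrite in_itv /= => /andP[ax xb]; apply/has_deriv_is_derive/h; rewrite !ltW.
- apply: derivable_within_continuous => x; rewrite in_itv /= => xab.
  exact: has_deriv_derivable (h x xab).
by rewrite in_itv /= => cab E; exists c.
Qed.

Lemma mvt_real_le F f (a b M : R) : a <= b -> (forall x, a <= x <= b -> has_deriv F x (f x)) ->
  (forall x, a <= x <= b -> f x <= M) -> F b - F a <= M * (b - a).
Proof.
move=> ab h hM; have [c cab ->] := mvt_real ab h.
by rewrite ler_wpM2r ?subr_ge0 // hM.
Qed.

Lemma deriv0_const F (a b : R) : (forall x, Num.min a b <= x <= Num.max a b -> has_deriv F x 0) -> F b = F a.
Proof.
wlog ab : a b / a <= b.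
  move=> H h; case: (leP a b) => [|/ltW] ab; first exact: H.
  by apply/esym/H => // x; rewrite minC maxC; exact: h.
rewrite min_l // max_r // => h.
by apply/eqP; rewrite -subr_eq0; have [c _ ->] := mvt_real ab h; rewrite mul0r.
Qed.

Lemma exists_primitive_itv f (n : R) : 0 < n -> continuous f ->
  exists F, forall x, - n < x < n -> has_deriv F x (f x).
Proof.
move=> n0 cf; exists (fun x => \int[lebesgue_measure]_(t in `[- n, x]) f t)%R => x /andP[nx xn].
have fi : lebesgue_measure.-integrable `[- n, n] (EFin \o f).
  apply: continuous_compact_integrable; first exact: segment_compact.
  exact: continuous_subspaceT.
have [h1 h2] := continuous_FTC1_closed xn fi nx (cf x).
by apply/has_derivP.
Qed.

(** Primitives on growing intervals, normalized to vanish at 0, agree where they overlap and can be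
    glued. *)
Lemma exists_primitive f : continuous f -> exists F, forall x, has_deriv F x (f x).
Proof.
move=> cf.
have /choice [P HP] : forall n : nat, exists F, forall x, - n.+1%:R < x < n.+1%:R -> has_deriv F x (f x).
  by move=> n; exact: exists_primitive_itv.
have agree (m n : nat) x : (m <= n)%N -> `|x| < m.+1%:R -> P m x - P m 0 = P n x - P n 0.
  move=> mn xm.
  suff : P m x - P n x = P m 0 - P n 0 by lra.
  apply: (@deriv0_const (fun y => P m y - P n y)) => y /andP[y1 y2].
  have ym : - m.+1%:R < y < m.+1%:R.
    have : 0 < (m.+1%:R : R) by rewrite ltr0Sn.
    have := xm; rewrite ltr_norml => /andP[? ?] ?.
    apply/andP; split; [apply: lt_le_trans y1|apply: le_lt_trans y2 _].
      by rewrite lt_min; apply/andP; split; lra.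
    by rewrite gt_max; apply/andP; split; lra.
  have mn' : (m.+1%:R : R) <= n.+1%:R by rewrite ler_nat.
  rewrite -(subrr (f y)); apply: has_derivB; apply: HP; first exact: ym.
  by case/andP: ym => ? ?; apply/andP; split; lra.
pose N (x : R) : nat := Num.truncn `|x|.
have Nx x : `|x| < (N x).+1%:R by rewrite truncnS_gt.
exists (fun x => P (N x) x - P (N x) 0) => x.
(* One more than the index of [x]: every point within distance 1 of [x] has index at most [M]. *)
pose M := (N x).+1.
have : has_deriv (fun y => P M y - P M 0) x (f x).
  rewrite -(subr0 (f x)); apply: has_derivB; last exact: has_deriv_cst.
  apply: HP; rewrite -ltr_norml; apply: lt_trans (Nx x) _.
  by rewrite ltr_nat.
apply: has_deriv_near.
apply/(@nbhs_ballP R R); exists 1; first exact: ltr01.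
move=> y; rewrite /ball /= => xy.
apply/esym/agree => //.
rewrite /M -ltnS -(ltr_nat R).
have h1 : (N y)%:R <= `|y| by have := @truncn_le R `|y|; rewrite normr_ge0.
have h2 : `|y| <= `|x| + `|x - y| by rewrite -[in leLHS](subKr x y); exact: ler_normB.
by have := Nx x; rewrite -[((N x).+2)%:R]natr1; lra.
Qed.

End RealLine.

(** * Differentiable curves in the plane *)

Section Paths.
Context {R : realType}.
Local Notation C := (cplx R).
Local Notation Re := complex.Re.
Local Notation Im := complex.Im.
Implicit Types (z w a b : C).

(** [has_deriv] has one field as source and target, so a curve is differentiated through its real
    and imaginary parts. *)
Definition path_deriv (g : R -> C) (t : R) (l : C) :=
  has_deriv (fun s => Re (g s)) t (Re l) /\ has_deriv (fun s => Im (g s)) t (Im l).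

Lemma path_derivD g h (t : R) l m : path_deriv g t l -> path_deriv h t m ->
  path_deriv (fun s => g s + h s) t (l + m).
Proof.
move=> [h1 h2] [h3 h4]; split; rewrite ?ReD ?ImD.
  by rewrite (_ : (fun _ => _) = fun s => Re (g s) + Re (h s)); [exact: has_derivD|apply/funext => s; rewrite ReD].
by rewrite (_ : (fun _ => _) = fun s => Im (g s) + Im (h s)); [exact: has_derivD|apply/funext => s; rewrite ImD].
Qed.

Lemma path_deriv_cst z t : path_deriv (fun _ => z) t 0.
Proof. by split; exact: has_deriv_cst. Qed.

Lemma path_derivZ (c : C) g (t : R) l : path_deriv g t l -> path_deriv (fun s => c * g s) t (c * l).
Proof.
move=> [h1 h2]; split.
  rewrite (_ : (fun _ => _) = fun s => Re c * Re (g s) - Im c * Im (g s)).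
    by rewrite ReM; apply: has_derivB; exact: has_derivZ.
  by apply/funext => s; rewrite ReM.
rewrite (_ : (fun _ => _) = fun s => Re c * Im (g s) + Im c * Re (g s)).
  by rewrite ImM; apply: has_derivD; exact: has_derivZ.
by apply/funext => s; rewrite ImM.
Qed.

Lemma path_derivN g (t : R) l : path_deriv g t l -> path_deriv (fun s => - g s) t (- l).
Proof.
move=> h; rewrite -mulN1r (_ : (fun _ => _) = fun s => (-1) * g s); first exact: path_derivZ.
by apply/funext => s; rewrite mulN1r.
Qed.

Lemma path_derivB g h (t : R) l m : path_deriv g t l -> path_deriv h t m ->
  path_deriv (fun s => g s - h s) t (l - m).
Proof. by move=> h1 h2; apply: path_derivD h1 (path_derivN h2). Qed.

Lemma path_deriv_real t : path_deriv (fun s => mkC s 0) t 1.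
Proof. by split; [exact: has_deriv_id|exact: has_deriv_cst]. Qed.

Lemma path_deriv_affine z w t : path_deriv (fun s => z + mkC s 0 * w) t w.
Proof.
rewrite -{2}(mulr1 w) -[w * 1]add0r; apply: path_derivD; first exact: path_deriv_cst.
rewrite (_ : (fun _ => _) = fun s => w * mkC s 0); last by apply/funext => s; rewrite mulrC.
by apply: path_derivZ; exact: path_deriv_real.
Qed.

Lemma path_deriv_cont g (t : R) l : path_deriv g t l -> {for t, continuous g}.
Proof. by move=> [/has_deriv_cont h1 /has_deriv_cont h2]; apply/contRC_ReIm. Qed.

Lemma path_deriv_comp (f : C -> C) g (t : R) l m : path_deriv g t l -> has_deriv f (g t) m ->
  path_deriv (fun s => f (g s)) t (m * l).
Proof.
move=> hg; have cg := path_deriv_cont hg.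
case: hg => [[p [cp pl pE]] [q [cq ql qE]]] [phi [cphi phil fE]].
pose r s : C := phi (g s) * mkC (p s) (q s).
have gE s : g s = g t + mkC (s - t) 0 * mkC (p s) (q s).
  apply: cplx_ext; rewrite ?ReD ?ImD ?ReM ?ImM /=.
    by rewrite mul0r subr0 pE [p s * _]mulrC.
  by rewrite mul0r addr0 qE [q s * _]mulrC.
have rE s : f (g s) = f (g t) + mkC (s - t) 0 * r s.
  by rewrite fE {2}(gE s) /r; ring.
have cphig : {for t, continuous (fun s => phi (g s))} by exact: contcomp cg cphi.
have /contRC_ReIm [c1 c2] := cphig.
split.
- exists (fun s => Re (r s)); split.
  + rewrite (_ : (fun _ => _) = fun s => Re (phi (g s)) * p s - Im (phi (g s)) * q s).
      by apply: contB; apply: contM.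
    by apply/funext => s; rewrite /r ReM.
  + by rewrite /r phil pl ql mkC_eta.
  + by move=> s; rewrite rE ReD ReM /= mul0r subr0 [Re (r s) * _]mulrC.
- exists (fun s => Im (r s)); split.
  + rewrite (_ : (fun _ => _) = fun s => Re (phi (g s)) * q s + Im (phi (g s)) * p s).
      by apply: contD; apply: contM.
    by apply/funext => s; rewrite /r ImM.
  + by rewrite /r phil pl ql mkC_eta.
  + by move=> s; rewrite rE ImD ImM /= mul0r addr0 [Im (r s) * _]mulrC.
Qed.

Lemma path_mvt (g dg : R -> C) (a b M : R) : a <= b ->
  (forall t, a <= t <= b -> path_deriv g t (dg t)) ->
  (forall t, a <= t <= b -> cabs (dg t) <= M) -> cabs (g b - g a) <= M * (b - a).
Proof.
move=> ab h hM; set d := g b - g a.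
have [->|d0] := eqVneq d 0.
  rewrite cabs0 mulr_ge0 ?subr_ge0 //.
  by apply: le_trans (hM a _); rewrite ?cabs_ge0 // lexx ab.
have cd : 0 < cabs d by rewrite cabs_gt0.
(* project onto the direction of the increment *)
pose G t := Re d * Re (g t) + Im d * Im (g t).
pose H t := Re d * Re (dg t) + Im d * Im (dg t).
have hG t : a <= t <= b -> has_deriv G t (H t).
  by move=> /h [h1 h2]; apply: has_derivD; apply: has_derivZ.
have hH t : a <= t <= b -> H t <= cabs d * M.
  move=> /hM hMt.
  have -> : H t = Re (dg t * mkC (Re d) (- Im d)) by rewrite ReM /= /H; ring.
  apply: le_trans (ler_norm _) _; apply: le_trans (Re_le_cabs _) _.
  rewrite cabsM mulrC; apply: ler_pM; rewrite ?cabs_ge0 //.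
  by rewrite !cabsE /= sqrrN.
have := mvt_real_le ab hG hH.
have -> : G b - G a = cabs d ^+ 2.
  by rewrite cabs2 /d ReD ReN ImD ImN /G /d ReD ReN ImD ImN; ring.
by rewrite expr2 -mulrA ler_pM2l.
Qed.

Lemma exists_path_primitive (g : R -> C) : continuous g -> exists G, forall t, path_deriv G t (g t).
Proof.
move=> cg.
have [F1 h1] : exists F, forall t, has_deriv F t (Re (g t)).
  by apply: exists_primitive => t; have /contRC_ReIm [] := cg t.
have [F2 h2] : exists F, forall t, has_deriv F t (Im (g t)).
  by apply: exists_primitive => t; have /contRC_ReIm [] := cg t.
by exists (fun t => mkC (F1 t) (F2 t)) => t; split.
Qed.

Lemma cmvt (f df : C -> C) z w M : (forall t : R, 0 <= t <= 1 -> has_deriv f (z + mkC t 0 * (w - z)) (df (z + mkC t 0 * (w - z)))) ->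
  (forall t : R, 0 <= t <= 1 -> cabs (df (z + mkC t 0 * (w - z))) <= M) ->
  cabs (f w - f z) <= M * cabs (w - z).
Proof.
move=> h hM.
have := @path_mvt (fun t => f (z + mkC t 0 * (w - z))) (fun t => df (z + mkC t 0 * (w - z)) * (w - z)) 0 1 (M * cabs (w - z)) ler01.
have -> : z + mkC 1 0 * (w - z) = w by rewrite mul1r addrC subrK.
have -> : z + mkC 0 0 * (w - z) = z by rewrite mul0r addr0.
rewrite subr0 mulr1; apply.
- move=> t t01; apply: path_deriv_comp (h t t01); exact: path_deriv_affine.
- by move=> t t01; rewrite cabsM ler_wpM2r ?cabs_ge0 // hM.
Qed.

Lemma segment_sub (t : R) z w : 0 <= t <= 1 -> cabs (z + mkC t 0 * (w - z) - z) <= cabs (w - z).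
Proof.
move=> /andP[t0 t1]; rewrite addrAC subrr add0r cabsM cabs_real ger0_norm //.
by rewrite ler_piMl // cabs_ge0.
Qed.

Lemma cderiv0_const (f : C -> C) z w : (forall z, has_deriv f z 0) -> f z = f w.
Proof.
move=> h; have := @cmvt f (fun _ => 0) w z 0 (fun t _ => h _).
rewrite mul0r => /(_ _) H; apply/eqP; rewrite -subr_eq0 -cabs_eq0.
by rewrite eq_le cabs_ge0 andbT H // => t _; rewrite cabs0.
Qed.

End Paths.

(** * The complex exponential *)

Section Exponential.
Context {R : realType}.
Local Notation C := (cplx R).
Implicit Types (z w : C).

Lemma cexpD z w : cexp (z + w) = cexp z * cexp w.
Proof.
by apply: cplx_ext; rewrite /cexp ?ReM ?ImM /= ReD ImD expRD ?cosD ?sinD; ring.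
Qed.

Lemma cexp0 : cexp (0 : C) = 1.
Proof. by rewrite /cexp /= expR0 cos0 sin0 mul1r mulr0. Qed.

Lemma cabs_cexp z : cabs (cexp z) = expR (complex.Re z).
Proof.
rewrite cabsE /= !exprMn -mulrDr cos2Dsin2 mulr1 sqrtr_sqr ger0_norm // expR_ge0.
Qed.

Lemma cexp_neq0 z : cexp z != 0.
Proof. by rewrite -cabs_gt0 cabs_cexp expR_gt0. Qed.

Lemma cexpN z : cexp (- z) = (cexp z)^-1.
Proof.
apply: (mulfI (cexp_neq0 z)).
by rewrite -cexpD subrr cexp0 divff // cexp_neq0.
Qed.

Lemma cexp_deriv0 : has_deriv (@cexp R) 0 1.
Proof.
apply/has_derivC => e e0.
have h1 : has_deriv (@expR R) 0 1.
  by apply: (@has_deriv_eq R _ _ (expR 0)); [apply/has_deriv_is_derive|rewrite expR0].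
have h2 : has_deriv (@cos R) 0 0.
  by apply: (@has_deriv_eq R _ _ (- sin 0)); [apply/has_deriv_is_derive|rewrite sin0 oppr0].
have h3 : has_deriv (@sin R) 0 1.
  by apply: (@has_deriv_eq R _ _ (cos 0)); [apply/has_deriv_is_derive|rewrite cos0].
(* The final estimate collects eight copies of [e' * c]: one and two from the real part, one and
   four from the imaginary part. *)
pose e' := Num.min (e / 8) 1.
have e'0 : 0 < e' by rewrite lt_min ltr01 divr_gt0.
have e'1 : e' <= 1 by rewrite ge_min lexx orbT.
have e'e : e' <= e / 8 by rewrite ge_min lexx.
clearbody e'.
have [d1 d10 H1] := has_derivRR h1 e'0.
have [d2 d20 H2] := has_derivRR h2 e'0.
have [d3 d30 H3] := has_derivRR h3 e'0.
exists (Num.min (Num.min d1 d2) (Num.min d3 e')); first by rewrite !lt_min d10 d20 d30 e'0.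
move=> w; rewrite !lt_min subr0 mul1r cexp0 => /andP[/andP[w1 w2] /andP[w3 w4]].
case: w => x y in w1 w2 w3 w4 *.
have xw := Re_le_cabs (x +i* y : C)%C; have yw := Im_le_cabs (x +i* y : C)%C.
rewrite /= in xw yw; set c := cabs _ in w1 w2 w3 w4 xw yw *.
have := H1 x; have := H2 y; have := H3 y.
rewrite !subr0 expR0 cos0 sin0 mul0r !mul1r !subr0.
move=> /(_ (le_lt_trans yw w3)) s1 /(_ (le_lt_trans yw w2)) c1 /(_ (le_lt_trans xw w1)) x1.
have c0 : 0 <= c := cabs_ge0 _.
have cosb : `|cos y| <= 1 by rewrite ler_norml cos_geN1 cos_le1.
have sinb : `|sin y| <= 1 by rewrite ler_norml sin_geN1 sin_le1.
have x2 : `|expR x - 1 - x| <= e' * c by apply: le_trans x1 _; rewrite ler_wpM2l // ltW.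
have c2 : `|cos y - 1| <= e' * c by apply: le_trans c1 _; rewrite ler_wpM2l // ltW.
have s2 : `|sin y - y| <= e' * c by apply: le_trans s1 _; rewrite ler_wpM2l // ltW.
have xb : `|x| <= e' by apply: le_trans xw (ltW w4).
have yb : `|y| <= c by [].
have ec : e' * c <= c by rewrite ler_piMl.
have xe : `|expR x - 1| <= 2 * c.
  have : `|expR x - 1| <= `|expR x - 1 - x| + `|x| by rewrite -{1}[expR x - 1](subrK x) ler_normD.
  by lra.
apply: le_trans (cabs_le_ReIm _) _.
rewrite !ReD !ImD !ReN !ImN /= !subr0.
have -> : expR x * cos y - 1 - x = (expR x - 1 - x) * cos y + (1 + x) * (cos y - 1) by ring.
have -> : expR x * sin y - y = (sin y - y) + (expR x - 1) * sin y by ring.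
have b1 : `|(expR x - 1 - x) * cos y| <= e' * c.
  by rewrite normrM -[leRHS]mulr1 ler_pM.
have b2 : `|(1 + x) * (cos y - 1)| <= 2 * (e' * c).
  rewrite normrM ler_pM //; apply: le_trans (ler_normD _ _) _; rewrite normr1; lra.
have cE : c <= e' by exact: ltW.
have b3 : `|(expR x - 1) * sin y| <= 4 * (e' * c).
  rewrite normrM.
  have siny : `|sin y| <= 2 * c.
    have : `|sin y| <= `|sin y - y| + `|y| by rewrite -{1}(subrK y (sin y)) ler_normD.
    by lra.
  have := ler_pM (normr_ge0 _) (normr_ge0 _) xe siny.
  have : c * c <= e' * c by rewrite ler_wpM2r.
  by lra.
apply: le_trans (lerD (ler_normD _ _) (ler_normD _ _)) _.
have : 8 * (e' * c) <= e * c by rewrite mulrA ler_wpM2r // -ler_pdivlMl // mulrC.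
by lra.
Qed.

Lemma cexp_deriv z : has_deriv (@cexp R) z (cexp z).
Proof.
rewrite (_ : cexp = fun w => cexp z * cexp (w - z)); last first.
  by apply/funext => w; rewrite -cexpD addrC subrK.
have h : has_deriv (fun w : C => w - z) z 1.
  by rewrite -[1]subr0; apply: has_derivB; [exact: has_deriv_id|exact: has_deriv_cst].
have h0 : has_deriv (@cexp R) (z - z) 1 by rewrite subrr; exact: cexp_deriv0.
have := has_derivZ (cexp z) (has_deriv_comp h h0).
by rewrite !mulr1 subrr cexp0 mulr1.
Qed.

Lemma cexp_2pi z : cexp (z + mkC 0 (pi *+ 2)) = cexp z.
Proof. by rewrite /cexp /= ReD ImD /= addr0 cosD2pi sinD2pi. Qed.

End Exponential.

(** * Goursat's theorem for rectangles *)

Section Goursat.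
Context {R : realType}.
Local Notation C := (cplx R).
Local Notation Re := complex.Re.
Local Notation Im := complex.Im.
Implicit Types (z w : C).

Definition entire (f : C -> C) := forall z, exists l, has_deriv f z l.

Lemma entire_deriv f z : entire f -> has_deriv f z (derive1 f z).
Proof. by move=> /(_ z) [l hl]; rewrite (has_derivE hl). Qed.

Lemma entire_cont f z : entire f -> {for z, continuous f}.
Proof. by move=> /(_ z) [l]; exact: has_deriv_cont. Qed.

Lemma path_mvt_dist (g dg : R -> C) (a b M : R) :
  (forall t, Num.min a b <= t <= Num.max a b -> path_deriv g t (dg t)) ->
  (forall t, Num.min a b <= t <= Num.max a b -> cabs (dg t) <= M) -> cabs (g b - g a) <= M * `|b - a|.
Proof.
case: (leP a b) => [ab|/ltW ab] h hM.
  by rewrite ger0_norm ?subr_ge0 //; exact: path_mvt hM.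
by rewrite cabsC distrC ger0_norm ?subr_ge0 //; exact: path_mvt hM.
Qed.

Lemma path_deriv_horizontal (y t : R) : path_deriv (fun s => mkC s y) t (1 : C).
Proof. by split; [exact: has_deriv_id|exact: has_deriv_cst]. Qed.

Lemma path_deriv_vertical (x t : R) : path_deriv (fun s => mkC x s) t (mkC 0 1).
Proof. by split; [exact: has_deriv_cst|exact: has_deriv_id]. Qed.

Variable f : C -> C.
Hypothesis ef : entire f.
Variables PH PV : R -> R -> C.
Hypothesis hPH : forall y t, path_deriv (PH y) t (f (mkC t y)).
Hypothesis hPV : forall x t, path_deriv (PV x) t (f (mkC x t) * mkC 0 1).

(** The integral of [f] around the boundary of the rectangle, counterclockwise, as increments of
    primitives along the four sides. *)
Let I x x' y y' := (PH y x' - PH y x) + (PV x' y' - PV x' y) -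
  (PH y' x' - PH y' x) - (PV x y' - PV x y).

(** The affine function has a primitive [A] in the plane, whose increments cancel around the
    rectangle; only the deviation of [f] contributes, side by side through the mean value
    inequality. *)
Let I_affine_bound x x' y y' (al be p : C) (M : R) : x <= x' -> y <= y' ->
  (forall s t, x <= s <= x' -> y <= t <= y' ->
     cabs (f (mkC s t) - (al + be * (mkC s t - p))) <= M) ->
  cabs (I x x' y y') <= M * (2 * ((x' - x) + (y' - y))).
Proof.
move=> xx yy hM.
pose A w := al * w + be / 2 * ((w - p) * (w - p)).
have hA w : has_deriv A w (al + be * (w - p)).
  have h1 : has_deriv (fun w : C => w - p) w 1.
    by rewrite -[1]subr0; apply: has_derivB; [exact: has_deriv_id|exact: has_deriv_cst].
  have := has_derivD (has_derivZ al (has_deriv_id w)) (has_derivZ (be / 2) (has_derivM h1 h1)).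
  by move/has_deriv_eq; apply; field.
have bH t : y <= t <= y' -> cabs (PH t x' - PH t x - (A (mkC x' t) - A (mkC x t))) <= M * (x' - x).
  move=> ht.
  have -> : PH t x' - PH t x - (A (mkC x' t) - A (mkC x t)) =
    (PH t x' - A (mkC x' t)) - (PH t x - A (mkC x t)) by ring.
  apply: (@path_mvt R (fun s => PH t s - A (mkC s t))
    (fun s => f (mkC s t) - (al + be * (mkC s t - p)))) => // s hs; last exact: hM.
  apply: path_derivB => //.
  by rewrite -[X in path_deriv _ _ X]mulr1; apply: path_deriv_comp (hA _); exact: path_deriv_horizontal.
have bV s : x <= s <= x' -> cabs (PV s y' - PV s y - (A (mkC s y') - A (mkC s y))) <= M * (y' - y).
  move=> hs.
  have -> : PV s y' - PV s y - (A (mkC s y') - A (mkC s y)) =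
    (PV s y' - A (mkC s y')) - (PV s y - A (mkC s y)) by ring.
  apply: (@path_mvt R (fun t => PV s t - A (mkC s t))
    (fun t => (f (mkC s t) - (al + be * (mkC s t - p))) * mkC 0 1)) => // t ht; last first.
    by rewrite cabsM cabs_imag normr1 mulr1; exact: hM.
  rewrite mulrBl; apply: path_derivB => //.
  by apply: path_deriv_comp (hA _); exact: path_deriv_vertical.
have hx : x <= x <= x' by rewrite lexx. have hx' : x <= x' <= x' by rewrite lexx andbT.
have hy : y <= y <= y' by rewrite lexx. have hy' : y <= y' <= y' by rewrite lexx andbT.
have -> : I x x' y y' =
  ((PH y x' - PH y x - (A (mkC x' y) - A (mkC x y))) -
   (PH y' x' - PH y' x - (A (mkC x' y') - A (mkC x y')))) +
  ((PV x' y' - PV x' y - (A (mkC x' y') - A (mkC x' y))) -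
   (PV x y' - PV x y - (A (mkC x y') - A (mkC x y)))) by rewrite /I; ring.
apply: le_trans (cabsD _ _) _.
apply: le_trans (lerD (cabsB _ _) (cabsB _ _)) _.
have := bH _ hy; have := bH _ hy'; have := bV _ hx; have := bV _ hx'.
by lra.
Qed.

Let half (a : R) n := a / 2 ^+ n.

Let halfS a n : half a n = half a n.+1 + half a n.+1.
Proof. by rewrite /half exprS; field. Qed.

Let Q a b n x y := I x (x + half a n) y (y + half b n).

(** The integral is the sum over the four quarters, so one of them carries at least a fourth of
    it. *)
Let Q_step a b n x y : 0 <= a -> 0 <= b -> exists xy : R * R,
  [/\ x <= xy.1, xy.1 + half a n.+1 <= x + half a n, y <= xy.2, xy.2 + half b n.+1 <= y + half b n &
    cabs (Q a b n x y) <= 4 * cabs (Q a b n.+1 xy.1 xy.2)].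
Proof.
move=> a0 b0.
have ha : 0 <= half a n.+1 by rewrite divr_ge0 // exprn_ge0.
have hb : 0 <= half b n.+1 by rewrite divr_ge0 // exprn_ge0.
set h := half a n.+1 in ha *; set k := half b n.+1 in hb *.
pose q1 := Q a b n.+1 x y; pose q2 := Q a b n.+1 (x + h) y.
pose q3 := Q a b n.+1 x (y + k); pose q4 := Q a b n.+1 (x + h) (y + k).
have E : Q a b n x y = (q1 + q2) + (q3 + q4).
  by rewrite /q1 /q2 /q3 /q4 /Q /I (halfS a) (halfS b) -/h -/k !addrA; ring.
have B : cabs (Q a b n x y) <= (cabs q1 + cabs q2) + (cabs q3 + cabs q4).
  by rewrite E; apply: le_trans (cabsD _ _) _; apply: lerD; exact: cabsD.
have [H1|H1] := leP (cabs (Q a b n x y)) (4 * cabs q1).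
  by exists (x, y); rewrite /= (halfS a) (halfS b) -/h -/k; split => //; lra.
have [H2|H2] := leP (cabs (Q a b n x y)) (4 * cabs q2).
  by exists (x + h, y); rewrite /= (halfS a) (halfS b) -/h -/k; split => //; lra.
have [H3|H3] := leP (cabs (Q a b n x y)) (4 * cabs q3).
  by exists (x, y + k); rewrite /= (halfS a) (halfS b) -/h -/k; split => //; lra.
exists (x + h, y + k); rewrite /= (halfS a) (halfS b) -/h -/k; split => //; try lra.
Qed.

Let nested_limit (u : nat -> R) a : 0 <= a -> (forall n, u n <= u n.+1 /\ u n.+1 + half a n.+1 <= u n + half a n) ->
  exists p, forall n, u n <= p <= u n + half a n.
Proof.
move=> a0 hu.
have mono m n : u m <= u (m + n)%N.
  elim: n => [|n IH]; first by rewrite addn0.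
  by rewrite addnS; apply: le_trans IH _; case: (hu (m + n)%N).
have anti m n : u (m + n)%N + half a (m + n) <= u m + half a m.
  elim: n => [|n IH]; first by rewrite addn0.
  by rewrite addnS; apply: le_trans IH; case: (hu (m + n)%N).
have ha n : 0 <= half a n by rewrite divr_ge0 // exprn_ge0.
have cross m n : u m <= u n + half a n.
  have h1 := mono m n; have h2 := anti n m; rewrite addnC in h2.
  by have := ha (m + n)%N; lra.
pose S := [set r | exists n, r = u n].
have S0 : S !=set0 by exists (u 0%N), 0%N.
exists (sup S) => n; apply/andP; split.
  apply: ub_le_sup; last by exists n.
  by exists (u 0%N + half a 0) => r [m ->]; exact: cross.
by apply: ge_sup => // r [m ->]; exact: cross.
Qed.

(** Bisection leads to nested rectangles with a common point [p]. Differentiability at [p] bounds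
    the [n]-th integral by [2 * e] times the square of its half perimeter [s / 2 ^+ n], and this
    square absorbs the factor [4 ^+ n] lost by bisecting. *)
Let I0_ordered x x' y y' : x <= x' -> y <= y' -> I x x' y y' = 0.
Proof.
move=> xx yy.
pose a := x' - x; pose b := y' - y.
have a0 : 0 <= a by rewrite subr_ge0.
have b0 : 0 <= b by rewrite subr_ge0.
have /choice [next hnext] : forall nxy : nat * (R * R), exists xy : R * R,
  [/\ nxy.2.1 <= xy.1, xy.1 + half a nxy.1.+1 <= nxy.2.1 + half a nxy.1,
      nxy.2.2 <= xy.2, xy.2 + half b nxy.1.+1 <= nxy.2.2 + half b nxy.1 &
    cabs (Q a b nxy.1 nxy.2.1 nxy.2.2) <= 4 * cabs (Q a b nxy.1.+1 xy.1 xy.2)].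
  by move=> [n [s t]]; exact: Q_step.
pose fix c n := if n is n'.+1 then next (n', c n') else (x, y).
have hc n := hnext (n, c n).
have [p1 Hp1] : exists p, forall n, (c n).1 <= p <= (c n).1 + half a n.
  by apply: nested_limit => // n; case: (hc n) => /=.
have [p2 Hp2] : exists p, forall n, (c n).2 <= p <= (c n).2 + half b n.
  by apply: nested_limit => // n; case: (hc n) => /=.
have grow n : cabs (I x x' y y') <= 4 ^+ n * cabs (Q a b n (c n).1 (c n).2).
  elim: n => [|n IH].
    by rewrite /= mul1r /Q /half expr0 !divr1 /a /b ![_ + (_ - _)]addrC !subrK.
  apply: le_trans IH _; rewrite exprSr -mulrA ler_wpM2l ?exprn_ge0 //.
  by case: (hc n).
pose p : C := mkC p1 p2.
have [l hl] := ef p; move/has_derivC in hl.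
pose s := a + b.
have s0 : 0 <= s by rewrite addr_ge0.
have key e : 0 < e -> cabs (I x x' y y') <= e * (2 * (s * s)).
  move=> e0; have [d d0 Hd] := hl e e0.
  have [n hn] : exists n : nat, s / 2 ^+ n < d.
    exists (Num.truncn (s / d)); rewrite ltr_pdivrMr ?exprn_gt0 // mulrC -ltr_pdivrMr //.
    apply: lt_le_trans (truncnS_gt _) _.
    by rewrite -natrX ler_nat; exact: ltn_expl.
  have Qb : cabs (Q a b n (c n).1 (c n).2) <= e * (s / 2 ^+ n) * (2 * (s / 2 ^+ n)).
    have -> : s / 2 ^+ n = half a n + half b n by rewrite /s /half mulrDl.
    have ha : 0 <= half a n by rewrite divr_ge0 // exprn_ge0.
    have hb : 0 <= half b n by rewrite divr_ge0 // exprn_ge0.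
    have {2}-> : half a n + half b n = ((c n).1 + half a n - (c n).1) + ((c n).2 + half b n - (c n).2) by ring.
    apply: (I_affine_bound (al := f p) (be := l) (p := p)); rewrite ?lerDl //.
    move=> s1 t1 hs ht.
    have dist : cabs (mkC s1 t1 - p) <= half a n + half b n.
      apply: le_trans (cabs_le_ReIm _) _; rewrite ReD ReN ImD ImN /=.
      have := Hp1 n; have := Hp2 n.
      move: hs ht => /andP[? ?] /andP[? ?] /andP[? ?] /andP[? ?].
      by apply: lerD; rewrite ler_norml; apply/andP; split; lra.
    rewrite opprD addrA; apply: le_trans (Hd _ _) _.
      by apply: le_lt_trans dist _; rewrite /half -mulrDl.
    by rewrite ler_wpM2l // ltW.
  apply: le_trans (grow n) _.
  apply: le_trans (_ : 4 ^+ n * (e * (s / 2 ^+ n) * (2 * (s / 2 ^+ n))) <= _).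
    by rewrite ler_wpM2l // exprn_ge0.
  rewrite (_ : 4 ^+ n = 2 ^+ n * 2 ^+ n :> R); last by rewrite -exprMn; congr (_ ^+ _); ring.
  have n0 : 2 ^+ n != 0 :> R by rewrite expf_neq0.
  by rewrite le_eqVlt; apply/orP; left; apply/eqP; field.
apply/eqP; rewrite -cabs_eq0 eq_le cabs_ge0 andbT leNgt; apply/negP => h.
have ss : 0 < 2 * (s * s) + 1 by rewrite ltr_wpDl // mulr_ge0 // mulr_ge0.
(* For this [e] the bound is at most half of the integral itself; the [+ 1] keeps the divisor
   positive when the rectangle is a point. *)
have := key (cabs (I x x' y y') / (2 * (2 * (s * s) + 1))).
rewrite divr_gt0 // ?mulr_gt0 // => /(_ isT).
set q := cabs _ in h *.
rewrite mulrAC ler_pdivlMr ?mulr_gt0 //.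
have : 0 <= q * (s * s) by rewrite mulr_ge0 ?(ltW h) // mulr_ge0.
by lra.
Qed.

Lemma rectangle0 x x' y y' : (PH y x' - PH y x) + (PV x' y' - PV x' y) =
  (PH y' x' - PH y' x) + (PV x y' - PV x y).
Proof.
suff : I x x' y y' = 0 by rewrite /I -addrA -opprD => /eqP; rewrite subr_eq0 => /eqP.
have swx u u' v v' : I u u' v v' = - I u' u v v' by rewrite /I; ring.
have swy u u' v v' : I u u' v v' = - I u u' v' v by rewrite /I; ring.
case: (leP x x') => [|/ltW] xx; case: (leP y y') => [|/ltW] yy.
- exact: I0_ordered.
- by rewrite swy I0_ordered // oppr0.
- by rewrite swx I0_ordered // oppr0.
- by rewrite swx swy I0_ordered // !oppr0.
Qed.

End Goursat.

(** * Primitives of entire functions, Cauchy's estimate and Liouville's theorem *)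

Section Cauchy.
Context {R : realType}.
Local Notation C := (cplx R).
Local Notation Re := complex.Re.
Local Notation Im := complex.Im.
Implicit Types (z w a : C) (f : C -> C).

(** The primitive integrates along the real axis and then vertically. By [rectangle0] its increment
    from [z] can be taken along an L-shaped path starting at [z], where [f] is close to [f z]. *)
Lemma exists_cprimitive f : entire f -> exists F, forall z, has_deriv F z (f z).
Proof.
move=> ef.
have cH y : continuous (fun t => f (mkC t y)).
  move=> t; apply: (@path_deriv_cont R _ _ (derive1 f (mkC t y) * 1)).
  by apply: path_deriv_comp (entire_deriv _ ef); exact: path_deriv_horizontal.
have cV x : continuous (fun t => f (mkC x t) * mkC 0 1).
  move=> t; apply: (path_deriv_cont (l := (derive1 f (mkC x t) * mkC 0 1) * mkC 0 1)).
  rewrite (_ : (fun _ => _) = fun s => mkC 0 1 * f (mkC x s)); last by apply/funext => s; rewrite mulrC.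
  rewrite [X in path_deriv _ _ X]mulrC; apply: path_derivZ.
  by apply: path_deriv_comp (entire_deriv _ ef); exact: path_deriv_vertical.
have /choice [PH hPH] y := exists_path_primitive (cH y).
have /choice [PV hPV] x := exists_path_primitive (cV x).
exists (fun z => PH 0 (Re z) + (PV (Re z) (Im z) - PV (Re z) 0)) => z.
have inc w : PH 0 (Re w) + (PV (Re w) (Im w) - PV (Re w) 0) -
   (PH 0 (Re z) + (PV (Re z) (Im z) - PV (Re z) 0)) =
   (PH (Im z) (Re w) - PH (Im z) (Re z)) + (PV (Re w) (Im w) - PV (Re w) (Im z)).
  have := rectangle0 ef hPH hPV (Re z) (Re w) 0 (Im z).
  move/eqP; rewrite -subr_eq0 => /eqP E.
  by rewrite -[LHS]subr0 -E; ring.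
apply/has_derivC => e e0.
have e20 : 0 < e / 2 by rewrite divr_gt0.
have /contC /(_ _ e20) [d d0 Hd] := @entire_cont R f z ef.
exists (d / 2); first by rewrite divr_gt0.
move=> w wz; rewrite inc.
have wzR : `|Re w - Re z| <= cabs (w - z) by have := Re_le_cabs (w - z); rewrite ReD ReN.
have wzI : `|Im w - Im z| <= cabs (w - z) by have := Im_le_cabs (w - z); rewrite ImD ImN.
have btw (u v t : R) : Num.min u v <= t <= Num.max u v -> `|t - u| <= `|v - u|.
  case: (leP u v) => [uv|/ltW uv] /andP[? ?].
    by rewrite !ger0_norm; lra.
  by rewrite !ler0_norm; lra.
have bH : cabs (PH (Im z) (Re w) - PH (Im z) (Re z) - mkC (Re w - Re z) 0 * f z) <= e / 2 * `|Re w - Re z|.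
  have -> : PH (Im z) (Re w) - PH (Im z) (Re z) - mkC (Re w - Re z) 0 * f z =
    (PH (Im z) (Re w) - (0 + mkC (Re w) 0 * f z)) - (PH (Im z) (Re z) - (0 + mkC (Re z) 0 * f z)).
    have -> : mkC (Re w - Re z) 0 = mkC (Re w) 0 - mkC (Re z) 0 by apply: cplx_ext; rewrite /= ?subrr.
    by ring.
  apply: (@path_mvt_dist R (fun t => PH (Im z) t - (0 + mkC t 0 * f z)) (fun t => f (mkC t (Im z)) - f z)) => t ht.
    by apply: path_derivB (hPH _ _) _; exact: path_deriv_affine.
  apply/ltW/Hd.
  have -> : mkC t (Im z) - z = mkC (t - Re z) 0 by apply: cplx_ext; rewrite ?ReD ?ImD ?ReN ?ImN /= ?subrr.
  by rewrite cabs_real; apply: le_lt_trans (btw _ _ _ ht) _; have := cabs_ge0 (w - z); lra.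
have bV : cabs (PV (Re w) (Im w) - PV (Re w) (Im z) - mkC (Im w - Im z) 0 * (f z * mkC 0 1)) <= e / 2 * `|Im w - Im z|.
  have -> : PV (Re w) (Im w) - PV (Re w) (Im z) - mkC (Im w - Im z) 0 * (f z * mkC 0 1) =
    (PV (Re w) (Im w) - (0 + mkC (Im w) 0 * (f z * mkC 0 1))) - (PV (Re w) (Im z) - (0 + mkC (Im z) 0 * (f z * mkC 0 1))).
    have -> : mkC (Im w - Im z) 0 = mkC (Im w) 0 - mkC (Im z) 0 by apply: cplx_ext; rewrite /= ?subrr.
    by ring.
  apply: (@path_mvt_dist R (fun t => PV (Re w) t - (0 + mkC t 0 * (f z * mkC 0 1))) (fun t => (f (mkC (Re w) t) - f z) * mkC 0 1)) => t ht.
    by rewrite mulrBl; apply: path_derivB (hPV _ _) _; exact: path_deriv_affine.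
  rewrite cabsM cabs_imag normr1 mulr1.
  apply/ltW/Hd.
  apply: le_lt_trans (cabs_le_ReIm _) _; rewrite ReD ImD ReN ImN /=.
  by have := btw _ _ _ ht; lra.
have -> : PH (Im z) (Re w) - PH (Im z) (Re z) + (PV (Re w) (Im w) - PV (Re w) (Im z)) - f z * (w - z) =
  (PH (Im z) (Re w) - PH (Im z) (Re z) - mkC (Re w - Re z) 0 * f z) +
  (PV (Re w) (Im w) - PV (Re w) (Im z) - mkC (Im w - Im z) 0 * (f z * mkC 0 1)).
  have -> : w - z = mkC (Re w - Re z) 0 + mkC (Im w - Im z) 0 * mkC 0 1.
    by apply: cplx_ext; rewrite ?ReD ?ImD ?ReM ?ImM ?ReN ?ImN /=; ring.
  by ring.
apply: le_trans (cabsD _ _) _; apply: le_trans (lerD bH bV) _.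
by rewrite -mulrDr mulrAC ler_pdivrMr // -mulrA ler_pM2l //; lra.
Qed.

Lemma entire_cst (c : C) : entire (fun _ => c).
Proof. by move=> z; exists 0; exact: has_deriv_cst. Qed.

Lemma entire_id : entire (fun z : C => z).
Proof. by move=> z; exists 1; exact: has_deriv_id. Qed.

Lemma entireD f g : entire f -> entire g -> entire (fun z => f z + g z).
Proof. by move=> hf hg z; eexists; apply: has_derivD; exact: entire_deriv. Qed.

Lemma entireN f : entire f -> entire (fun z => - f z).
Proof. by move=> hf z; eexists; apply: has_derivN; exact: entire_deriv. Qed.

Lemma entireB f g : entire f -> entire g -> entire (fun z => f z - g z).
Proof. by move=> hf hg z; eexists; apply: has_derivB; exact: entire_deriv. Qed.

Lemma entireM f g : entire f -> entire g -> entire (fun z => f z * g z).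
Proof. by move=> hf hg z; eexists; apply: has_derivM; exact: entire_deriv. Qed.

Lemma entireX f n : entire f -> entire (fun z => f z ^+ n).
Proof.
move=> hf; elim: n => [|n IH].
  by rewrite (_ : (fun _ => _) = fun _ => 1); [exact: entire_cst|apply/funext => z; rewrite expr0].
rewrite (_ : (fun _ => _) = fun z => f z * f z ^+ n); first exact: entireM.
by apply/funext => z; rewrite exprS.
Qed.

Lemma entire_comp f g : entire f -> entire g -> entire (fun z => f (g z)).
Proof. by move=> hf hg z; eexists; apply: has_deriv_comp; exact: entire_deriv. Qed.

Lemma entire_cexp : entire (@cexp R).
Proof. by move=> z; eexists; exact: cexp_deriv. Qed.

Lemma entire_affine a b : entire (fun z => a * z + b).
Proof. by apply: entireD (entire_cst _); apply: entireM (entire_cst _) entire_id. Qed.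

Lemma entire_prod (I : Type) (r : seq I) (P : pred I) (F : I -> C -> C) :
  (forall i, P i -> entire (F i)) -> entire (fun z => \prod_(i <- r | P i) F i z).
Proof.
move=> h; elim: r => [|i r IH].
  by rewrite (_ : (fun _ => _) = fun _ => 1); [exact: entire_cst|apply/funext => z; rewrite big_nil].
rewrite (_ : (fun _ => _) = fun z => (if P i then F i z else 1) * \prod_(j <- r | P j) F j z).
  apply: entireM IH; case: (boolP (P i)) => [/h //|_]; exact: entire_cst.
by apply/funext => z; rewrite big_cons; case: ifP; rewrite ?mul1r.
Qed.

(* In the coordinate w -> a + e^w a circle around a becomes a vertical segment of length 2 pi, and
   the increment along it of a primitive of f(a + e^w) e^(-w) does not depend on the radius. Letting
   the radius tend to 0 shows that it equals 2 pi i f'(a). *)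
Lemma cauchy_estimate f a (r M : R) : entire f -> 0 < r ->
  (forall w, cabs (w - a) = r -> cabs (f w) <= M) -> cabs (derive1 f a) <= M / r.
Proof.
move=> ef r0 hM.
pose g w := f (a + cexp w) * cexp (- w).
have eN : entire (fun w : C => - w) by exact: entireN entire_id.
have eg : entire g.
  apply: entireM; last exact: entire_comp entire_cexp eN.
  by apply: entire_comp ef _; apply: entireD (entire_cst _) entire_cexp.
have [G hG] := exists_cprimitive eg.
pose T : C := mkC 0 (pi *+ 2).
have gT w : g (w + T) = g w by rewrite /g -[cexp (- (w + T))]cexp_2pi opprD subrK cexp_2pi.
pose c0 := G T - G 0.
have hc w : G (w + T) - G w = c0.
  rewrite /c0 -[in G T](add0r T).
  apply: (@cderiv0_const R (fun w => G (w + T) - G w)) => v.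
  have h1 : has_deriv (fun w => G (w + T)) v (g v).
    rewrite -(gT v) -[g (v + T)]mulr1; apply: (has_deriv_comp (g := fun v => v + T)) (hG _).
    by rewrite -[X in has_deriv _ _ X]addr0; apply: has_derivD; [exact: has_deriv_id|exact: has_deriv_cst].
  by have := has_derivB h1 (hG v); rewrite subrr.
have pi2 : 0 < pi *+ 2 :> R by rewrite pmulrn_lgt0 // pi_gt0.
have seg (h dh : C -> C) (s M' : R) : (forall w, has_deriv h w (dh w)) ->
  (forall t, cabs (dh (mkC s t)) <= M') -> cabs (h (mkC s 0 + T) - h (mkC s 0)) <= M' * (pi *+ 2).
  move=> hh hb.
  have -> : mkC s 0 + T = mkC s (pi *+ 2) by apply: cplx_ext; rewrite ?ReD ?ImD /= ?addr0 ?add0r.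
  rewrite -[X in _ <= _ * X]subr0.
  apply: (@path_mvt R (fun t => h (mkC s t)) (fun t => dh (mkC s t) * mkC 0 1)); first exact: ltW.
    by move=> t _; apply: path_deriv_comp (hh _); exact: path_deriv_vertical.
  by move=> t _; rewrite cabsM cabs_imag normr1 mulr1.
have ec : c0 = derive1 f a * T.
  apply/eqP; rewrite -subr_eq0 -cabs_eq0 eq_le cabs_ge0 andbT leNgt; apply/negP => hpos.
  pose e := cabs (c0 - derive1 f a * T) / (2 * (pi *+ 2)).
  have e0 : 0 < e by rewrite divr_gt0 // mulr_gt0.
  have := entire_deriv a ef; move/has_derivC/(_ _ e0) => [d d0 Hd].
  (* The vertical line over [s] is the circle of radius [d / 2] around [a]. *)
  pose s := ln (d / 2).
  have es : expR s = d / 2 by rewrite lnK // posrE divr_gt0.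
  (* The two added terms remove the value and the linear part of [f] at [a]. The first has period
     [T] and drops out of the increment, the second contributes [derive1 f a * T], and the remaining
     derivative is at most [e] on the line over [s]. *)
  have hH w : has_deriv (fun w => G w + f a * cexp (- w) - derive1 f a * w) w
     ((f (a + cexp w) - f a - derive1 f a * cexp w) * cexp (- w)).
    have h1 : has_deriv (fun w : C => cexp (- w)) w (cexp (- w) * -1).
      by apply: (has_deriv_comp (g := fun v : C => - v)) (cexp_deriv _); apply: has_derivN; exact: has_deriv_id.
    have := has_derivB (has_derivD (hG w) (has_derivZ (f a) h1)) (has_derivZ (derive1 f a) (has_deriv_id w)).
    move/has_deriv_eq; apply; rewrite /g cexpN; have := cexp_neq0 w => ?; by field.
  have := seg _ _ s e hH.
  have -> : G (mkC s 0 + T) + f a * cexp (- (mkC s 0 + T)) - derive1 f a * (mkC s 0 + T) -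
     (G (mkC s 0) + f a * cexp (- mkC s 0) - derive1 f a * mkC s 0) = c0 - derive1 f a * T.
    rewrite -(hc (mkC s 0)) (_ : cexp (- (mkC s 0 + T)) = cexp (- mkC s 0)); first by ring.
    by rewrite -cexp_2pi opprD subrK.
  have b t : cabs ((f (a + cexp (mkC s t)) - f a - derive1 f a * cexp (mkC s t)) * cexp (- mkC s t)) <= e.
    have := Hd (a + cexp (mkC s t)); rewrite addrAC subrr add0r cabs_cexp /= es => /(_ _) H.
    rewrite cabsM cabs_cexp /= expRN es ler_pdivrMr ?divr_gt0 //.
    by apply: H; lra.
  move=> /(_ b); rewrite /e.
  set q := cabs _ in hpos *.
  have -> : q / (2 * (pi *+ 2)) * (pi *+ 2) = q / 2.
    have : pi *+ 2 != 0 :> R by rewrite gt_eqF.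
    by move: (pi *+ 2) => p p0; field.
  by lra.
have := seg G g (ln r) (M / r) hG; rewrite hc ec cabsM cabs_imag (gtr0_norm pi2) ler_pM2r //; apply.
move=> t; rewrite cabsM cabs_cexp /= expRN lnK ?posrE // ler_pM2r ?invr_gt0 //.
by apply: hM; rewrite addrAC subrr add0r cabs_cexp /= lnK ?posrE.
Qed.

Lemma liouville f (M : R) z w : entire f -> (forall z, cabs (f z) <= M) -> f z = f w.
Proof.
move=> ef hM; apply: cderiv0_const => a.
apply: has_deriv_eq (entire_deriv a ef) _; apply/eqP; rewrite -cabs_eq0 eq_le cabs_ge0 andbT leNgt.
apply/negP => h; set q := cabs _ in h.
have M0 : 0 <= M := le_trans (cabs_ge0 _) (hM 0).
have := @cauchy_estimate f a ((M + 1) / q) M ef.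
rewrite divr_gt0 //; last by lra.
move=> /(_ isT (fun w _ => hM w)); rewrite invf_div mulrA ler_pdivlMr; last by lra.
by rewrite -/q mulrC ler_pM2r //; lra.
Qed.

End Cauchy.

(** * Locally uniform limits of entire functions; division by a linear factor *)

Section Weierstrass.
Context {R : realType}.
Local Notation C := (cplx R).
Local Notation Re := complex.Re.
Local Notation Im := complex.Im.
Implicit Types (z w a : C) (f g : C -> C).

Lemma continuous_uncurry (u : C -> R) (p : R * R) : {for mkC p.1 p.2, continuous u} ->
  {for p, continuous (fun q : R * R => u (mkC q.1 q.2))}.
Proof.
move=> /contCR h; apply/cont_epsP => e e0; have [d d0 Hd] := h e e0.
have d20 : 0 < d / 2 by rewrite divr_gt0.
apply/nbhs_ballP; exists (d / 2) => // q [/= q1 q2]; rewrite /ball /= in q1 q2.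
rewrite distrC; apply: Hd; apply: le_lt_trans (cabs_le_ReIm _) _; rewrite ReD ReN ImD ImN /=.
by rewrite distrC [ `|q.2 - _|]distrC [d]splitr ltrD.
Qed.

Lemma rectangle_bounded (u : C -> R) (a b : R) : 0 <= a -> 0 <= b ->
  (forall x y, `|x| <= a -> `|y| <= b -> {for mkC x y, continuous u}) ->
  exists2 M, 0 <= M & forall x y, `|x| <= a -> `|y| <= b -> `|u (mkC x y)| <= M.
Proof.
move=> a0 b0 cu.
have [|||c _ hc] := @compact_EVT_max _ R (fun p : R * R => `|u (mkC p.1 p.2)|) (`[- a, a]%classic `*` `[- b, b]%classic).
- by exists (0, 0); split; rewrite /= in_itv /=; lra.
- by apply: compact_setX; exact: segment_compact.
- apply: continuous_in_subspaceT => p /set_mem [/= p1 p2]; rewrite in_itv /= -ler_norml in p1.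
  rewrite in_itv /= -ler_norml in p2.
  exact: (@contcomp (R * R)%type R R (fun t => `|t|) (fun q => u (mkC q.1 q.2)) p (continuous_uncurry (cu _ _ p1 p2)) (@norm_continuous _ _ _)).
exists `|u (mkC c.1 c.2)| => // x y xa yb; apply: (hc (x, y)); apply: mem_set.
by split; rewrite /= in_itv /= -ler_norml.
Qed.

Lemma disc_bounded (u : C -> R) (r : R) : continuous u ->
  exists2 M, 0 <= M & forall z, cabs z <= r -> `|u z| <= M.
Proof.
move=> cu; have [|r0] := ltP r 0; first by exists 0 => // z; have := cabs_ge0 z; lra.
have [M M0 HM] := rectangle_bounded r0 r0 (fun x y _ _ => cu (mkC x y)).
exists M => // z zr; rewrite -(mkC_eta z).
by apply: HM; apply: le_trans zr; [exact: Re_le_cabs|exact: Im_le_cabs].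
Qed.

Lemma entire_bounded f (r : R) : entire f -> exists2 M, 0 <= M & forall z, cabs z <= r -> cabs (f z) <= M.
Proof.
move=> ef; have [|M M0 HM] := @disc_bounded (fun z => cabs (f z)) r.
  move=> z; apply/contCR => e e0; have /contC /(_ e e0) [d d0 Hd] := entire_cont (z := z) ef.
  exists d => // w /Hd; apply: le_lt_trans; rewrite ler_norml cabs_lb andbT lerNl opprB cabsC.
  exact: cabs_lb.
by exists M => // z /HM; rewrite ger0_norm ?cabs_ge0.
Qed.

(** The limit is the lower limit: the supremum of the numbers that eventually bound the sequence
    from below. *)
Lemma real_cauchy (u : nat -> R) :
  (forall e, 0 < e -> exists N, forall n m, (N <= n)%N -> (N <= m)%N -> `|u n - u m| <= e) ->
  exists l, forall e, 0 < e -> exists N, forall n, (N <= n)%N -> `|u n - l| <= e.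
Proof.
move=> h; pose S := [set x | exists N, forall n, (N <= n)%N -> x <= u n].
have lbS e N : (forall n m, (N <= n)%N -> (N <= m)%N -> `|u n - u m| <= e) -> S (u N - e).
  move=> H; exists N => n Nn; have := H n N Nn (leqnn _); rewrite ler_norml => /andP[]; lra.
have ubS e N : (forall n m, (N <= n)%N -> (N <= m)%N -> `|u n - u m| <= e) -> ubound S (u N + e).
  move=> H x [M HM]; have := H (maxn N M) N (leq_maxl _ _) (leqnn _).
  rewrite ler_norml => /andP[_]; have := HM (maxn N M) (leq_maxr _ _); lra.
exists (sup S) => e e0; have e20 : 0 < e / 2 by rewrite divr_gt0.
have [N HN] := h _ e20; exists N => n Nn.
have h1 : u N - e / 2 <= sup S.
  by apply: ub_le_sup; [exists (u N + e / 2); exact: ubS|exact: lbS].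
have h2 : sup S <= u N + e / 2.
  by apply: ge_sup; [exists (u N - e / 2); exact: lbS|exact: ubS].
have := HN n N Nn (leqnn _); rewrite !ler_norml => /andP[? ?]; apply/andP; split; lra.
Qed.

Lemma complex_cauchy (u : nat -> C) :
  (forall e, 0 < e -> exists N, forall n m, (N <= n)%N -> (N <= m)%N -> cabs (u n - u m) <= e) ->
  exists l : C, forall e, 0 < e -> exists N, forall n, (N <= n)%N -> cabs (u n - l) <= e.
Proof.
move=> h.
have [l1 h1] : exists l, forall e, 0 < e -> exists N, forall n, (N <= n)%N -> `|Re (u n) - l| <= e.
  apply: real_cauchy => e /h [N HN]; exists N => n m Nn Nm; apply: le_trans (HN _ _ Nn Nm).
  by have := Re_le_cabs (u n - u m); rewrite ReD ReN.
have [l2 h2] : exists l, forall e, 0 < e -> exists N, forall n, (N <= n)%N -> `|Im (u n) - l| <= e.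
  apply: real_cauchy => e /h [N HN]; exists N => n m Nn Nm; apply: le_trans (HN _ _ Nn Nm).
  by have := Im_le_cabs (u n - u m); rewrite ImD ImN.
exists (mkC l1 l2) => e e0; have e20 : 0 < e / 2 by rewrite divr_gt0.
have [N1 H1] := h1 _ e20; have [N2 H2] := h2 _ e20.
exists (maxn N1 N2) => n; rewrite geq_max => /andP[n1 n2].
apply: le_trans (cabs_le_ReIm _) _; rewrite ReD ReN ImD ImN /=.
by rewrite [e]splitr lerD ?H1 ?H2.
Qed.

(** Uniform convergence on every disc around 0, that is, locally uniform convergence. *)
Definition luconv (F : nat -> C -> C) f := forall r e : R, 0 < e ->
  exists N, forall n z, (N <= n)%N -> cabs z <= r -> cabs (F n z - f z) <= e.

Lemma entire_diff_bound f g a (M : R) : entire f -> entire g ->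
  (forall w, cabs (w - a) = 1 -> cabs (f w - g w) <= M) -> cabs (derive1 f a - derive1 g a) <= M.
Proof.
move=> ef eg hM.
rewrite -[derive1 f a - _](has_derivE (has_derivB (entire_deriv a ef) (entire_deriv a eg))).
by rewrite -[M]divr1; apply: cauchy_estimate => //; exact: entireB.
Qed.

Lemma cabs_unit_circle z w (r : R) : cabs z <= r -> cabs (w - z) = 1 -> cabs w <= r + 1.
Proof. by move=> zr wz; rewrite -(subrK z w); apply: le_trans (cabsD _ _) _; lra. Qed.

(** Cauchy's estimate on unit circles makes the derivatives a locally uniform Cauchy sequence, at
    the price of enlarging the disc by 1; the mean value inequality transfers this to the difference
    quotients. *)
Lemma weierstrass (F : nat -> C -> C) f : (forall n, entire (F n)) -> luconv F f ->
  entire f /\ luconv (fun n => derive1 (F n)) (derive1 f).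
Proof.
move=> eF hF.
have cau r e : 0 < e -> exists N, forall n m z, (N <= n)%N -> (N <= m)%N -> cabs z <= r ->
    cabs (derive1 (F n) z - derive1 (F m) z) <= e.
  move=> e0; have e20 : 0 < e / 2 by rewrite divr_gt0.
  have [N HN] := hF (r + 1) _ e20; exists N => n m z Nn Nm zr.
  apply: entire_diff_bound => // w wz; have wr := cabs_unit_circle zr wz.
  apply: le_trans (cabs_distD (f w) _ _) _; rewrite [e]splitr lerD ?HN //.
  by rewrite cabsC HN.
have /choice [g hg] : forall z, exists l, forall e, 0 < e -> exists N, forall n, (N <= n)%N ->
    cabs (derive1 (F n) z - l) <= e.
  move=> z; apply: complex_cauchy => e /(cau (cabs z)) [N HN]; exists N => n m Nn Nm; exact: HN.
have conv : luconv (fun n => derive1 (F n)) g.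
  move=> r e e0; have [N HN] := cau r e e0; exists N => n z Nn zr.
  apply/ler_addgt0Pr => d d0; have [N' HN'] := hg z d d0.
  apply: le_trans (cabs_distD (derive1 (F (maxn N N')) z) _ _) _; apply: lerD.
    by apply: HN => //; exact: leq_maxl.
  by apply: HN'; exact: leq_maxr.
(* The three thirds of [e] are spent on the increments of [f] against those of [F N], on the
   differentiability of [F N] at [z], and on [derive1 (F N) z] against its limit. *)
have df z : has_deriv f z (g z).
  apply/has_derivC => e e0; have e30 : 0 < e / 3 by rewrite divr_gt0.
  have [N1 HN1] := cau (cabs z + 1) _ e30.
  have [N2 HN2] := conv (cabs z) _ e30.
  pose N := maxn N1 N2.
  have := entire_deriv z (eF N); move/has_derivC/(_ _ e30) => [d d0 Hd].
  exists (Num.min d 1); first by rewrite lt_min d0 ltr01.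
  move=> w; rewrite lt_min => /andP[wd w1].
  have step : cabs ((f w - f z) - (F N w - F N z)) <= e / 3 * cabs (w - z).
    apply/ler_addgt0Pr => h h0; have h20 : 0 < h / 2 by rewrite divr_gt0.
    have [M HM] := hF (cabs z + 1) _ h20.
    pose n := maxn N M.
    have wz1 : cabs w <= cabs z + 1.
      by rewrite -{1}(subrK z w); apply: le_trans (cabsD _ _) _; lra.
    have b1 : cabs ((F n w - F N w) - (F n z - F N z)) <= e / 3 * cabs (w - z).
      apply: (@cmvt R (fun w => F n w - F N w) (fun w => derive1 (F n) w - derive1 (F N) w)) => t t01.
        by apply: has_derivB; exact: entire_deriv.
      apply: HN1; rewrite ?leq_maxl //; first by rewrite /n /N -maxnA leq_maxl.
      rewrite -(subrK z (z + _)); apply: le_trans (cabsD _ _) _; rewrite addrC lerD2l.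
      by apply: le_trans (segment_sub _ _ t01) (ltW w1).
    have b2 : cabs (F n w - f w) <= h / 2 by apply: HM => //; exact: leq_maxr.
    have b3 : cabs (F n z - f z) <= h / 2 by apply: HM; rewrite ?leq_maxr //; lra.
    have -> : f w - f z - (F N w - F N z) = ((F n w - F N w) - (F n z - F N z)) +
       ((F n z - f z) - (F n w - f w)) by ring.
    apply: le_trans (cabsD _ _) _; apply: lerD => //.
    by apply: le_trans (cabsB _ _) _; lra.
  have h2 := Hd w wd.
  have h3 : cabs (derive1 (F N) z - g z) <= e / 3 by apply: HN2; rewrite ?leq_maxr.
  have -> : f w - f z - g z * (w - z) = ((f w - f z) - (F N w - F N z)) +
    (F N w - F N z - derive1 (F N) z * (w - z)) + (derive1 (F N) z - g z) * (w - z) by ring.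
  apply: le_trans (cabsD _ _) _; apply: le_trans (lerD (cabsD _ _) (lexx _)) _.
  have : cabs ((derive1 (F N) z - g z) * (w - z)) <= e / 3 * cabs (w - z).
    by rewrite cabsM ler_wpM2r // cabs_ge0.
  have -> : e * cabs (w - z) = e / 3 * cabs (w - z) + e / 3 * cabs (w - z) + e / 3 * cabs (w - z) by field.
  by lra.
split; first by move=> z; exists (g z).
by rewrite (_ : derive1 f = g) //; apply/funext => z; exact: has_derivE.
Qed.

(* f' is the locally uniform limit of the difference quotients n (f(z + 1/n) - f z), because f', being
   bounded by Cauchy's estimate, makes f Lipschitz, and then again by Cauchy's estimate f' is Lipschitz. *)
Lemma entire_derive1 f : entire f -> entire (derive1 f).
Proof.
move=> ef.
have lip r : exists2 M, 0 <= M & forall z w, cabs z <= r -> cabs w <= r -> cabs (f w - f z) <= M * cabs (w - z).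
  have [M M0 HM] := entire_bounded (r + 1) ef.
  exists M => // z w zr wr; apply: (@cmvt R f (derive1 f)) => t t01; first exact: entire_deriv.
  rewrite -[M]divr1; apply: cauchy_estimate => // v hv; apply: HM.
  apply: cabs_unit_circle hv.
  have -> : z + mkC t 0 * (w - z) = mkC (1 - t) 0 * z + mkC t 0 * w.
    have -> : mkC (1 - t) 0 = 1 - mkC t 0 by apply: cplx_ext; rewrite /= ?oppr0 ?addr0.
    by ring.
  case/andP: t01 => t0 t1.
  apply: le_trans (cabsD _ _) _; rewrite !cabsM !cabs_real !ger0_norm ?subr_ge0 //.
  have := ler_wpM2l t0 wr; have : (1 - t) * cabs z <= (1 - t) * r by rewrite ler_wpM2l // subr_ge0.
  by lra.
have lip' r : exists2 M, 0 <= M & forall z h, cabs z <= r -> cabs h <= 1 -> cabs (derive1 f (z + h) - derive1 f z) <= M * cabs h.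
  (* Unit circles around points of the disc stay within [r + 1], and the shift by [h] adds at most
     1. *)
  have [M M0 HM] := lip (r + 2); exists M => // z h zr h1.
  have sh w : has_deriv (fun w => f (w + h)) w (derive1 f (w + h)).
    rewrite -[derive1 f (w + h)]mulr1; apply: (has_deriv_comp (g := fun v => v + h)) (entire_deriv _ ef).
    by rewrite -[X in has_deriv _ _ X]addr0; apply: has_derivD; [exact: has_deriv_id|exact: has_deriv_cst].
  rewrite -(has_derivE (sh z)); apply: entire_diff_bound => //; first by move=> w; eexists; exact: sh.
  move=> w wz; have wr := cabs_unit_circle zr wz.
  have -> : M * cabs h = M * cabs (w + h - w) by rewrite addrAC subrr add0r.
  apply: HM; first by lra.
  by apply: le_trans (cabsD _ _) _; lra.
pose k n : C := (n.+1%:R)^-1.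
have k0 n : k n != 0 by rewrite invr_eq0 pnatr_eq0.
have ck n : cabs (k n) = (n.+1%:R)^-1 by rewrite cabsV cabs_nat.
have ck1 n : cabs (k n) <= 1 by rewrite ck invf_le1 ?ler1n // ltr0Sn.
pose F n z := (k n)^-1 * (f (z + k n) - f z).
have eF n : entire (F n).
  apply: entireM (entire_cst _) _; apply: entireB => //; apply: entire_comp => //.
  by apply: entireD entire_id (entire_cst _).
case: (@weierstrass F (derive1 f)) => //.
move=> r e e0; have [M M0 HM] := lip' r.
have [N HN] : exists N : nat, M / e < N.+1%:R by exists (Num.truncn (M / e)); exact: truncnS_gt.
exists N => n z Nn zr.
have -> : F n z - derive1 f z = (k n)^-1 * ((f (z + k n) - derive1 f z * (z + k n)) - (f z - derive1 f z * z)).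
  by rewrite /F; field; exact: k0.
rewrite cabsM cabsV ler_pdivrMl ?ck ?invr_gt0 ?ltr0Sn // -ck.
have := @cmvt R (fun w => f w - derive1 f z * w) (fun w => derive1 f w - derive1 f z) z (z + k n) (M * cabs (k n)).
have -> : z + k n - z = k n by rewrite addrAC subrr add0r.
move=> H; apply: le_trans (H _ _) _.
- move=> t t01; apply: has_derivB; first exact: entire_deriv.
  by have := has_derivZ (derive1 f z) (has_deriv_id (z + mkC t 0 * k n)); rewrite mulr1.
- move=> t /andP[t0 t1]; have tk : cabs (mkC t 0 * k n) <= cabs (k n).
    by rewrite cabsM cabs_real ger0_norm // ler_piMl // cabs_ge0.
  apply: le_trans (HM _ _ zr (le_trans tk (ck1 n))) _.
  by rewrite ler_wpM2l.
rewrite mulrC ler_wpM2l ?cabs_ge0 // ck ler_pdivrMr ?ltr0Sn // mulrC -ler_pdivrMr //.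
by apply: le_trans (ltW HN) _; rewrite ler_nat.
Qed.

(** The difference quotient extends across [a] with derivative [f''(a) / 2] there, by the mean value
    inequality applied to the second-order remainder. This splits off a zero without power
    series. *)
Lemma entire_slope f a : entire f -> exists g, [/\ entire g, g a = derive1 f a & forall z, f z = f a + (z - a) * g z].
Proof.
move=> ef; pose g z := if z == a then derive1 f a else (f z - f a) / (z - a).
have gE z : f z = f a + (z - a) * g z.
  rewrite /g; case: eqP => [->|/eqP za]; first by rewrite subrr mul0r addr0.
  by rewrite mulrC divfK ?subr_eq0 // addrC subrK.
have ga : g a = derive1 f a by rewrite /g eqxx.
exists g; split => // z.
have [->|za] := eqVneq z a.
  exists (derive1 (derive1 f) a / 2); set m := derive1 (derive1 f) a.
  have dq v : has_deriv (fun w => f w - derive1 f a * w - m / 2 * ((w - a) * (w - a))) v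
      (derive1 f v - derive1 f a - m * (v - a)).
    have h1 : has_deriv (fun w : C => w - a) v 1.
      by rewrite -[1]subr0; apply: has_derivB; [exact: has_deriv_id|exact: has_deriv_cst].
    have := has_derivB (has_derivB (entire_deriv v ef) (has_derivZ (derive1 f a) (has_deriv_id v)))
       (has_derivZ (m / 2) (has_derivM h1 h1)).
    move/has_deriv_eq; apply.
    by move: (derive1 f v) (derive1 f a) m => x y k; field.
  apply/has_derivC => e e0.
  have := entire_deriv a (entire_derive1 ef); rewrite -/m => /has_derivC /(_ _ e0) [d d0 Hd].
  exists d => // w wd.
  have [->|wa] := eqVneq w a; first by rewrite !subrr mulr0 subr0 cabs0 mulr0.
  have wa0 : w - a != 0 by rewrite subr_eq0.
  have -> : g w - g a - m / 2 * (w - a) =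
    ((f w - derive1 f a * w - m / 2 * ((w - a) * (w - a))) - (f a - derive1 f a * a - m / 2 * ((a - a) * (a - a)))) / (w - a).
    by rewrite /g (negbTE wa) eqxx; field.
  rewrite cabs_div ler_pdivrMr ?cabs_gt0 //.
  apply: (@cmvt R (fun w => f w - derive1 f a * w - m / 2 * ((w - a) * (w - a)))
     (fun w => derive1 f w - derive1 f a - m * (w - a))) => t t01.
    exact: dq.
  have sv := segment_sub a w t01.
  apply: le_trans (Hd _ (le_lt_trans sv wd)) _.
  by rewrite ler_wpM2l // ltW.
have h1 w : has_deriv (fun w : C => w - a) w 1.
  by rewrite -[1]subr0; apply: has_derivB; [exact: has_deriv_id|exact: has_deriv_cst].
eexists; apply: (@has_deriv_near _ (fun z => (f z - f a) * (z - a)^-1)); last first.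
  apply: has_derivM (has_derivV _ (h1 z)); last by rewrite subr_eq0.
  by apply: has_derivB (has_deriv_cst _ _); exact: entire_deriv.
apply/nearC; exists (cabs (z - a)); first by rewrite cabs_gt0 subr_eq0.
move=> w wz; rewrite /g; case: eqP => // wa.
by move: wz; rewrite wa cabsC ltxx.
Qed.

End Weierstrass.

(** * Estimates for infinite products *)

Section ProductEstimates.
Context {R : realType}.
Local Notation C := (cplx R).
Implicit Types (z w a b u : C).

(** Bounds of the shape [expR s - 1] are stable under products: the exponents simply add, so that
    convergence of a product reduces to that of a sum. *)
Lemma near1_mul a b (s t : R) : cabs (a - 1) <= expR s - 1 -> cabs (b - 1) <= expR t - 1 ->
  cabs (a * b - 1) <= expR (s + t) - 1.
Proof.
move=> ha hb; have -> : a * b - 1 = a * (b - 1) + (a - 1) by ring.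
have ca : cabs a <= expR s.
  by rewrite -(subrK 1 a); apply: le_trans (cabsD _ _) _; rewrite cabs1; lra.
apply: le_trans (cabsD _ _) _; rewrite cabsM expRD.
have := ler_pM (cabs_ge0 _) (cabs_ge0 _) ca hb.
by rewrite mulrBr mulr1; lra.
Qed.

Lemma near1_prod (I : eqType) (s : seq I) (F : I -> C) (b : I -> R) :
  (forall i, i \in s -> cabs (F i - 1) <= expR (b i) - 1) ->
  cabs (\prod_(i <- s) F i - 1) <= expR (\sum_(i <- s) b i) - 1.
Proof.
elim: s => [|i s IH] h; first by rewrite !big_nil expR0 !subrr cabs0.
rewrite !big_cons; apply: near1_mul; first by apply: h; rewrite mem_head.
by apply: IH => j js; apply: h; rewrite in_cons js orbT.
Qed.

(** The elementary factor of genus 2. *)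
Definition wfactor u : C := (1 - u) * cexp (u + u ^+ 2 / 2).

(** The exponent is designed to cancel the lower-order terms: the derivative vanishes to second
    order at 0, whence the cubic bound on [wfactor u - 1]. *)
Lemma has_deriv_wfactor u : has_deriv wfactor u (- u ^+ 2 * cexp (u + u ^+ 2 / 2)).
Proof.
have h1 : has_deriv (fun u : C => 1 - u) u (0 - 1).
  by apply: has_derivB; [exact: has_deriv_cst|exact: has_deriv_id].
have h2 : has_deriv (fun u : C => u + u ^+ 2 / 2) u (1 + u).
  have h := has_derivD (has_deriv_id u) (has_derivM (has_derivM (has_deriv_id u) (has_deriv_id u)) (has_deriv_cst (2^-1) u)).
  by apply: has_deriv_eq h _; field.
have := has_derivM h1 (has_deriv_comp h2 (cexp_deriv _)).
by move/has_deriv_eq; apply; ring.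
Qed.

Lemma wfactor0 : wfactor 0 = 1.
Proof. by rewrite /wfactor expr0n /= mul0r subr0 addr0 cexp0 mulr1. Qed.

Lemma wfactor_eq0 u : (wfactor u == 0) = (u == 1).
Proof. by rewrite /wfactor mulf_eq0 (negbTE (cexp_neq0 _)) orbF subr_eq0 eq_sym. Qed.

Lemma wfactor_bound u : cabs (wfactor u - 1) <= cabs u ^+ 3 * expR (cabs u + cabs u ^+ 2).
Proof.
rewrite -wfactor0.
have := @cmvt R wfactor (fun u => - u ^+ 2 * cexp (u + u ^+ 2 / 2)) 0 u
  (cabs u ^+ 2 * expR (cabs u + cabs u ^+ 2)).
move=> H; apply: le_trans (H _ _) _.
- by move=> t _; exact: has_deriv_wfactor.
- move=> t t01; have := segment_sub 0 u t01; rewrite !subr0.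
  set v := 0 + _ => vu.
  rewrite cabsM cabsN cabsX cabs_cexp.
  have v2 : cabs v ^+ 2 <= cabs u ^+ 2 by rewrite ler_pXn2r ?nnegrE ?cabs_ge0.
  apply: ler_pM; rewrite ?exprn_ge0 ?cabs_ge0 ?expR_ge0 // ler_expR.
  apply: le_trans (ler_norm _) _; apply: le_trans (Re_le_cabs _) _.
  apply: le_trans (cabsD _ _) _; apply: lerD => //; rewrite cabs_div cabsX cabs_nat.
  by have := sqr_ge0 (cabs v); lra.
- by rewrite subr0 mulrAC -exprSr.
Qed.

(** For [x >= 1] one has [1 / x^2 <= 2 / x - 2 / (x + 1)], and the right-hand side telescopes. *)
Lemma sum_inv_sqr (K : R) N M : (N <= M)%N -> 0 <= K ->
  \sum_(N <= k < M) K / k.+1%:R ^+ 2 <= 2 * K / N.+1%:R.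
Proof.
move=> NM K0.
suff : \sum_(N <= k < M) K / k.+1%:R ^+ 2 <= 2 * K / N.+1%:R - 2 * K / M.+1%:R.
  by move=> h; apply: le_trans h _; rewrite gerBl divr_ge0 // mulr_ge0.
rewrite -(subnKC NM); elim: (M - N)%N => [|n IH].
  by rewrite addn0 big_geq // subrr.
rewrite addnS big_nat_recr ?leq_addr //=.
apply: le_trans (lerD IH (lexx _)) _.
set k := (N + n)%N.
have k1 : 0 < k.+1%:R :> R by rewrite ltr0Sn.
have -> : k.+2%:R = k.+1%:R + 1 :> R by rewrite -natr1.
set x : R := k.+1%:R in k1 *.
have x1 : 1 <= x by rewrite ler1n.
have aux (y : R) : y != 0 ->
    2 * K / y - 2 * K / x + K / x ^+ 2 = 2 * K / y - 2 * K / (x + 1) - K * ((x - 1) / (x ^+ 2 * (x + 1))).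
  by move: x k1 x1 => x k1 x1 y0; field; rewrite y0 /=; apply/andP; split; lra.
rewrite aux ?pnatr_eq0 //.
by rewrite gerBl mulr_ge0 // divr_ge0 ?mulr_ge0 ?exprn_ge0 //; lra.
Qed.

Lemma expR_sub1_small (K e : R) : 0 <= K -> 0 < e -> exists N : nat, forall n, (N <= n)%N -> expR (K / n.+1%:R) - 1 <= e.
Proof.
move=> K0 e0; have l0 : 0 < ln (1 + e) by rewrite ln_gt0 // ltrDl.
exists (Num.truncn (K / ln (1 + e))) => n Nn.
have : K / n.+1%:R <= ln (1 + e).
  rewrite ler_pdivrMr ?ltr0Sn // mulrC -ler_pdivrMr //.
  by apply: le_trans (ltW (truncnS_gt _)) _; rewrite ler_nat.
by rewrite -ler_expR lnK ?posrE; lra.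
Qed.

Lemma limn_cplx (u : nat -> C) l :
  (forall e, 0 < e -> exists N, forall n, (N <= n)%N -> cabs (u n - l) <= e) -> limn u = l.
Proof.
move=> h; suff H : u @ \oo --> l by exact: cvg_lim H.
apply/cvgrPdist_le => -[e e']; rewrite ltcE /= => /andP[/eqP -> e0].
have [N HN] := h e e0; exists N => // n /= Nn.
by rewrite cabs_mkC lecE /= eqxx cabsC HN.
Qed.

End ProductEstimates.

(** * Square boxes and shells of lattice indices *)

Section LatticeIndices.

Lemma mem_int_box (N : nat) (m : int) : (m \in int_box N) = (`|m| <= N)%N.
Proof.
apply/mapP/idP => [[k]|mN].
  by rewrite mem_iota => /andP[_ ?] ->; lia.
by exists (absz (m + N%:Z)%R); rewrite ?mem_iota; lia.
Qed.

Lemma uniq_int_box N : uniq (int_box N).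
Proof. by rewrite map_inj_uniq ?iota_uniq // => i j; lia. Qed.

Lemma size_int_box N : size (int_box N) = N.*2.+1.
Proof. by rewrite size_map size_iota. Qed.

Definition index_box N : seq (int * int) := [seq (m, n) | m <- int_box N, n <- int_box N].

Lemma mem_index_box N p : (p \in index_box N) = (`|p.1| <= N)%N && (`|p.2| <= N)%N.
Proof.
rewrite -!mem_int_box; apply/allpairsP/andP => [[[m n] [? ? ->]]|[h1 h2]] //.
by exists p; split => //; case: p {h1 h2}.
Qed.

Lemma uniq_index_box N : uniq (index_box N).
Proof. by apply: allpairs_uniq; rewrite ?uniq_int_box // => -[? ?] [? ?]. Qed.

Lemma size_index_box N : size (index_box N) = (N.*2.+1 ^ 2)%N.
Proof. by rewrite size_allpairs size_int_box. Qed.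

Definition shell N : seq (int * int) := [seq p <- index_box N.+1 | p \notin index_box N].

Lemma perm_shell N : perm_eq (index_box N.+1) (index_box N ++ shell N).
Proof.
apply: perm_trans (_ : perm_eq _ ([seq p <- index_box N.+1 | p \in index_box N] ++ shell N)) _.
  by rewrite perm_sym; exact/permPl/perm_filterC.
rewrite perm_cat2r; apply: uniq_perm; rewrite ?filter_uniq ?uniq_index_box // => p.
by rewrite mem_filter !mem_index_box; lia.
Qed.

(** The difference of two consecutive odd squares. This linear growth, against factors that are
    cubically close to 1, makes the sigma product converge shell by shell. *)
Lemma size_shell N : size (shell N) = (8 * N.+1)%N.
Proof.
have : size (index_box N.+1) = (size (index_box N) + size (shell N))%N.
  by rewrite -size_cat; exact/perm_size/perm_shell.
by rewrite !size_index_box -!muln2; nia.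
Qed.

Lemma shell_large N p : p \in shell N -> (N.+1 <= maxn `|p.1| `|p.2|)%N.
Proof. by rewrite mem_filter !mem_index_box; lia. Qed.

End LatticeIndices.

(** * Convergence of the sigma product and its zeros *)

Section Sigma.
Context {R : realType}.
Local Notation C := (cplx R).
Local Notation Re := complex.Re.
Local Notation Im := complex.Im.
Implicit Types (z w : C) (p : int * int).
Variable tau : C.
Hypothesis tau_gt0 : 0 < Im tau.

Definition lat p : C := p.1%:~R + p.2%:~R * tau.

Lemma lattice_lat p : lattice tau (lat p).
Proof. by exists p.1, p.2. Qed.

Lemma latticeP w : lattice tau w -> exists p, w = lat p.
Proof. by move=> [m [n ->]]; exists (m, n). Qed.

Lemma latD p q : lat p + lat q = lat (p.1 + q.1, p.2 + q.2).
Proof. by rewrite /lat /= !intrD; ring. Qed.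

Lemma latN p : - lat p = lat (- p.1, - p.2).
Proof. by rewrite /lat /= !mulrNz; ring. Qed.

Lemma Re_lat p : Re (lat p) = p.1%:~R + p.2%:~R * Re tau.
Proof. by rewrite /lat ReD ReM !mkC_int /= mul0r subr0. Qed.

Lemma Im_lat p : Im (lat p) = p.2%:~R * Im tau.
Proof. by rewrite /lat ImD ImM !mkC_int /= mul0r addr0 add0r. Qed.

(** The imaginary part of the lattice point controls [p.2], and the real part then controls
    [p.1]. *)
Lemma lat_bound : exists2 c : R, 0 < c & forall p (k : nat), (k <= maxn `|p.1| `|p.2|)%N -> c * k%:R <= cabs (lat p).
Proof.
(* The summands [A + Im tau] serve the case where [p.1] is the larger index, the summand 1 the case
   of [p.2]. *)
pose A := `|Re tau|; pose D := A + Im tau + 1.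
have A0 : 0 <= A by exact: normr_ge0.
have T0 : 0 < Im tau := tau_gt0.
have D0 : 0 < D by rewrite /D; lra.
exists (Im tau / D); first by rewrite divr_gt0.
move=> p k kp; rewrite mulrAC ler_pdivrMr // mulrC [leRHS]mulrC.
have hI : `|p.2%:~R| * Im tau <= cabs (lat p).
  by apply: le_trans (Im_le_cabs _); rewrite Im_lat normrM (ger0_norm (ltW tau_gt0)).
have hR : `|p.1%:~R| - `|p.2%:~R| * A <= cabs (lat p).
  apply: le_trans (Re_le_cabs _); rewrite Re_lat -normrM lerBlDr.
  by rewrite -{1}(addrK (p.2%:~R * Re tau) p.1%:~R); exact: ler_normB.
have nat1 (m : int) : `|m%:~R| = (absz m)%:R :> R by rewrite -intr_norm -abszE.
rewrite /D !mulrDl mul1r; set c := cabs _ in hI hR *.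
have cc : 0 <= c := cabs_ge0 _.
have Tc : 0 <= Im tau * c by rewrite mulr_ge0 // ltW.
have Ac : 0 <= A * c by rewrite mulr_ge0.
move: kp; rewrite leq_max => /orP[k1|k2].
- have h1 : k%:R <= `|p.1%:~R| :> R by rewrite nat1 ler_nat.
  have h2 := ler_wpM2l (ltW tau_gt0) hR; have h3 := ler_wpM2l A0 hI.
  have h4 := ler_wpM2r (ltW tau_gt0) h1.
  by rewrite mulrBr in h2; nra.
- have h1 : k%:R <= `|p.2%:~R| :> R by rewrite nat1 ler_nat.
  have h4 := ler_wpM2r (ltW tau_gt0) h1.
  by nra.
Qed.

Lemma lat_eq0 p : (lat p == 0) = (p == (0, 0)).
Proof.
apply/eqP/eqP => [h|->]; last by rewrite /lat /= mul0r addr0.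
have [c c0 hc] := lat_bound; have := hc p _ (leqnn _).
rewrite h cabs0 pmulr_rle0 // lern0; case: p {h} => m n /= mn.
by congr (_, _); lia.
Qed.

Lemma lat_inj : injective lat.
Proof.
move=> p q /eqP; rewrite -subr_eq0 latN latD lat_eq0; case: p q => [m n] [m' n'] /= /eqP [? ?].
by congr (_, _); lia.
Qed.

(** The index 0 receives the neutral factor, so that products run over whole boxes. *)
Definition gfactor z p := if lat p == 0 then 1 else wfactor (z / lat p).

Definition sigma_part N z := z * \prod_(p <- index_box N) gfactor z p.

Lemma wsigma_limn z : wsigma tau z = limn (fun N => sigma_part N z).
Proof.
rewrite /wsigma; congr (lim (_ @ \oo)); apply/funext => N; congr (_ * _).
have -> : lattice_box tau N = [seq lat p | p <- index_box N].
  by rewrite /lattice_box /index_box map_allpairs.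
rewrite big_map [RHS](bigID (fun p => lat p != 0)) /=.
rewrite [X in _ = _ * X]big1 ?mulr1; last by move=> p; rewrite negbK /gfactor => ->.
by apply: eq_bigr => p /negbTE p0; rewrite /gfactor p0.
Qed.

Lemma entire_gfactor p : entire (fun z => gfactor z p).
Proof.
rewrite /gfactor; case: (lat p == 0); first exact: entire_cst.
have e1 : entire (fun z => z / lat p) by apply: entireM entire_id (entire_cst _).
apply: (entire_comp (f := @wfactor R)) e1 => u; eexists; exact: has_deriv_wfactor.
Qed.

Lemma entire_sigma_part N : entire (sigma_part N).
Proof.
by apply: entireM entire_id _; apply: entire_prod => p _; exact: entire_gfactor.
Qed.

Definition shell_prod N z := \prod_(p <- shell N) gfactor z p.

Lemma sigma_partS N z : sigma_part N.+1 z = sigma_part N z * shell_prod N z.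
Proof. by rewrite /sigma_part (perm_big _ (perm_shell N)) big_cat mulrA. Qed.

Lemma sigma_partD N M z : (N <= M)%N -> sigma_part M z = sigma_part N z * \prod_(N <= k < M) shell_prod k z.
Proof.
move/subnKC <-; elim: (M - N)%N => [|n IH]; first by rewrite addn0 big_geq // mulr1.
by rewrite addnS sigma_partS IH big_nat_recr ?leq_addr //= mulrA.
Qed.

(** Each of the [8 * N.+1] factors differs from 1 by at most a constant over [N.+1 ^+ 3], uniformly
    on the disc. *)
Lemma shell_prod_bound r : exists2 K : R, 0 <= K & forall N z, cabs z <= r ->
  cabs (shell_prod N z - 1) <= expR (K / N.+1%:R ^+ 2) - 1.
Proof.
have [r0|r0] := ltP r 0; first by exists 0 => // N z; have := cabs_ge0 z; lra.
have [c c0 hc] := lat_bound.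
pose U := r / c; have U0 : 0 <= U by rewrite divr_ge0 // ltW.
pose B := expR (U + U ^+ 2).
have B0 : 0 <= B by exact: expR_ge0.
exists (8 * (U ^+ 3 * B)); first by apply: mulr_ge0 => //; apply: mulr_ge0 => //; exact: exprn_ge0.
move=> N z zr.
pose b : R := U ^+ 3 / N.+1%:R ^+ 3 * B.
have b0 : 0 <= b by rewrite mulr_ge0 // divr_ge0 // exprn_ge0.
have one : forall p, p \in shell N -> cabs (gfactor z p - 1) <= expR b - 1.
  move=> p /shell_large pN.
  have lb := hc _ _ pN.
  have N1 : 1 <= N.+1%:R :> R by rewrite ler1n.
  have cN : 0 < c * N.+1%:R by rewrite mulr_gt0 // ltr0Sn.
  have lp : 0 < cabs (lat p) := lt_le_trans cN lb.
  have u1 : cabs (z / lat p) <= U / N.+1%:R.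
    rewrite cabs_div /U -mulrA -invfM; apply: ler_pM => //; rewrite ?cabs_ge0 ?invr_ge0 ?cabs_ge0 //.
    by rewrite lef_pV2 // posrE.
  have u2 : cabs (z / lat p) <= U.
    by apply: le_trans u1 _; rewrite ler_pdivrMr ?ltr0Sn // ler_peMr.
  have H : cabs (gfactor z p - 1) <= b.
    rewrite /gfactor -cabs_eq0 gt_eqF //; apply: le_trans (wfactor_bound _) _.
    have c3 : cabs (z / lat p) ^+ 3 <= U ^+ 3 / N.+1%:R ^+ 3.
      by rewrite -expr_div_n ler_pXn2r ?nnegrE ?cabs_ge0 // divr_ge0.
    have cB : expR (cabs (z / lat p) + cabs (z / lat p) ^+ 2) <= B.
      by rewrite ler_expR lerD // ler_pXn2r ?nnegrE ?cabs_ge0.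
    by apply: ler_pM c3 cB; rewrite ?exprn_ge0 ?cabs_ge0 ?expR_ge0.
  by apply: le_trans H _; have := expR_ge1Dx b; lra.
apply: le_trans (near1_prod (b := fun _ => b) one) _.
rewrite lerD2r ler_expR big_const_seq count_predT iter_addr_0 size_shell.
rewrite -[b *+ _]mulr_natl natrM /b le_eqVlt; apply/orP; left; apply/eqP.
have : N.+1%:R != 0 :> R by rewrite pnatr_eq0.
by move: (N.+1%:R : R) => x x0; field.
Qed.

Lemma tail_bound r e : 0 < e -> exists N, forall n m z, (N <= n)%N -> (n <= m)%N -> cabs z <= r ->
  cabs (\prod_(n <= k < m) shell_prod k z - 1) <= e.
Proof.
move=> e0; have [K K0 HK] := shell_prod_bound r.
have [N HN] := expR_sub1_small (mulr_ge0 (ler0n R 2) K0) e0.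
exists N => n m z Nn nm zr.
apply: le_trans (HN n Nn).
apply: le_trans (near1_prod (b := fun k => K / k.+1%:R ^+ 2) _) _; first by move=> k _; exact: HK.
by rewrite lerD2r ler_expR; exact: sum_inv_sqr.
Qed.

Lemma sigma_part_bounded r : exists2 B : R, 0 <= B & forall N z, cabs z <= r -> cabs (sigma_part N z) <= B.
Proof.
have [r0|r0] := ltP r 0; first by exists 0 => // N z; have := cabs_ge0 z; lra.
have [N1 H1] := tail_bound r ltr01.
have fin n : exists2 B : R, 0 <= B & forall N z, (N <= n)%N -> cabs z <= r -> cabs (sigma_part N z) <= B.
  elim: n => [|n [B B0 HB]].
    have [B B0 HB] := entire_bounded r (entire_sigma_part 0).
    by exists B => // N z; rewrite leqn0 => /eqP ->; exact: HB.
  have [B' B'0 HB'] := entire_bounded r (entire_sigma_part n.+1).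
  exists (B + B'); first by rewrite addr_ge0.
  move=> N z; rewrite leq_eqVlt => /orP[/eqP ->|Nn] zr.
    by apply: le_trans (HB' z zr) _; rewrite lerDr.
  by apply: le_trans (HB N z Nn zr) _; rewrite lerDl.
have [B B0 HB] := fin N1.
(* Beyond [N1] the remaining factors multiply to a number within 1 of 1, hence of modulus at most
   2. *)
exists (B * 2); first by rewrite mulr_ge0.
move=> N z zr; have [NN|/ltnW NN] := leqP N N1.
  by apply: le_trans (HB _ _ NN zr) _; lra.
rewrite (sigma_partD z NN) cabsM; apply: ler_pM; rewrite ?cabs_ge0 ?HB //.
rewrite -(subrK 1 (\prod_(_ <= k < _) _)); apply: le_trans (cabsD _ _) _; rewrite cabs1.
by have := H1 N1 N z (leqnn _) NN zr; lra.
Qed.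

Lemma sigma_part_cauchy r e : 0 < e -> exists N, forall n m z, (N <= n)%N -> (n <= m)%N -> cabs z <= r ->
  cabs (sigma_part m z - sigma_part n z) <= e.
Proof.
move=> e0; have [B B0 HB] := sigma_part_bounded r.
have B1 : 0 < B + 1 by lra.
have [N HN] := tail_bound r (divr_gt0 e0 B1).
exists N => n m z Nn nm zr.
rewrite (sigma_partD z nm) -{2}[sigma_part n z]mulr1 -mulrBr cabsM.
apply: le_trans (ler_pM (cabs_ge0 _) (cabs_ge0 _) (HB n z zr) (HN n m z Nn nm zr)) _.
rewrite mulrCA ler_piMr ?(ltW e0) // ler_pdivrMr //; lra.
Qed.

Lemma luconv_sigma : luconv sigma_part (wsigma tau).
Proof.
have lim z e : 0 < e -> exists N, forall n, (N <= n)%N -> cabs (sigma_part n z - wsigma tau z) <= e.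
  move: e; have [l hl] : exists l : C, forall e, 0 < e -> exists N, forall n, (N <= n)%N -> cabs (sigma_part n z - l) <= e.
    apply: complex_cauchy => e e0; have [N HN] := sigma_part_cauchy (cabs z) e0.
    exists N => n m Nn Nm; have [nm|/ltnW nm] := leqP n m; last by rewrite HN.
    by rewrite cabsC HN.
  by rewrite wsigma_limn (limn_cplx hl).
move=> r e e0; have [N HN] := sigma_part_cauchy r e0.
exists N => n z Nn zr; apply/ler_addgt0Pr => d d0.
have [N' HN'] := lim z d d0.
apply: le_trans (cabs_distD (sigma_part (maxn n N') z) _ _) _; apply: lerD.
  by rewrite cabsC HN // leq_maxl.
by apply: HN'; exact: leq_maxr.
Qed.

Lemma entire_sigma : entire (wsigma tau).
Proof. by case: (weierstrass entire_sigma_part luconv_sigma). Qed.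

Lemma luconv_dsigma : luconv (fun N => derive1 (sigma_part N)) (derive1 (wsigma tau)).
Proof. by case: (weierstrass entire_sigma_part luconv_sigma). Qed.

Lemma sigma_part_lat N p : p \in index_box N -> sigma_part N (lat p) = 0.
Proof.
move=> pN; rewrite /sigma_part (big_rem p) //= /gfactor.
case: eqP => [->|/eqP p0]; first by rewrite mul0r.
by rewrite divff // (_ : wfactor 1 = 0) ?mul0r ?mulr0 //; apply/eqP; rewrite wfactor_eq0.
Qed.

Lemma sigma_lat p : wsigma tau (lat p) = 0.
Proof.
apply/eqP; rewrite -cabs_eq0 eq_le cabs_ge0 andbT.
apply/ler_addgt0Pr => e e0; rewrite add0r.
have [N HN] := luconv_sigma (cabs (lat p)) e0.
pose M := maxn N (maxn `|p.1| `|p.2|).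
have := HN M (lat p) (leq_maxl _ _) (lexx _).
rewrite sigma_part_lat ?sub0r ?cabsN //.
by rewrite mem_index_box /M !leq_max !leqnn !orbT.
Qed.

Lemma limit_lb (u : nat -> C) l (b : R) : (forall e, 0 < e -> exists N, forall n, (N <= n)%N -> cabs (u n - l) <= e) ->
  (exists N, forall n, (N <= n)%N -> b <= cabs (u n)) -> b <= cabs l.
Proof.
move=> h [N HN]; apply/ler_addgt0Pr => e /h [N' HN'].
have h1 := HN' _ (leq_maxr N N'); have h2 := HN _ (leq_maxl N N').
have h3 := cabs_lb (u (maxn N N')) l.
by rewrite addrC -lerBlDr; apply: le_trans h1; apply: le_trans h3; rewrite lerD2r.
Qed.

(** Keeps the limit away from 0, both for the product off the lattice and for its derivative at a
    lattice point. *)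
Lemma tail_half_after z N0 : exists2 N, (N0 <= N)%N & forall m, (N <= m)%N -> 1 / 2 <= cabs (\prod_(N <= k < m) shell_prod k z).
Proof.
have [|N HN] := @tail_bound (cabs z) (1 / 2); first by lra.
exists (maxn N0 N); rewrite ?leq_maxl // => m Nm.
have := HN _ m z (leq_maxr _ _) Nm (lexx _).
have := cabs_lb 1 (1 - \prod_(maxn N0 N <= k < m) shell_prod k z).
by rewrite subKr cabs1 [cabs (1 - _)]cabsC; lra.
Qed.

Lemma sigma_neq0 z : ~ lattice tau z -> wsigma tau z != 0.
Proof.
move=> zL.
have [N _ HN] := tail_half_after z 0.
have sN : sigma_part N z != 0.
  rewrite /sigma_part mulf_neq0 //.
    by apply: contra_notN zL => /eqP ->; exists 0, 0; rewrite mul0r addr0.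
  rewrite prodf_seq_neq0; apply/allP => p _ /=; rewrite /gfactor; case: (eqVneq (lat p) 0) => p0; first exact: oner_neq0.
  rewrite wfactor_eq0; apply: contra_notN zL => /eqP H.
  by rewrite -[z](divfK p0) H mul1r; exact: lattice_lat.
rewrite -cabs_gt0; apply: lt_le_trans (_ : cabs (sigma_part N z) * (1 / 2) <= _).
  by rewrite mulr_gt0 ?cabs_gt0 //; lra.
apply: (limit_lb (u := fun n => sigma_part n z)).
  by move=> e e0; have [M HM] := luconv_sigma (cabs z) e0; exists M => n Mn; exact: HM.
exists N => n Nn; rewrite (sigma_partD z Nn) cabsM ler_wpM2l ?cabs_ge0 //; exact: HN.
Qed.

Lemma sigma_eq0 z : wsigma tau z = 0 <-> lattice tau z.
Proof.
split; last by move=> /latticeP [p ->]; exact: sigma_lat.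
by move=> h; apply: contrapT => /sigma_neq0; rewrite h eqxx.
Qed.

End Sigma.

(** * Quotients of entire functions *)

Section EntireQuotients.
Context {R : realType}.
Local Notation C := (cplx R).
Implicit Types (z w a b : C) (f g A B : C -> C).

Lemma near_neq0 g a : {for a, continuous g} -> g a != 0 -> \forall w \near a, g w != 0.
Proof.
move=> /contC cg ga; have [d d0 Hd] := cg (cabs (g a)) (etrans (cabs_gt0 _) ga).
apply/nearC; exists d => // w /Hd; apply: contraTneq => ->.
by rewrite sub0r cabsN ltxx.
Qed.

(** Near a simple zero of [B] the linear factor cancels between [A] and [B], leaving the quotient of
    their slope functions. *)
Lemma entire_div A B : entire A -> entire B ->
  (forall a, B a = 0 -> derive1 B a != 0 /\ A a = 0) ->
  exists2 psi, entire psi & forall z, A z = psi z * B z.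
Proof.
move=> eA eB h.
pose psi z := if B z == 0 then derive1 A z / derive1 B z else A z / B z.
exists psi => z; last first.
  by rewrite /psi; case: eqP => [/[dup] /h [_ ->] ->|/eqP Bz]; rewrite ?mulr0 // divfK.
have cB a : {for a, continuous B} by exact: entire_cont.
have [Bz|Bz] := eqVneq (B z) 0; last first.
  eexists; apply: (@has_deriv_near _ (fun w => A w * (B w)^-1)); last first.
    by apply: has_derivM (entire_deriv z eA) (has_derivV Bz (entire_deriv z eB)).
  by apply: filterS (near_neq0 (cB z) Bz) => w /negbTE Bw; rewrite /psi Bw.
have [dB Az] := h z Bz.
have [A1 [eA1 A1z A1E]] := entire_slope z eA.
have [B1 [eB1 B1z B1E]] := entire_slope z eB.
have B1z0 : B1 z != 0 by rewrite B1z.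
eexists; apply: (@has_deriv_near _ (fun w => A1 w * (B1 w)^-1)); last first.
  by apply: has_derivM (entire_deriv z eA1) (has_derivV B1z0 (entire_deriv z eB1)).
apply: filterS (near_neq0 (entire_cont eB1) B1z0) => w B1w.
have [->|wz] := eqVneq w z; first by rewrite /psi Bz eqxx A1z B1z.
have wz0 : w - z != 0 by rewrite subr_eq0.
have Bw : B w = (w - z) * B1 w by rewrite B1E Bz add0r.
rewrite /psi Bw mulf_eq0 (negbTE wz0) (negbTE B1w) /= A1E Az add0r.
by field; rewrite wz0 B1w.
Qed.

Lemma cabs_small0 z : (forall e, 0 < e -> cabs z <= e) -> z = 0.
Proof.
move=> h; apply/eqP; rewrite -cabs_eq0 eq_le cabs_ge0 andbT.
by apply/ler_addgt0Pr => e e0; rewrite add0r h.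
Qed.

Lemma cvg_cplxP (u : nat -> C) (l : C) : (u @ \oo --> l) <->
  forall e : R, 0 < e -> exists N, forall n, (N <= n)%N -> cabs (u n - l) <= e.
Proof.
split.
- move=> /cvgrPdist_le h e e0.
  have /h [N _ HN] : (0 : C) < mkC e 0 by rewrite ltcE /= eqxx.
  exists N => n Nn; have := HN n Nn; rewrite /= cabs_mkC lecE /= => /andP[_].
  by rewrite cabsC.
- move=> h; apply/cvgrPdist_le => -[e e']; rewrite ltcE /= => /andP[/eqP -> e0].
  have [N HN] := h e e0; exists N => // n /= Nn.
  by rewrite cabs_mkC lecE /= eqxx cabsC HN.
Qed.

Lemma luconv_cvg (F : nat -> C -> C) f z : luconv F f -> (F n z @[n --> \oo] --> f z).
Proof.
move=> h; apply/cvg_cplxP => e e0; have [N HN] := h (cabs z) e e0.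
by exists N => n Nn; exact: HN.
Qed.

Lemma cvg_cplx_unique (u : nat -> C) (l l' : C) : u @ \oo --> l -> u @ \oo --> l' -> l = l'.
Proof. by move=> h1 h2; rewrite -(cvg_lim _ h1) ?(cvg_lim _ h2). Qed.

End EntireQuotients.

(** * Simplicity of the zeros of sigma, and oddness *)

Section SigmaZeros.
Context {R : realType}.
Local Notation C := (cplx R).
Local Notation Re := complex.Re.
Local Notation Im := complex.Im.
Implicit Types (z w : C) (p : int * int).
Variable tau : C.
Hypothesis tau_gt0 : 0 < Im tau.
Local Notation lat := (lat tau).
Local Notation sigma_part := (sigma_part tau).
Local Notation gfactor := (gfactor tau).

Lemma lattice_coord (a b : R) : lattice tau (mkC a 0 + mkC b 0 * tau) ->
  exists m n : int, a = m%:~R /\ b = n%:~R.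
Proof.
move=> /latticeP [[m n] E]; exists m, n.
have hI := congr1 (fun z : C => Im z) E; have hR := congr1 (fun z : C => Re z) E.
move: hI hR; rewrite Im_lat Re_lat ImD ReD ImM ReM /= !mul0r subr0 addr0 add0r.
have T0 : Im tau != 0 by rewrite gt_eqF.
move/(mulIf T0) => ->; by move/addIr.
Qed.

Lemma lattice0 : lattice tau 0.
Proof. by exists 0, 0; rewrite mul0r addr0. Qed.

Lemma lattice1 : lattice tau 1.
Proof. by exists 1, 0; rewrite mul0r addr0. Qed.

Lemma lattice_tau : lattice tau tau.
Proof. by exists 0, 1; rewrite mul1r add0r. Qed.

Lemma latticeN w : lattice tau w -> lattice tau (- w).
Proof. by move=> /latticeP [p ->]; rewrite latN; exact: lattice_lat. Qed.

Lemma latticeD w w' : lattice tau w -> lattice tau w' -> lattice tau (w + w').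
Proof. by move=> /latticeP [p ->] /latticeP [q ->]; rewrite latD; exact: lattice_lat. Qed.

Lemma lattice_addr z w : lattice tau w -> lattice tau (z + w) <-> lattice tau z.
Proof.
move=> hw; split => h; last exact: latticeD.
by rewrite -(addrK w z); apply: latticeD h (latticeN hw).
Qed.

(** A small positive real shift leaves the lattice, and continuity gives the value at the lattice
    point. *)
Lemma entire_zero_off_lattice f : entire f -> (forall z, ~ lattice tau z -> f z = 0) -> forall z, f z = 0.
Proof.
move=> ef h z; apply: cabs_small0 => e e0.
have /contC /(_ _ e0) [d d0 Hd] := @entire_cont R f z ef.
have [/latticeP [p zp]|zL] := pselect (lattice tau z); last by rewrite h // cabs0 ltW.
pose t : R := Num.min (d / 2) (1 / 2).
have t0 : 0 < t by rewrite lt_min !divr_gt0.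
have t1 : t < 1 by rewrite gt_min; apply/orP; right; lra.
have td : t < d by rewrite gt_min; apply/orP; left; lra.
have := Hd (z + mkC t 0); rewrite addrAC subrr add0r cabs_real gtr0_norm // => /(_ td).
rewrite h; first by rewrite sub0r cabsN => /ltW.
move=> zt; have : lattice tau (mkC t 0 + mkC 0 0 * tau).
  rewrite mul0r addr0 -(addKr z (mkC t 0)); apply: latticeD => //.
  by apply: latticeN; rewrite zp; exact: lattice_lat.
move=> /lattice_coord [m [n [tm _]]]; move: t0 t1; rewrite tm ltr0z ltrz1; lia.
Qed.

(** Exactly one factor of the finite product vanishes at [lat p], and it does so to first order. *)
Lemma dsigma_part_lat N p : p \in index_box N -> derive1 (sigma_part N) (lat p) != 0.
Proof.
move=> pN.
have nz q : q \in rem p (index_box N) -> gfactor (lat p) q != 0.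
  rewrite mem_rem_uniq ?uniq_index_box // inE => /andP[qp _]; rewrite /gfactor.
  case: (eqVneq (lat q) 0) => q0; first exact: oner_neq0.
  rewrite wfactor_eq0; apply: contra_neqN qp => /eqP E.
  by apply: (lat_inj tau_gt0); rewrite -[RHS](divfK q0) E mul1r.
have [p0|p0] := eqVneq (lat p) 0.
  rewrite p0; have E : has_deriv (fun z => \prod_(q <- index_box N) gfactor z q) 0 (derive1 (fun z => \prod_(q <- index_box N) gfactor z q) 0).
    by apply: entire_deriv; apply: entire_prod => q _; exact: entire_gfactor.
  rewrite (has_derivE (has_derivM (has_deriv_id 0) E)) mul0r addr0 mul1r big1; first exact: oner_neq0.
  by move=> q _; rewrite /gfactor mul0r wfactor0; case: ifP.
pose rest z := z * \prod_(q <- rem p (index_box N)) gfactor z q.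
have er : entire rest.
  by apply: entireM entire_id _; apply: entire_prod => q _; exact: entire_gfactor.
have -> : sigma_part N = fun z => rest z * wfactor (z / lat p).
  apply/funext => z; rewrite /sigma_part (big_rem p) //= /rest {1}/gfactor (negbTE p0).
  by rewrite [wfactor _ * _]mulrC mulrA.
have h1 : has_deriv (fun z => z / lat p) (lat p) (1 / lat p).
  by have := has_derivM (has_deriv_id (lat p)) (has_deriv_cst (lat p)^-1 (lat p)); rewrite mulr0 addr0.
have h2 := has_deriv_comp h1 (has_deriv_wfactor _).
rewrite (has_derivE (has_derivM (entire_deriv _ er) h2)) divff //.
rewrite (_ : wfactor 1 = 0) ?mulr0 ?add0r; last by apply/eqP; rewrite wfactor_eq0.
have n1 : rest (lat p) != 0.
  by apply: mulf_neq0 => //; rewrite prodf_seq_neq0; apply/allP => q qN; exact: nz.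
have n2 : 1 / lat p != 0 by apply: mulf_neq0; [exact: oner_neq0|rewrite invr_eq0].
have n3 : - (1 : C) ^+ 2 != 0 by rewrite expr1n oppr_eq0 oner_neq0.
exact: mulf_neq0 n1 (mulf_neq0 (mulf_neq0 n3 (cexp_neq0 _)) n2).
Qed.

(** At a lattice point the product rule leaves only the derivative of the head times the tail, so
    the derivatives of the partial products stay above half of the one at stage [N]. *)
Lemma dsigma_lat p : derive1 (wsigma tau) (lat p) != 0.
Proof.
have [N pN HN] := tail_half_after tau_gt0 (lat p) (maxn `|p.1| `|p.2|).
have pbox : p \in index_box N by rewrite mem_index_box -geq_max.
have d0 := dsigma_part_lat pbox.
rewrite -cabs_gt0; apply: lt_le_trans (_ : cabs (derive1 (sigma_part N) (lat p)) * (1 / 2) <= _).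
  by rewrite mulr_gt0 ?cabs_gt0 //; lra.
apply: (limit_lb (u := fun n => derive1 (sigma_part n) (lat p))).
  by apply/cvg_cplxP; exact: luconv_cvg (luconv_dsigma tau_gt0).
exists N => n Nn.
have -> : sigma_part n = fun z => sigma_part N z * \prod_(N <= k < n) shell_prod tau k z.
  by apply/funext => z; exact: sigma_partD.
have es : entire (fun z => \prod_(N <= k < n) shell_prod tau k z).
  by apply: entire_prod => k _; apply: entire_prod => q _; exact: entire_gfactor.
rewrite (has_derivE (has_derivM (entire_deriv _ (entire_sigma_part tau N)) (entire_deriv _ es))).
by rewrite sigma_part_lat // mul0r addr0 cabsM ler_wpM2l ?cabs_ge0 //; exact: HN.
Qed.

Lemma dsigma_lattice w : lattice tau w -> derive1 (wsigma tau) w != 0.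
Proof. by move=> /latticeP [p ->]; exact: dsigma_lat. Qed.

Lemma dsigma0 : derive1 (wsigma tau) 0 = 1.
Proof.
have h := luconv_cvg (z := 0) (luconv_dsigma tau_gt0).
apply: (cvg_cplx_unique h).
suff -> : (fun n => derive1 (sigma_part n) 0) = fun _ => 1 by exact: cvg_cst.
apply/funext => N.
have E : has_deriv (fun z => \prod_(q <- index_box N) gfactor z q) 0 (derive1 (fun z => \prod_(q <- index_box N) gfactor z q) 0).
  by apply: entire_deriv; apply: entire_prod => q _; exact: entire_gfactor.
rewrite (has_derivE (has_derivM (has_deriv_id 0) E)) mul0r addr0 mul1r big1 //.
by move=> q _; rewrite /gfactor mul0r wfactor0; case: ifP.
Qed.

Lemma sigma0 : wsigma tau 0 = 0.
Proof. by apply/(sigma_eq0 tau_gt0); exact: lattice0. Qed.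

Definition negp p : int * int := (- p.1, - p.2).

Lemma lat_negp p : lat (negp p) = - lat p.
Proof. by rewrite latN. Qed.

Lemma perm_negp N : perm_eq [seq negp p | p <- index_box N] (index_box N).
Proof.
apply: uniq_perm; rewrite ?uniq_index_box //.
  rewrite map_inj_uniq ?uniq_index_box // => -[a b] [a' b'] [ha hb].
  by congr (_, _); apply: oppr_inj.
move=> p; apply/mapP/idP => [[q]|]; first by rewrite !mem_index_box => ? ->; rewrite /negp /= !abszN.
move=> h; exists (negp p); first by move: h; rewrite !mem_index_box /negp /= !abszN.
by case: p h => a b _; rewrite /negp /= !opprK.
Qed.

Lemma sigma_odd z : wsigma tau (- z) = - wsigma tau z.
Proof.
have E N : sigma_part N (- z) = - sigma_part N z.
  rewrite /sigma_part mulNr; congr (- (_ * _)).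
  rewrite -(perm_big _ (perm_negp N)) big_map; apply: eq_bigr => p _.
  by rewrite /gfactor lat_negp oppr_eq0 invrN mulrNN.
have h1 := luconv_cvg (z := - z) (luconv_sigma tau_gt0).
apply: (cvg_cplx_unique h1).
rewrite (_ : (fun n => sigma_part n (- z)) = fun n => - sigma_part n z); last exact/funext.
by apply: cvgN; exact: luconv_cvg (luconv_sigma tau_gt0).
Qed.

End SigmaZeros.

(** * Quasi-periodicity of zeta and sigma *)

Section QuasiPeriods.
Context {R : realType}.
Local Notation C := (cplx R).
Local Notation Re := complex.Re.
Local Notation Im := complex.Im.
Implicit Types (z w : C) (p : int * int).
Variable tau : C.
Hypothesis tau_gt0 : 0 < Im tau.
Local Notation lat := (lat tau).
Local Notation sigma_part := (sigma_part tau).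

Lemma has_deriv_prod_log (I : eqType) (s : seq I) (F : I -> C -> C) (L : I -> C) z :
  (forall i, has_deriv (F i) z (F i z * L i)) ->
  has_deriv (fun w => \prod_(i <- s) F i w) z ((\prod_(i <- s) F i z) * \sum_(i <- s) L i).
Proof.
move=> h; elim: s => [|i s IH].
  rewrite !big_nil mulr0 (_ : (fun _ => _) = fun _ => 1); first exact: has_deriv_cst.
  by apply/funext => w; rewrite big_nil.
rewrite !big_cons (_ : (fun _ => _) = fun w => F i w * \prod_(j <- s) F j w).
  by apply: has_deriv_eq (has_derivM (h i) IH) _; ring.
by apply/funext => w; rewrite big_cons.
Qed.

(* The inverse of 0 is 0, so that for p = 0 this is 1/z, as it should be. *)
Definition zeta_term z p : C := (z - lat p)^-1 + (lat p)^-1 + z * (lat p)^-2.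

Definition zeta_part N z := \sum_(p <- index_box N) zeta_term z p.

(** The isolated factor [z] becomes the factor at index 0, so that the partial product has a uniform
    logarithmic derivative. *)
Definition sigma_term p z := if lat p == 0 then z else wfactor (z / lat p).

Lemma sigma_part_prod N z : sigma_part N z = \prod_(p <- index_box N) sigma_term p z.
Proof.
have o0 : (0, 0) \in index_box N by rewrite mem_index_box.
rewrite /sigma_part (big_rem (0, 0)) // [RHS](big_rem (0, 0)) //.
have g0 : gfactor tau z (0, 0) = 1 by rewrite /gfactor (lat_eq0 tau_gt0) eqxx.
have s0 : sigma_term (0, 0) z = z by rewrite /sigma_term (lat_eq0 tau_gt0) eqxx.
rewrite g0 s0; congr (z * _); apply: etrans (mul1r _) _.
apply: eq_big_seq => p; rewrite mem_rem_uniq ?uniq_index_box // inE => /andP[p0 _].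
by rewrite /gfactor /sigma_term (lat_eq0 tau_gt0) (negbTE p0).
Qed.

Lemma lat_sub_neq0 z p : ~ lattice tau z -> z - lat p != 0.
Proof. by move=> zL; rewrite subr_eq0; apply: contra_notN zL => /eqP ->; exact: lattice_lat. Qed.

Lemma has_deriv_sigma_part N z : ~ lattice tau z ->
  has_deriv (sigma_part N) z (sigma_part N z * zeta_part N z).
Proof.
move=> zL; rewrite sigma_part_prod (_ : sigma_part N = fun w => \prod_(p <- index_box N) sigma_term p w); last first.
  by apply/funext => w; exact: sigma_part_prod.
apply: has_deriv_prod_log => p; rewrite /sigma_term /zeta_term.
have zp := lat_sub_neq0 p zL.
have [p0|p0] := eqVneq (lat p) 0.
  rewrite p0 subr0 in zp *; rewrite invr0 expr0n /= mulr0n invr0 mulr0 !addr0 divff //; exact: has_deriv_id.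
have h1 : has_deriv (fun z => z / lat p) z (1 / lat p).
  by have := has_derivM (has_deriv_id z) (has_deriv_cst (lat p)^-1 z); rewrite mulr0 addr0.
apply: has_deriv_eq (has_deriv_comp h1 (has_deriv_wfactor _)) _.
rewrite /wfactor; move: (cexp _) => e.
by field; rewrite p0 zp.
Qed.

Lemma sigma_part_neq0 N z : ~ lattice tau z -> sigma_part N z != 0.
Proof.
move=> zL; rewrite sigma_part_prod prodf_seq_neq0; apply/allP => p _ /=; rewrite /sigma_term.
have [p0|p0] := eqVneq (lat p) 0; first by have := lat_sub_neq0 p zL; rewrite p0 subr0.
rewrite wfactor_eq0; apply: contra_notN zL => /eqP H.
by rewrite -[z](divfK p0) H mul1r; exact: lattice_lat.
Qed.

Lemma zeta_part_cvg z : ~ lattice tau z -> (zeta_part N z @[N --> \oo] --> wzeta tau z).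
Proof.
move=> zL.
have E N : zeta_part N z = derive1 (sigma_part N) z * (sigma_part N z)^-1.
  by rewrite (has_derivE (has_deriv_sigma_part N zL)) mulrAC divff ?mul1r // sigma_part_neq0.
rewrite (_ : (fun N => zeta_part N z) = fun N => derive1 (sigma_part N) z * (sigma_part N z)^-1); last exact/funext.
apply: cvgM; first exact: luconv_cvg (luconv_dsigma tau_gt0).
by apply: cvgV; [exact: sigma_neq0|exact: luconv_cvg (luconv_sigma tau_gt0)].
Qed.

(** Translation by [- q]: shifting [z] by [lat q] moves the poles the opposite way. *)
Definition padd p q : int * int := (p.1 - q.1, p.2 - q.2).

(** In this second difference the constant and the linear terms of [zeta_term] cancel. Only the
    poles remain, and their sum telescopes in the direction [e]. *)
Lemma zeta_part_shift N z z' e :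
  (zeta_part N (z + lat e) - zeta_part N z) - (zeta_part N (z' + lat e) - zeta_part N z') =
  \sum_(p <- index_box N) (((z - lat (padd p e))^-1 - (z' - lat (padd p e))^-1) - ((z - lat p)^-1 - (z' - lat p)^-1)).
Proof.
have latB p : lat (padd p e) = lat p - lat e by rewrite latN latD.
rewrite /zeta_part -!sumrB; apply: eq_bigr => p _.
rewrite /zeta_term latB.
have -> : z - (lat p - lat e) = z + lat e - lat p by ring.
have -> : z' - (lat p - lat e) = z' + lat e - lat p by ring.
by ring.
Qed.

Lemma telescope_int_box (V : zmodType) N (g : int -> V) :
  \sum_(m <- int_box N) (g (m - 1) - g m) = g (- N.+1%:Z) - g N%:Z.
Proof.
rewrite big_map -{1}(subn0 N.*2.+1) -/(index_iota _ _).
rewrite (eq_bigr (fun k : nat => (- g (k.+1%:Z - N.+1%:Z)) - (- g (k%:Z - N.+1%:Z)))); last first.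
  by move=> k _; rewrite opprK addrC; congr (- g _ + g _); lia.
rewrite telescope_sumr // opprK addrC; congr (g _ - g _); lia.
Qed.

(** A difference of two simple poles decays like the inverse square of the distance, whereas the
    edge of a box grows only linearly. *)
Lemma boundary_bound z z' : exists2 K : R, 0 <= K & exists M : nat, forall (N : nat) p, (M <= N)%N -> (N <= maxn `|p.1| `|p.2|)%N ->
  cabs ((z - lat p)^-1 - (z' - lat p)^-1) <= K / N%:R ^+ 2.
Proof.
have [c c0 hc] := lat_bound tau_gt0.
pose r := cabs z + cabs z'.
have r0 : 0 <= r by rewrite addr_ge0 // cabs_ge0.
exists (4 * cabs (z' - z) / c ^+ 2); first by rewrite divr_ge0 ?mulr_ge0 ?cabs_ge0 ?exprn_ge0 // ltW.
(* From this [N] on the lattice point is more than twice as far from 0 as [z] and [z'], so its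
   distance to them is at least [c * N / 2]. *)
exists (Num.truncn (2 * r / c)).+1 => N p MN Np.
have cN : 2 * r < c * N%:R.
  rewrite [c * _]mulrC -ltr_pdivrMr //; apply: lt_le_trans (truncnS_gt _) _.
  by rewrite ler_nat.
have N0 : 0 < N%:R :> R by rewrite ltr0n; apply: leq_trans MN.
have lb := hc p _ Np.
have far v : cabs v <= r -> c * N%:R / 2 <= cabs (v - lat p).
  by move=> vr; have := cabs_lb (lat p) v; rewrite cabsC; lra.
have h1 := far z; have h2 := far z'.
have {}h1 : c * N%:R / 2 <= cabs (z - lat p) by apply: h1; rewrite lerDl cabs_ge0.
have {}h2 : c * N%:R / 2 <= cabs (z' - lat p) by apply: h2; rewrite lerDr cabs_ge0.
have cN0 : 0 < c * N%:R / 2 by rewrite divr_gt0 // mulr_gt0.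
have n1 : z - lat p != 0 by rewrite -cabs_gt0; apply: lt_le_trans h1.
have n2 : z' - lat p != 0 by rewrite -cabs_gt0; apply: lt_le_trans h2.
have -> : (z - lat p)^-1 - (z' - lat p)^-1 = (z' - z) / ((z - lat p) * (z' - lat p)).
  by field; rewrite n1 n2.
rewrite cabs_div cabsM ler_pdivrMr ?mulr_gt0 ?cabs_gt0 //.
apply: le_trans (_ : 4 * cabs (z' - z) / c ^+ 2 / N%:R ^+ 2 * ((c * N%:R / 2) * (c * N%:R / 2)) <= _).
  have : c != 0 by rewrite gt_eqF. have : N%:R != 0 :> R by rewrite gt_eqF.
  move: (N%:R : R) => x x0 c0'; rewrite le_eqVlt; apply/orP; left; apply/eqP.
  by field; rewrite x0 c0'.
rewrite ler_wpM2l //; last by apply: ler_pM => //; exact: ltW.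
by rewrite !divr_ge0 ?mulr_ge0 ?cabs_ge0 ?exprn_ge0 // ltW.
Qed.

Lemma small_of_boundary (K : R) (u : nat -> C) : 0 <= K ->
  (exists M, forall N, (M <= N)%N -> cabs (u N) <= N.*2.+1%:R * (2 * (K / N%:R ^+ 2))) ->
  u @ \oo --> (0 : C).
Proof.
move=> K0 [M HM]; apply/cvg_cplxP => e e0.
exists (maxn M.+1 (Num.truncn (6 * K / e)).+1) => N; rewrite geq_max => /andP[N1 N2].
rewrite subr0; apply: le_trans (HM N (ltnW N1)) _.
have N0 : 0 < N%:R :> R by rewrite ltr0n; apply: leq_trans N1.
have N3 : 1 <= N%:R :> R by rewrite ler1n; apply: leq_trans N1.
have hN : 6 * K < e * N%:R.
  rewrite [e * _]mulrC -ltr_pdivrMr //; apply: lt_le_trans (truncnS_gt _) _.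
  by rewrite ler_nat.
have -> : N.*2.+1%:R = 2 * N%:R + 1 :> R by rewrite -natr1 -muln2 natrM mulrC.
move: (N%:R : R) N0 N3 hN => x x0 x1 hx.
have -> : (2 * x + 1) * (2 * (K / x ^+ 2)) = (4 * K * x + 2 * K) / x ^+ 2 by field; rewrite gt_eqF.
rewrite ler_pdivrMr ?exprn_gt0 //.
apply: le_trans (_ : 6 * K * x <= _).
  have h : K <= K * x by rewrite ler_peMr.
  by lra.
by rewrite expr2 mulrA ler_pM2r // ltW.
Qed.

(** After telescoping, the partial sums retain two opposite edges of the box, of total size O(1 /
    N). *)
Lemma wzeta_shift e z z' : e = (1, 0) \/ e = (0, 1) -> ~ lattice tau z -> ~ lattice tau z' ->
  wzeta tau (z + lat e) - wzeta tau z = wzeta tau (z' + lat e) - wzeta tau z'.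
Proof.
move=> he zL zL'; apply/eqP; rewrite -subr_eq0; apply/eqP.
have sL v : ~ lattice tau v -> ~ lattice tau (v + lat e).
  by move=> h /(lattice_addr _ (lattice_lat tau e)).
pose D N := (zeta_part N (z + lat e) - zeta_part N z) - (zeta_part N (z' + lat e) - zeta_part N z').
have h1 : D N @[N --> \oo] --> (wzeta tau (z + lat e) - wzeta tau z) - (wzeta tau (z' + lat e) - wzeta tau z').
  by apply: cvgB; apply: cvgB; apply: zeta_part_cvg => //; exact: sL.
apply: (cvg_cplx_unique h1).
have [K K0 [M HM]] := boundary_bound z z'.
apply: (small_of_boundary K0); exists M => N MN.
pose phi p := (z - lat p)^-1 - (z' - lat p)^-1.
have bnd (a b : int -> int * int) : (forall m, (N <= maxn `|(a m).1| `|(a m).2|)%N) ->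
    (forall m, (N <= maxn `|(b m).1| `|(b m).2|)%N) ->
    cabs (\sum_(m <- int_box N) (phi (a m) - phi (b m))) <= N.*2.+1%:R * (2 * (K / N%:R ^+ 2)).
  move=> ha hb; apply: le_trans (cabs_sum _ _ _) _.
  apply: le_trans (_ : \sum_(m <- int_box N) (2 * (K / N%:R ^+ 2)) <= _).
    apply: ler_sum => m _; apply: le_trans (cabsB _ _) _.
    by rewrite mulr_natl mulr2n; apply: lerD; [exact: HM MN (ha m)|exact: HM MN (hb m)].
  by rewrite big_const_seq count_predT iter_addr_0 size_int_box [leRHS]mulr_natl.
rewrite /D zeta_part_shift /index_box.
case: he => ->.
- rewrite big_allpairs exchange_big /= /padd /=.
  rewrite (eq_bigr (fun n => phi (- N.+1%:Z, n) - phi (N%:Z, n))); last first.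
    move=> n _; rewrite -(telescope_int_box N (fun m => phi (m, n))).
    by apply: eq_bigr => m _; rewrite subr0.
  by apply: bnd => m /=; lia.
- rewrite big_allpairs /= /padd /=.
  rewrite (eq_bigr (fun m => phi (m, - N.+1%:Z) - phi (m, N%:Z))); last first.
    move=> m _; rewrite -(telescope_int_box N (fun n => phi (m, n))).
    by apply: eq_bigr => n _; rewrite subr0.
  by apply: bnd => m /=; lia.
Qed.

Lemma lat10 : lat (1, 0) = 1. Proof. by rewrite /lat /= mul0r addr0. Qed.
Lemma lat01 : lat (0, 1) = tau. Proof. by rewrite /lat /= mul1r add0r. Qed.

Lemma half_not_lattice w : w = 1 \/ w = tau -> ~ lattice tau (w / 2).
Proof.
have nz (m : int) : (1 / 2 : R) <> m%:~R.
  move=> h; have : 0 < (m%:~R : R) < 1 by rewrite -h; lra.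
  by rewrite ltr0z ltrz1; lia.
move=> hw; case: hw => -> h.
- have : lattice tau (mkC (1 / 2) 0 + mkC 0 0 * tau).
    rewrite mul0r addr0 (_ : mkC (1 / 2) 0 = 1 / 2 :> C) //.
    by rewrite (_ : mkC (1 / 2) 0 = real_complex R (1 / 2)) // rmorphM fmorphV rmorph1 rmorph_nat.
  by case/(lattice_coord tau_gt0) => m [n [/nz]].
- have : lattice tau (mkC 0 0 + mkC (1 / 2) 0 * tau).
    rewrite add0r (_ : mkC (1 / 2) 0 * tau = tau / 2 :> C) //.
    by rewrite (_ : mkC (1 / 2) 0 = real_complex R (1 / 2)) // rmorphM fmorphV rmorph1 rmorph_nat mul1r mulrC.
  by case/(lattice_coord tau_gt0) => m [n [_ /nz]].
Qed.

(** [quasi_period] is a choice with default 0, so the set it chooses from must be shown inhabited;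
    the increment at [w / 2] is a witness by [wzeta_shift]. *)
Lemma wzeta_quasi_period w z : w = 1 \/ w = tau -> ~ lattice tau z ->
  wzeta tau (z + w) = wzeta tau z + quasi_period tau w.
Proof.
move=> hw zL.
have [e he we] : exists2 e, e = (1, 0) \/ e = (0, 1) & w = lat e.
  case: hw => ->; [exists (1, 0)|exists (0, 1)]; rewrite ?lat10 ?lat01 //; [by left|by right].
suff : [set e : C | forall z, ~ lattice tau z -> wzeta tau (z + w) = wzeta tau z + e] (quasi_period tau w).
  by apply.
apply: (xgetPex 0); exists (wzeta tau (w / 2 + w) - wzeta tau (w / 2)) => v vL.
have -> : wzeta tau (w / 2 + w) - wzeta tau (w / 2) = wzeta tau (v + w) - wzeta tau v.
  by rewrite we; apply: wzeta_shift => //; rewrite -we; exact: half_not_lattice.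
by rewrite [RHS]addrC subrK.
Qed.

(** The quotient of [s (z + w) * cexp (- eta * z)] by [s z] is entire because the zeros are simple
    and periodic. Its logarithmic derivative vanishes by the quasi-periodicity of zeta, so it is
    constant. *)
Lemma sigma_quasi_period w z : w = 1 \/ w = tau ->
  wsigma tau (z + w) = - cexp (quasi_period tau w * (z + w / 2)) * wsigma tau z.
Proof.
move=> hw.
have wL : lattice tau w by case: hw => ->; [exact: lattice1|exact: lattice_tau].
set eta := quasi_period tau w; pose s := wsigma tau.
have es : entire s := entire_sigma tau_gt0.
pose phi z := s (z + w) * cexp (- eta * z).
have h1 v : has_deriv (fun v => s (v + w)) v (derive1 s (v + w)).
  rewrite -[derive1 s (v + w)]mulr1; apply: (has_deriv_comp (g := fun v => v + w)) (entire_deriv _ es).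
  by rewrite -[X in has_deriv _ _ X]addr0; apply: has_derivD; [exact: has_deriv_id|exact: has_deriv_cst].
have h2 v : has_deriv (fun v => cexp (- eta * v)) v (cexp (- eta * v) * - eta).
  apply: (has_deriv_comp (g := fun v => - eta * v)) (cexp_deriv _).
  by rewrite -[X in has_deriv _ _ X]mulr1; apply: has_derivZ; exact: has_deriv_id.
have hphi v := has_derivM (h1 v) (h2 v).
have ephi : entire phi by move=> v; eexists; exact: hphi.
have [psi epsi psiE] : exists2 psi, entire psi & forall z, phi z = psi z * s z.
  apply: entire_div => // a /(sigma_eq0 tau_gt0) aL; split; first exact: dsigma_lattice.
  by rewrite /phi (_ : s (a + w) = 0) ?mul0r //; apply/(sigma_eq0 tau_gt0); exact: latticeD.
have dpsi0 v : derive1 psi v = 0.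
  apply: (entire_zero_off_lattice tau_gt0 (entire_derive1 epsi)) => {}v vL.
  have sv : s v != 0 by exact: sigma_neq0.
  have swv : s (v + w) != 0 by apply: sigma_neq0 => // /(lattice_addr _ wL).
  have D1 : derive1 phi v = derive1 psi v * s v + psi v * derive1 s v.
    rewrite (_ : phi = fun z => psi z * s z); last exact/funext.
    by apply: has_derivE; apply: has_derivM; exact: entire_deriv.
  have Zq := wzeta_quasi_period hw vL.
  have D2 : derive1 phi v = phi v * (wzeta tau v).
    rewrite (has_derivE (hphi v)) /phi.
    have -> : wzeta tau v = derive1 s (v + w) / s (v + w) - eta.
      by rewrite -[X in X / _]/(derive1 (wsigma tau) (v + w)) -/(wzeta tau (v + w)) Zq addrK.
    by move: (cexp _) (derive1 _ _) => x y; field.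
  apply: (mulIf sv); rewrite mul0r.
  have : derive1 phi v = psi v * derive1 s v.
    by rewrite D2 psiE /wzeta -/s; move: (derive1 s v) => x; field.
  by rewrite D1 => /eqP; rewrite -subr_eq0 addrK => /eqP.
have cpsi a b : psi a = psi b.
  by apply: cderiv0_const => v; rewrite -(dpsi0 v); exact: entire_deriv.
have sh : s (w / 2) != 0 by apply: sigma_neq0 => //; exact: half_not_lattice.
(* At [- (w / 2)] the translate is [w / 2], and oddness relates the two values of [s]. *)
have v0 : psi z = - cexp (eta * (w / 2)).
  rewrite (cpsi z (- (w / 2))); have := psiE (- (w / 2)).
  rewrite /phi /s (sigma_odd tau_gt0) -/s mulNr mulrN opprK.
  have -> : - (w / 2) + w = w / 2 by field.
  move=> E; apply: (mulIf sh); rewrite mulNr [cexp _ * _]mulrC E mulrN opprK //.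
have := psiE z; rewrite /phi v0 => E.
rewrite -/s mulrDr cexpD mulNr.
apply: (mulIf (cexp_neq0 (- eta * z))); rewrite E.
have -> : cexp (- eta * z) = (cexp (eta * z))^-1 by rewrite mulNr cexpN.
have := cexp_neq0 (eta * z); move: (cexp (eta * z)) (cexp _) => x y x0.
by field.
Qed.

End QuasiPeriods.

(** * Doubly periodic entire functions *)

Section PeriodicLiouville.
Context {R : realType}.
Local Notation C := (cplx R).
Local Notation Re := complex.Re.
Local Notation Im := complex.Im.
Implicit Types (z w c : C).

Lemma int_shift_ind (T : Type) (P : C -> T) c : (forall z, P (z + c) = P z) ->
  forall (m : int) z, P (z + m%:~R * c) = P z.
Proof.
move=> h m; elim/int_rec: m => [|n IH|n IH] z.
- by rewrite mul0r addr0.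
- by rewrite -addn1 PoszD intrD mulrDl mul1r addrA h IH.
- by rewrite -(h (z + _)) -addn1 PoszD opprD intrD mulrDl mulN1r addrA subrK IH.
Qed.

Lemma liouville_periodic f c z w : 0 < Im c -> entire f ->
  (forall z, f (z + 1) = f z) -> (forall z, f (z + c) = f z) -> f z = f w.
Proof.
move=> c0 ef h1 hc.
have [M M0 HM] := entire_bounded (1 + Im c + cabs c) ef.
apply: (@liouville R f M) => // {z w} z.
pose n : int := Num.floor (Im z / Im c).
pose z1 := z - n%:~R * c.
pose m : int := Num.floor (Re z1).
have -> : f z = f (z1 - m%:~R).
  have := int_shift_ind hc n (z1 - m%:~R); rewrite -(int_shift_ind h1 m) mulr1 => <-.
  by congr (f _); rewrite /z1; ring.
apply: HM.
have fl (x : R) : 0 <= x - (Num.floor x)%:~R <= 1.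
  have := floor_le_tmp x. have := lt_succ_floor x. rewrite intrD; lra.
have rz : `|Re (z1 - m%:~R)| <= 1.
  rewrite ReD ReN mkC_int /=; have := fl (Re z1); rewrite -/m => /andP[? ?].
  by rewrite ler_norml; lra.
have iz : `|Im (z1 - m%:~R)| <= Im c.
  rewrite ImD ImN mkC_int /= subr0 /z1 ImD ImN ImM mkC_int /= mul0r addr0.
  have := fl (Im z / Im c); rewrite -/n => /andP[a1 a2].
  have -> : Im z - n%:~R * Im c = (Im z / Im c - n%:~R) * Im c.
    by rewrite mulrBl divfK // gt_eqF.
  rewrite normrM (ger0_norm (ltW c0)) ger0_norm //.
  by rewrite ler_piMl // ltW.
apply: le_trans (cabs_le_ReIm _) _.
by have := cabs_ge0 c; lra.
Qed.

(** At a zero of [B] the product rule leaves [D * B'], and [B'] does not vanish there. *)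
Lemma entire_cancel (D B : C -> C) : entire D -> entire B ->
  (forall a, B a = 0 -> derive1 B a != 0) -> (forall z, D z * B z = 0) -> forall z, D z = 0.
Proof.
move=> eD eB hB h z.
have [Bz|Bz] := eqVneq (B z) 0; last by apply: (mulIf Bz); rewrite h mul0r.
have := has_derivM (entire_deriv z eD) (entire_deriv z eB).
rewrite (_ : (fun y => D y * B y) = fun _ => 0); last exact/funext.
move=> /has_deriv_uniq /(_ (has_deriv_cst 0 z)) /eqP; rewrite Bz mulr0 add0r mulf_eq0.
by rewrite (negbTE (hB z Bz)) orbF => /eqP.
Qed.

Lemma has_deriv_shift f z c l : has_deriv f (z + c) l -> has_deriv (fun w => f (w + c)) z l.
Proof.
move=> h; rewrite -[l]mulr1; apply: (has_deriv_comp (g := fun v => v + c)) h.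
by rewrite -[X in has_deriv _ _ X]addr0; apply: has_derivD; [exact: has_deriv_id|exact: has_deriv_cst].
Qed.

Lemma has_deriv_scale f z c l : has_deriv f (c * z) l -> has_deriv (fun w => f (c * w)) z (l * c).
Proof.
move=> h; apply: (has_deriv_comp (g := fun v => c * v)) h.
by rewrite -[X in has_deriv _ _ X]mulr1; apply: has_derivZ; exact: has_deriv_id.
Qed.

Lemma has_deriv_opp f z l : has_deriv f (- z) l -> has_deriv (fun w => f (- w)) z (- l).
Proof.
move=> h; rewrite -mulrN1; apply: (has_deriv_comp (g := fun v => - v)) h.
by apply: has_derivN; exact: has_deriv_id.
Qed.

End PeriodicLiouville.

(** * The Weierstrass function as a quotient of entire functions *)

Section WeierstrassP.
Context {R : realType}.
Local Notation C := (cplx R).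
Local Notation Re := complex.Re.
Local Notation Im := complex.Im.
Implicit Types (z w : C).
Variable tau : C.
Hypothesis tau_gt0 : 0 < Im tau.
Local Notation s := (wsigma tau).
Local Notation ds := (derive1 (wsigma tau)).
Local Notation dds := (derive1 (derive1 (wsigma tau))).
Local Notation eta w := (quasi_period tau w).
Local Notation period w := (w = 1 \/ w = tau).

Let es : entire s := entire_sigma tau_gt0.
Let eds : entire ds := entire_derive1 es.
Let edds : entire dds := entire_derive1 eds.

(** This is [s^2 wp], which is entire; together with [wpden] it replaces [wp] by a pair without
    poles. *)
Definition wpnum z := ds z ^+ 2 - s z * dds z.
Definition wpden z := s z ^+ 2.

Lemma entire_wpnum : entire wpnum.
Proof. by apply: entireB (entireX 2 eds) (entireM es edds). Qed.

Lemma entire_wpden : entire wpden.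
Proof. exact: entireX. Qed.

Lemma wpE z : ~ lattice tau z -> wp tau z = wpnum z / wpden z.
Proof.
move=> zL; have sz : s z != 0 by exact: sigma_neq0.
have h : has_deriv (wzeta tau) z (dds z * (s z)^-1 + ds z * (- ds z / s z ^+ 2)).
  by apply: has_derivM (entire_deriv z eds) (has_derivV sz (entire_deriv z es)).
rewrite /wp (has_derivE h) /wpnum /wpden.
by move: (dds z) (ds z) => x y; field.
Qed.

Definition multiplier w z := - cexp (eta w * (z + w / 2)).

Lemma multiplier_neq0 w z : multiplier w z != 0.
Proof. by rewrite oppr_eq0 cexp_neq0. Qed.

Lemma s_shift w z : period w -> s (z + w) = multiplier w z * s z.
Proof. exact: sigma_quasi_period. Qed.

Lemma has_deriv_multiplier w z : has_deriv (multiplier w) z (multiplier w z * eta w).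
Proof.
have h : has_deriv (fun z => eta w * (z + w / 2)) z (eta w).
  rewrite -[X in has_deriv _ _ X]mulr1; apply: has_derivZ.
  by rewrite -[X in has_deriv _ _ X]addr0; apply: has_derivD; [exact: has_deriv_id|exact: has_deriv_cst].
by rewrite /multiplier mulNr; apply: has_derivN; apply: has_deriv_comp h (cexp_deriv _).
Qed.

Lemma ds_shift w z : period w -> ds (z + w) = multiplier w z * (ds z + eta w * s z).
Proof.
move=> hw; have h1 := has_deriv_shift (entire_deriv (z + w) es).
have h2 := has_derivM (has_deriv_multiplier w z) (entire_deriv z es).
rewrite (_ : (fun w0 => s (w0 + w)) = fun y => multiplier w y * s y) in h1; last first.
  by apply/funext => y; exact: s_shift.
rewrite (has_deriv_uniq h1 h2); move: (ds z) (s z) (multiplier w z) (eta w) => a b c d.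
by ring.
Qed.

Lemma dds_shift w z : period w ->
  dds (z + w) = multiplier w z * (dds z + 2 * eta w * ds z + eta w ^+ 2 * s z).
Proof.
move=> hw; have h1 := has_deriv_shift (entire_deriv (z + w) eds).
have h2 := has_derivM (has_deriv_multiplier w z)
  (has_derivD (entire_deriv z eds) (has_derivZ (eta w) (entire_deriv z es))).
rewrite (_ : (fun w0 => ds (w0 + w)) = fun y => multiplier w y * (ds y + eta w * s y)) in h1; last first.
  by apply/funext => y; exact: ds_shift.
rewrite (has_deriv_uniq h1 h2); move: (dds z) (ds z) (s z) (multiplier w z) (eta w) => a b c d e.
by ring.
Qed.

Lemma wpnum_shift w z : period w -> wpnum (z + w) = multiplier w z ^+ 2 * wpnum z.
Proof.
move=> hw; rewrite /wpnum s_shift // ds_shift // dds_shift //.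
by move: (dds z) (ds z) (s z) (multiplier w z) (eta w) => a b c d e; ring.
Qed.

Lemma wpden_shift w z : period w -> wpden (z + w) = multiplier w z ^+ 2 * wpden z.
Proof. by move=> hw; rewrite /wpden s_shift // exprMn. Qed.

Lemma ds_even z : ds (- z) = ds z.
Proof.
have h1 := has_deriv_opp (entire_deriv (- z) es).
have h2 := has_derivN (entire_deriv z es).
rewrite (_ : (fun w => s (- w)) = fun w => - s w) in h1; last first.
  by apply/funext => y; exact: sigma_odd.
by apply: oppr_inj; exact: (has_deriv_uniq h1 h2).
Qed.

Lemma dds_odd z : dds (- z) = - dds z.
Proof.
have h1 := has_deriv_opp (entire_deriv (- z) eds).
have h2 := entire_deriv z eds.
rewrite (_ : (fun w => ds (- w)) = ds) in h1; last by apply/funext => y; exact: ds_even.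
by apply: oppr_inj; rewrite opprK; exact: (has_deriv_uniq h1 h2).
Qed.

Lemma wpnum_even z : wpnum (- z) = wpnum z.
Proof. by rewrite /wpnum ds_even dds_odd sigma_odd // mulrNN. Qed.

Lemma wpden_even z : wpden (- z) = wpden z.
Proof. by rewrite /wpden sigma_odd // sqrrN. Qed.

Lemma zeros_lattice_shift (g : C -> C) : (forall w z, period w -> (g (z + w) == 0) = (g z == 0)) ->
  forall z w, lattice tau w -> (g (z + w) == 0) = (g z == 0).
Proof.
move=> h z w [m [n ->]].
rewrite addrA (int_shift_ind (P := fun z => g z == 0)); last by move=> v; apply: h; right.
by rewrite -[m%:~R]mulr1 (int_shift_ind (P := fun z => g z == 0)) // => v; apply: h; left.
Qed.

(* Both sides are entire in z, have the same multipliers under translation by periods, and the right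
   hand side has simple zeros at which the left hand side vanishes, so their quotient is constant. *)
Lemma wp_difference z w : ~ lattice tau w -> ~ lattice tau (w + w) ->
  wpnum z - wp tau w * wpden z = - (s (z - w) * s (z + w)) / s w ^+ 2.
Proof.
move=> wL wwL; set p := wp tau w.
have sw : s w != 0 by exact: sigma_neq0.
pose A z := wpnum z - p * wpden z; pose B z := s (z - w) * s (z + w).
have eA : entire A by apply: entireB entire_wpnum (entireM (entire_cst p) entire_wpden).
have hB v : has_deriv B v (ds (v - w) * s (v + w) + s (v - w) * ds (v + w)).
  by apply: has_derivM; apply: has_deriv_shift; exact: entire_deriv.
have eB : entire B by move=> v; eexists; exact: hB.
have As v y : period v -> A (y + v) = multiplier v y ^+ 2 * A y.
  by move=> hv; rewrite /A wpnum_shift // wpden_shift // [RHS]mulrBr [p * _]mulrCA.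
have Bs v y : period v -> B (y + v) = multiplier v y ^+ 2 * B y.
  move=> hv; rewrite /B addrAC [y + v + w]addrAC (s_shift (y - w) hv) (s_shift (y + w) hv) mulrACA; congr (_ * _).
  by rewrite /multiplier mulrNN expr2 mulrNN -!cexpD; congr cexp; ring.
have Az : A w = 0 by rewrite /A /p wpE // divfK ?subrr // expf_neq0.
have AN y : A (- y) = A y by rewrite /A wpnum_even wpden_even.
have zA v y : period v -> (A (y + v) == 0) = (A y == 0).
  by move=> hv; rewrite As // mulf_eq0 expf_eq0 /= (negbTE (multiplier_neq0 _ _)).
have A0s y v : lattice tau v -> A y = 0 -> A (y + v) = 0.
  by move=> hv h; apply/eqP; rewrite (zeros_lattice_shift zA) // h.
have zB a : B a = 0 -> derive1 B a != 0 /\ A a = 0.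
  move/eqP; rewrite mulf_eq0 => /orP[]/eqP/(sigma_eq0 tau_gt0) aL; split.
  - rewrite (has_derivE (hB a)) (_ : s (a - w) = 0) ?mul0r ?addr0; last exact/(sigma_eq0 tau_gt0).
    rewrite mulf_neq0 ?dsigma_lattice //; apply: sigma_neq0 => // h.
    by apply: wwL; rewrite (_ : w + w = (a + w) - (a - w)); [exact: latticeD h (latticeN aL)|ring].
  - by rewrite (_ : a = w + (a - w)); [exact: A0s|ring].
  - rewrite (has_derivE (hB a)) (_ : s (a + w) = 0) ?mulr0 ?add0r; last exact/(sigma_eq0 tau_gt0).
    rewrite mulf_neq0 ?dsigma_lattice //; apply: sigma_neq0 => // h.
    by apply: wwL; rewrite (_ : w + w = (a + w) - (a - w)); [exact: latticeD aL (latticeN h)|ring].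
  - by rewrite (_ : a = - w + (a + w)); [apply: A0s; rewrite ?AN|ring].
have [psi epsi psiE] := entire_div eA eB zB.
have per v y : period v -> psi (y + v) = psi y.
  move=> hv; apply/eqP; rewrite -subr_eq0; apply/eqP.
  have eD : entire (fun y => psi (y + v) - psi y).
    by apply: entireB => //; move=> t; eexists; apply: has_deriv_shift; exact: entire_deriv.
  apply: (entire_cancel eD eB) => [a /zB [] //|t].
  apply: (mulfI (expf_neq0 2 (multiplier_neq0 v t))).
  have E1 := psiE (t + v); rewrite As // Bs // in E1.
  by rewrite mulr0 mulrBl mulrBr mulrCA -E1 -(psiE t) subrr.
have cst : psi z = psi 0.
  by apply: (liouville_periodic _ _ tau_gt0 epsi) => y; apply: per; [left|right].
have E := psiE z; rewrite cst in E.
(* At [z = 0] the left side of the formula is [wpnum 0 = 1] and [B 0 = - s w ^+ 2], which fixes the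
   constant. *)
have := psiE 0; rewrite /A /B /wpnum /wpden sub0r add0r sigma_odd // sigma0 // dsigma0 //.
rewrite mul0r expr1n subr0 expr0n /= mulr0 subr0 => E0.
have c : psi 0 * s w ^+ 2 = -1.
  by apply: oppr_inj; rewrite opprK [RHS]E0; move: (psi 0) (s w) => x y; ring.
rewrite -/(A z) E; apply: (mulIf (expf_neq0 2 sw)).
by rewrite divfK ?expf_neq0 // mulrAC c mulN1r.
Qed.

Lemma wp_sub z w : ~ lattice tau z -> ~ lattice tau w -> ~ lattice tau (w + w) ->
  wp tau z - wp tau w = - (s (z - w) * s (z + w)) / (s w ^+ 2 * s z ^+ 2).
Proof.
move=> zL wL wwL; have sz : s z != 0 by exact: sigma_neq0.
have sw : s w != 0 by exact: sigma_neq0.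
rewrite [in wp tau z]wpE //.
have -> : wpnum z / wpden z - wp tau w = (wpnum z - wp tau w * wpden z) / wpden z.
  by rewrite [RHS]mulrBl mulfK // expf_neq0.
rewrite wp_difference // /wpden; move: (s (z - w)) (s (z + w)) => x y.
by field; rewrite sz sw.
Qed.

Lemma wpnum_wronskian z :
  derive1 wpnum z * wpden z - wpnum z * derive1 wpden z = - s (2 * z).
Proof.
pose E z := derive1 wpnum z * wpden z - wpnum z * derive1 wpden z + s (2 * z).
have es2 : entire (fun z => s (2 * z)).
  by move=> v; eexists; apply: has_deriv_scale; exact: entire_deriv.
have eE : entire E.
  apply: entireD es2; apply: entireB; apply: entireM.
  - exact: entire_derive1 entire_wpnum.
  - exact: entire_wpden.
  - exact: entire_wpnum.
  - exact: entire_derive1 entire_wpden.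
suff : E z = 0 by rewrite /E => /eqP; rewrite addr_eq0 => /eqP.
apply: (entire_cancel eE es2) => [a /(sigma_eq0 tau_gt0) aL|w].
  rewrite (has_derivE (has_deriv_scale (entire_deriv (2 * a) es))).
  by apply: mulf_neq0; [exact: dsigma_lattice|rewrite pnatr_eq0].
have [h|wwL] := pselect (lattice tau (w + w)).
  by rewrite (_ : s (2 * w) = 0) ?mulr0 //; apply/(sigma_eq0 tau_gt0); rewrite mulr_natl mulr2n.
have wL : ~ lattice tau w by move=> h; apply: wwL; exact: latticeD.
have sw : s w != 0 by exact: sigma_neq0.
suff -> : E w = 0 by rewrite mul0r.
have h1 := has_derivB (entire_deriv w entire_wpnum) (has_derivZ (wp tau w) (entire_deriv w entire_wpden)).
have h2 : has_deriv (fun z => - (s w ^+ 2)^-1 * (s (z - w) * s (z + w))) w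
    (- (s w ^+ 2)^-1 * (ds (w - w) * s (w + w) + s (w - w) * ds (w + w))).
  by apply: has_derivZ; apply: has_derivM; apply: has_deriv_shift; exact: entire_deriv.
rewrite (_ : (fun y => wpnum y - wp tau w * wpden y) =
  (fun z => - (s w ^+ 2)^-1 * (s (z - w) * s (z + w)))) in h1; last first.
  by apply/funext => y; rewrite wp_difference // mulNr mulNr mulrC.
have := has_deriv_uniq h1 h2; rewrite subrr sigma0 // dsigma0 // mul0r addr0 mul1r wpE // => D.
rewrite /E (_ : 2 * w = w + w); last by rewrite mulr_natl mulr2n.
have -> : derive1 wpnum w = wpnum w / wpden w * derive1 wpden w - (s w ^+ 2)^-1 * s (w + w).
  by rewrite -[LHS](subrK (wpnum w / wpden w * derive1 wpden w)) D; ring.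
rewrite /wpden -/wpden; move: (derive1 wpden w) (wpnum w) (s (w + w)) => x y t.
by rewrite /wpden; field.
Qed.

End WeierstrassP.

(** * Homogeneous fractions on the Riemann sphere *)

Section SphereLemmas.
Context {R : realType}.
Local Notation C := (cplx R).
Implicit Types (a b c : C).

Lemma P1frac_scale c a b : c != 0 -> P1frac (c * a) (c * b) = P1frac a b.
Proof.
move=> c0; rewrite /P1frac mulf_eq0 (negbTE c0) /=; case: (eqVneq b 0) => // b0.
by congr Some; field; rewrite b0 c0.
Qed.

Lemma P1oppE a b : P1opp (P1frac a b) = P1frac (- a) b.
Proof. by rewrite /P1frac; case: (eqVneq b 0) => //= b0; rewrite mulNr. Qed.

Lemma P1invE a b : (a != 0) || (b != 0) -> P1inv (P1frac a b) = P1frac b a.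
Proof.
rewrite /P1frac; case: (eqVneq b 0) => [->|b0] /=.
  by rewrite orbF => a0; rewrite (negbTE a0) mul0r.
rewrite /P1frac mulf_eq0 invr_eq0 (negbTE b0) orbF; case: (eqVneq a 0) => // a0 _.
by congr Some; field; rewrite a0 b0.
Qed.

Lemma P1frac_some a b : b != 0 -> P1frac a b = Some (a / b).
Proof. by rewrite /P1frac => /negbTE ->. Qed.

End SphereLemmas.

(** * Numerator and denominator of the developing map *)

Section DevelopingMap.
Context {R : realType}.
Local Notation C := (cplx R).
Local Notation Re := complex.Re.
Local Notation Im := complex.Im.
Implicit Types (z w : C).
Variable tau : C.
Hypothesis tau_gt0 : 0 < Im tau.
Local Notation s := (wsigma tau).
Local Notation ds := (derive1 (wsigma tau)).
Local Notation eta w := (quasi_period tau w).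

Let es : entire s := entire_sigma tau_gt0.

Lemma quarter_lattice (a b : int) : lattice tau ((a%:~R + b%:~R * tau) / 4) ->
  exists m n : int, a = 4 * m /\ b = 4 * n.
Proof.
move=> /latticeP [[m n] E]; exists m, n.
have : lat tau (a, b) = lat tau (4 * m, 4 * n).
  by rewrite {1}/lat /= -[LHS](@divfK _ 4) ?pnatr_eq0 // E /lat /= !intrM; ring.
by move/(lat_inj tau_gt0) => [-> ->].
Qed.

Definition dev_cst : C := cexp (1 / 4 * eta tau * (1 + tau)).

Definition dev_num z := - dev_cst * (s (z / 2 - 1 / 4) * s (z / 2 + 1 / 4)).

Definition dev_den z := s (z / 2 - 1 / 4 - tau / 2) * s (z / 2 + 1 / 4 + tau / 2).

Definition dev_map z : P1 R := P1frac (dev_num z) (dev_den z).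

Definition dev_wronskian z := derive1 dev_num z * dev_den z - dev_num z * derive1 dev_den z.

Let entire_s_affine (c : C) : entire (fun z => s (z / 2 + c)).
Proof. by apply: (entire_comp (f := s)) es _; apply: entireD (entireM entire_id (entire_cst _)) (entire_cst _). Qed.

Lemma entire_dev_num : entire dev_num.
Proof. by apply: entireM (entire_cst _) (entireM _ _); exact: entire_s_affine. Qed.

Lemma entire_dev_den : entire dev_den.
Proof.
rewrite (_ : dev_den = fun z => s (z / 2 + (- (1 / 4) - tau / 2)) * s (z / 2 + (1 / 4 + tau / 2))).
  by apply: entireM; exact: entire_s_affine.
by apply/funext => z; rewrite /dev_den !addrA.
Qed.

Lemma dev_cst_neq0 : dev_cst != 0. Proof. exact: cexp_neq0. Qed.

Lemma dev_num_even z : dev_num (- z) = dev_num z.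
Proof.
rewrite /dev_num; congr (_ * _).
have -> : - z / 2 - 1 / 4 = - (z / 2 + 1 / 4) by field.
have -> : - z / 2 + 1 / 4 = - (z / 2 - 1 / 4) by field.
by rewrite !sigma_odd // mulrNN mulrC.
Qed.

Lemma dev_den_even z : dev_den (- z) = dev_den z.
Proof.
rewrite /dev_den.
have -> : - z / 2 - 1 / 4 - tau / 2 = - (z / 2 + 1 / 4 + tau / 2) by field.
have -> : - z / 2 + 1 / 4 + tau / 2 = - (z / 2 - 1 / 4 - tau / 2) by field.
by rewrite !sigma_odd // mulrNN mulrC.
Qed.

Definition dev_mult1 z := - cexp (eta 1 * (z / 2 + 1 / 4)).
Definition dev_mult_tau z := dev_cst * cexp (eta tau * (z / 2 - 1 / 4)).

Lemma dev_mult1_neq0 z : dev_mult1 z != 0. Proof. by rewrite oppr_eq0 cexp_neq0. Qed.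
Lemma dev_mult_tau_neq0 z : dev_mult_tau z != 0. Proof. by rewrite mulf_neq0 // cexp_neq0. Qed.

Lemma dev_num_shift1 z : dev_num (z + 1) = dev_mult1 z * dev_num z.
Proof.
rewrite /dev_num.
have -> : (z + 1) / 2 - 1 / 4 = z / 2 + 1 / 4 by field.
have -> : (z + 1) / 2 + 1 / 4 = z / 2 - 1 / 4 + 1 by field.
rewrite (s_shift tau_gt0 (w := 1)); last by left.
rewrite /multiplier (_ : z / 2 - 1 / 4 + 1 / 2 = z / 2 + 1 / 4); last by field.
by rewrite /dev_mult1; move: (s _) (s _) (cexp _) => x y t; ring.
Qed.

(** The discrepancy between the multipliers of [dev_den] and [dev_num] under translation by 1. In
    Legendre's relation the exponent is [pi i]. *)
Let dev_ratio : C := cexp ((eta 1 * tau - eta tau) / 2).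

Let dev_den_shift1' z : dev_den (z + 1) = dev_ratio * dev_mult1 z * dev_den z.
Proof.
rewrite /dev_den.
have -> : (z + 1) / 2 - 1 / 4 - tau / 2 = z / 2 + 1 / 4 - tau / 2 by field.
have -> : (z + 1) / 2 + 1 / 4 + tau / 2 = z / 2 - 1 / 4 + tau / 2 + 1 by field.
rewrite (s_shift tau_gt0 (w := 1)); last by left.
have e1 := s_shift tau_gt0 (w := tau) (z / 2 - 1 / 4 - tau / 2) (or_intror erefl).
have e2 := s_shift tau_gt0 (w := tau) (z / 2 + 1 / 4 - tau / 2) (or_intror erefl).
have E1 : z / 2 - 1 / 4 - tau / 2 + tau = z / 2 - 1 / 4 + tau / 2 by field.
have E2 : z / 2 + 1 / 4 - tau / 2 + tau = z / 2 + 1 / 4 + tau / 2 by field.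
rewrite E1 in e1; rewrite E2 in e2; rewrite e1 e2 /multiplier /dev_mult1 /dev_ratio.
move: (s (z / 2 - 1 / 4 - tau / 2)) (s (z / 2 + 1 / 4 - tau / 2)) => x y.
set A := cexp (eta 1 * _); set B := cexp (eta tau * _); set D := cexp ((_ - _) / 2).
set E := cexp (eta 1 * _); set F := cexp (eta tau * _).
suff H : A * B = D * E * F by rewrite !mulNr !mulrN !opprK; move: H => H'; have := congr1 (fun t => t * (x * y)) H'; move=> H2; transitivity (A * B * (x * y)); [ring|rewrite H'; ring].
rewrite /A /B /D /E /F -!cexpD; congr cexp.
by move: (eta 1) (eta tau) => u v; field.
Qed.

Lemma dev_num_shift_tau z : dev_num (z + tau) = dev_mult_tau z * dev_den z.
Proof.
rewrite /dev_num /dev_den.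
have -> : (z + tau) / 2 - 1 / 4 = z / 2 - 1 / 4 - tau / 2 + tau by field.
have -> : (z + tau) / 2 + 1 / 4 = z / 2 + 1 / 4 + tau / 2 by field.
rewrite (s_shift tau_gt0 (w := tau)); last by right.
rewrite /multiplier /dev_mult_tau (_ : z / 2 - 1 / 4 - tau / 2 + tau / 2 = z / 2 - 1 / 4); last by field.
by move: (s _) (s _) (cexp (eta tau * _)) => x y t; ring.
Qed.

Lemma dev_den_shift_tau z : dev_den (z + tau) = dev_mult_tau z * dev_num z.
Proof.
rewrite /dev_num /dev_den.
have -> : (z + tau) / 2 - 1 / 4 - tau / 2 = z / 2 - 1 / 4 by field.
have -> : (z + tau) / 2 + 1 / 4 + tau / 2 = z / 2 + 1 / 4 + tau by field.
rewrite (s_shift tau_gt0 (w := tau)); last by right.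
rewrite /multiplier /dev_mult_tau /dev_cst.
move: (s _) (s _) => x y.
set A := cexp (eta tau * _); set B := cexp (1 / 4 * _ * _); set D := cexp (eta tau * _).
suff -> : A = B * B * D by ring.
by rewrite /A /B /D -!cexpD; congr cexp; field.
Qed.

Local Notation qa := (1 / 4 : C).
Local Notation qb := (1 / 4 + tau / 2).

Let quarter_ne (a b : int) w : w = (a%:~R + b%:~R * tau) / 4 -> (a %% 4)%Z != 0 \/ (b %% 4)%Z != 0 -> ~ lattice tau w.
Proof. by move=> -> h /quarter_lattice [m [n [ha hb]]]; lia. Qed.

Let qaL : ~ lattice tau qa.
Proof. by apply: (@quarter_ne 1 0); [field|left]. Qed.
Let qaaL : ~ lattice tau (qa + qa).
Proof. by apply: (@quarter_ne 2 0); [field|left]. Qed.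
Let qbL : ~ lattice tau qb.
Proof. by apply: (@quarter_ne 1 2); [field|left]. Qed.
Let qbbL : ~ lattice tau (qb + qb).
Proof. by apply: (@quarter_ne 2 4); [field|left]. Qed.

Lemma half_notin_lattice : ~ lattice tau (1 / 2).
Proof. by apply: (@quarter_ne 2 0); [field|left]. Qed.

Let sqa : s qa != 0. Proof. exact: sigma_neq0. Qed.
Let sqb : s qb != 0. Proof. exact: sigma_neq0. Qed.

Lemma dev_num_wp z : dev_num z = dev_cst * s qa ^+ 2 * (wpnum tau (z / 2) - wp tau qa * wpden tau (z / 2)).
Proof.
rewrite wp_difference // /dev_num; move: (s (z / 2 - qa)) (s (z / 2 + qa)) dev_cst => x y t.
by field.
Qed.

Lemma dev_den_wp z : dev_den z = - s qb ^+ 2 * (wpnum tau (z / 2) - wp tau qb * wpden tau (z / 2)).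
Proof.
rewrite wp_difference // /dev_den.
rewrite (_ : z / 2 - 1 / 4 - tau / 2 = z / 2 - qb); last by field.
rewrite (_ : z / 2 + 1 / 4 + tau / 2 = z / 2 + qb); last by field.
by move: (s (z / 2 - qb)) (s (z / 2 + qb)) => x y; field.
Qed.

Lemma wp_quarter_neq : wp tau qa - wp tau qb != 0.
Proof.
rewrite wp_sub //; apply: mulf_neq0; last first.
  by rewrite invr_eq0 mulf_neq0 // expf_neq0.
rewrite oppr_eq0; apply: mulf_neq0; apply: sigma_neq0 => //.
  by apply: (@quarter_ne 0 (-2)); [field|right].
by apply: (@quarter_ne 2 2); [field|right].
Qed.

(** Up to sign, the determinant of the coefficients of [dev_num] and [dev_den] with respect to
    [wpnum] and [wpden]; the division by 2 is the inner derivative of [z / 2]. *)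
Definition wronskian_cst : C := dev_cst * s qa ^+ 2 * s qb ^+ 2 * (wp tau qa - wp tau qb) / 2.

Lemma wronskian_cst_neq0 : wronskian_cst != 0.
Proof.
have h2 : (2 : C)^-1 != 0 by rewrite invr_eq0 pnatr_eq0.
exact: mulf_neq0 (mulf_neq0 (mulf_neq0 (mulf_neq0 dev_cst_neq0 (expf_neq0 2 sqa)) (expf_neq0 2 sqb)) wp_quarter_neq) h2.
Qed.

Lemma dev_wronskianE z : dev_wronskian z = wronskian_cst * s z.
Proof.
have hN c : has_deriv (fun z => wpnum tau (z / 2) - c * wpden tau (z / 2)) z
    ((derive1 (wpnum tau) (z / 2) - c * derive1 (wpden tau) (z / 2)) / 2).
  have hhalf : has_deriv (fun z : C => z / 2) z (1 / 2).
    by have := has_derivM (has_deriv_id z) (has_deriv_cst (2^-1 : C) z); rewrite mulr0 addr0.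
  have h1 := has_deriv_comp hhalf (entire_deriv _ (entire_wpnum tau_gt0)).
  have h2 := has_deriv_comp hhalf (entire_deriv _ (entire_wpden tau_gt0)).
  have := has_derivB h1 (has_derivZ c h2); move/has_deriv_eq; apply.
  by move: (derive1 _ _) (derive1 _ _) => x y; field.
have h1 : has_deriv dev_num z (dev_cst * s qa ^+ 2 * ((derive1 (wpnum tau) (z / 2) - wp tau qa * derive1 (wpden tau) (z / 2)) / 2)).
  by rewrite (_ : dev_num = fun z => dev_cst * s qa ^+ 2 * (wpnum tau (z / 2) - wp tau qa * wpden tau (z / 2)));
    [apply: has_derivZ|apply/funext => y; exact: dev_num_wp].
have h2 : has_deriv dev_den z (- s qb ^+ 2 * ((derive1 (wpnum tau) (z / 2) - wp tau qb * derive1 (wpden tau) (z / 2)) / 2)).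
  by rewrite (_ : dev_den = fun z => - s qb ^+ 2 * (wpnum tau (z / 2) - wp tau qb * wpden tau (z / 2)));
    [apply: has_derivZ|apply/funext => y; exact: dev_den_wp].
rewrite /dev_wronskian (has_derivE h1) (has_derivE h2) dev_num_wp dev_den_wp.
have := wpnum_wronskian tau_gt0 (z / 2).
have -> : 2 * (z / 2) = z by field.
move=> D; rewrite -[s z]opprK -D /wronskian_cst.
move: (derive1 (wpnum tau) _) (derive1 (wpden tau) _) (wpnum tau _) (wpden tau _) (wp tau qa) (wp tau qb) (s qa) (s qb) dev_cst.
by move=> x1 x2 x3 x4 x5 x6 x7 x8 x9; field.
Qed.

Lemma dev_num_eq0 z : dev_num z = 0 -> lattice tau (z - 1 / 2).
Proof.
move/eqP; rewrite mulf_eq0 oppr_eq0 (negbTE dev_cst_neq0) /= mulf_eq0.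
move=> /orP[]/eqP/(sigma_eq0 tau_gt0) h.
  by rewrite (_ : z - 1 / 2 = (z / 2 - 1 / 4) + (z / 2 - 1 / 4)); [exact: latticeD|field].
rewrite (_ : z - 1 / 2 = (z / 2 + 1 / 4) + (z / 2 + 1 / 4) + - 1); last by field.
by apply: latticeD; [exact: latticeD|apply: latticeN; exact: lattice1].
Qed.

Lemma dev_den_eq0 z : dev_den z = 0 -> lattice tau (z - 1 / 2).
Proof.
move/eqP; rewrite mulf_eq0.
move=> /orP[]/eqP/(sigma_eq0 tau_gt0) h.
  rewrite (_ : z - 1 / 2 = (z / 2 - 1 / 4 - tau / 2) + (z / 2 - 1 / 4 - tau / 2) + tau); last by field.
  by apply: latticeD; [exact: latticeD|exact: lattice_tau].
rewrite (_ : z - 1 / 2 = (z / 2 + 1 / 4 + tau / 2) + (z / 2 + 1 / 4 + tau / 2) + (- 1 + - tau)); last by field.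
by apply: latticeD; [exact: latticeD|apply: latticeD; apply: latticeN; [exact: lattice1|exact: lattice_tau]].
Qed.

(** A common zero would lie in the lattice class of [1 / 2] and, being a zero of the Wronskian, on
    the lattice as well. *)
Lemma dev_coprime z : dev_num z = 0 -> dev_den z != 0.
Proof.
move=> h; apply/eqP => h'.
have zL := dev_num_eq0 h.
have : dev_wronskian z = 0 by rewrite /dev_wronskian h h' mulr0 mul0r subrr.
move/eqP; rewrite dev_wronskianE mulf_eq0 (negbTE wronskian_cst_neq0) /= => /eqP/(sigma_eq0 tau_gt0) zL'.
by apply: half_notin_lattice; rewrite (_ : 1 / 2 = z + - (z - 1 / 2)); [exact: latticeD zL' (latticeN zL)|ring].
Qed.

Lemma dev_num_half : dev_num (1 / 2) = 0.
Proof.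
rewrite /dev_num (_ : 1 / 2 / 2 - 1 / 4 = 0); last by field.
by rewrite sigma0 // mul0r mulr0.
Qed.

Lemma dev_den_half_tau : dev_den (1 / 2 + tau) = 0.
Proof.
rewrite /dev_den (_ : (1 / 2 + tau) / 2 - 1 / 4 - tau / 2 = 0); last by field.
by rewrite sigma0 // mul0r.
Qed.

(* Legendre's relation in disguise: f(z + 1) = f(z) would make f' both even and odd about 1/2. *)
Let dev_ratioE : dev_ratio = -1.
Proof.
have eN := entire_dev_num; have eD := entire_dev_den.
(* Differentiated at [- (1 / 2)], whose translate is [1 / 2]. Both are zeros of the even function
   [dev_num], so only the terms with its derivative remain, with opposite signs. *)
have E : (fun z => dev_num (z + 1) * (dev_ratio * dev_den z)) = (fun z => dev_num z * dev_den (z + 1)).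
  by apply/funext => z; rewrite dev_num_shift1 dev_den_shift1'; ring.
have h1 := has_derivM (has_deriv_shift (entire_deriv (- (1 / 2) + 1) eN)) (has_derivZ dev_ratio (entire_deriv (- (1 / 2)) eD)).
have h2 := has_derivM (entire_deriv (- (1 / 2)) eN) (has_deriv_shift (entire_deriv (- (1 / 2) + 1) eD)).
rewrite E in h1; have := has_deriv_uniq h1 h2.
have -> : - (1 / 2) + 1 = 1 / 2 :> C by field.
rewrite dev_num_even dev_num_half !mul0r !addr0 dev_den_even.
have -> : derive1 dev_num (- (1 / 2)) = - derive1 dev_num (1 / 2).
  have h3 := has_deriv_opp (entire_deriv (- (1 / 2)) eN).
  rewrite (_ : (fun w => dev_num (- w)) = dev_num) in h3; last by apply/funext => y; exact: dev_num_even.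
  by rewrite (has_derivE h3) opprK.
have W0 : derive1 dev_num (1 / 2) * dev_den (1 / 2) != 0.
  have : dev_wronskian (1 / 2) != 0.
    rewrite dev_wronskianE; apply: mulf_neq0 wronskian_cst_neq0 _.
    exact: (sigma_neq0 tau_gt0 half_notin_lattice).
  by rewrite /dev_wronskian dev_num_half mul0r subr0.
by rewrite mulrCA mulNr -mulN1r => /(mulIf W0).
Qed.

Lemma dev_den_shift1 z : dev_den (z + 1) = - (dev_mult1 z * dev_den z).
Proof. by rewrite dev_den_shift1' dev_ratioE; ring. Qed.

Lemma dev_num_or_den_neq0 z : (dev_num z != 0) || (dev_den z != 0).
Proof. by case: (eqVneq (dev_num z) 0) => // /dev_coprime ->. Qed.

Lemma dev_map_type_I : type_I tau dev_map.
Proof.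
split=> z; rewrite /dev_map.
  rewrite P1oppE dev_num_shift1 dev_den_shift1 -mulrN P1frac_scale ?dev_mult1_neq0 //.
  by rewrite -[LHS](@P1frac_scale _ (-1)) ?oppr_eq0 ?oner_neq0 // !mulN1r opprK.
rewrite P1invE ?dev_num_or_den_neq0 // dev_num_shift_tau dev_den_shift_tau.
by rewrite P1frac_scale ?dev_mult_tau_neq0.
Qed.

Lemma dev_map_even z : dev_map (- z) = dev_map z.
Proof. by rewrite /dev_map dev_num_even dev_den_even. Qed.

(** Translation of [- (tau / 2)] by [tau] together with evenness; [dev_cst] is the constant for
    which the multiplier at that point equals 1. *)
Lemma dev_map_half_tau : dev_map (tau / 2) = Some 1.
Proof.
have E : dev_num (tau / 2) = dev_den (tau / 2).
  have := dev_num_shift_tau (- (tau / 2)); rewrite (_ : - (tau / 2) + tau = tau / 2); last by field.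
  move=> ->; rewrite dev_den_even /dev_mult_tau /dev_cst -cexpD.
  by rewrite (_ : _ + _ = 0) ?cexp0 ?mul1r //; field.
have d0 : dev_den (tau / 2) != 0.
  by apply/eqP => h; move/eqP: (dev_coprime (etrans E h)); rewrite h.
by rewrite /dev_map P1frac_some // E divff.
Qed.

End DevelopingMap.

(** * Properties (i) to (viii) and the closed forms *)

Lemma near_punctured (R : realType) (a : cplx R) (P : cplx R -> Prop) :
  (\forall w \near a, P w) -> \forall w \near a^', P w.
Proof. by move/nearC => [d d0 Hd]; apply/dnearC; exists d => // w _; exact: Hd. Qed.

(** Computes the second derivative of [f] at 0, where the first derivative [W / D ^+ 2] vanishes
    because [W] does. *)
Lemma has_deriv_div_sqr (K : numFieldType) (W D : K -> K) a w d : D a != 0 ->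
  has_deriv W a w -> has_deriv D a d -> W a = 0 ->
  has_deriv (fun z => W z / D z ^+ 2) a (w / D a ^+ 2).
Proof.
move=> Da hW hD Wa.
have D2 : D a * D a != 0 by rewrite mulf_neq0.
have h := has_derivM hW (@has_derivV _ (fun y => D y * D y) a _ D2 (has_derivM hD hD)).
rewrite (_ : (fun z => W z / D z ^+ 2) = fun z => W z * (D z * D z)^-1); last first.
  by apply/funext => z; rewrite expr2.
by rewrite Wa mul0r addr0 in h; rewrite expr2.
Qed.

Lemma P1frac_pole (R : realType) (x al be p q c : cplx R) : x != 0 -> q != 0 ->
  P1frac (c * p ^+ 2 * (x - al * 0)) (- q ^+ 2 * (x - be * 0)) = P1scale (- c * (p ^+ 2 / q ^+ 2)) (Some 1).
Proof.
move=> x0 q0; rewrite !mulr0 !subr0 P1frac_some /=; first by congr Some; field; rewrite x0 q0.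
by apply: mulf_neq0 => //; rewrite oppr_eq0 expf_neq0.
Qed.

Lemma P1frac_rescale (R : realType) (t x y p q c : cplx R) : t != 0 -> q != 0 ->
  P1frac (c * p ^+ 2 * (t * x)) (- q ^+ 2 * (t * y)) = P1scale (- c * (p ^+ 2 / q ^+ 2)) (P1frac x y).
Proof.
move=> t0 q0.
have -> : c * p ^+ 2 * (t * x) = t * (c * p ^+ 2 * x) by ring.
have -> : - q ^+ 2 * (t * y) = t * (- q ^+ 2 * y) by ring.
rewrite P1frac_scale // /P1frac mulf_eq0 oppr_eq0 expf_eq0 /= (negbTE q0) /=; case: eqP => //= /eqP y0.
by congr Some; field; rewrite y0 q0.
Qed.

Lemma normalizing_constant (K : fieldType) (c x y : K) : y != 0 -> c * (x / y) = 1 -> c = y / x.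
Proof.
move=> y0 E; have x0 : x != 0 by apply/eqP => x0; move: E; rewrite x0 mul0r mulr0 => /eqP; rewrite eq_sym oner_eq0.
apply: (mulIf x0); rewrite divfK //.
by apply: (mulIf (invr_neq0 y0)); rewrite divff // -mulrA E.
Qed.

Section DevelopingMapProperties.
Context {R : realType}.
Local Notation C := (cplx R).
Local Notation Re := complex.Re.
Local Notation Im := complex.Im.
Implicit Types (z w a : C).
Variable tau : C.
Hypothesis tau_gt0 : 0 < Im tau.
Local Notation N := (dev_num tau).
Local Notation D := (dev_den tau).
Local Notation W := (dev_wronskian tau).
Local Notation f := (dev_map tau).

Let eN : entire N := entire_dev_num tau_gt0.
Let eD : entire D := entire_dev_den tau_gt0.

Lemma near_dev_den a : D a != 0 -> \forall w \near a, D w != 0.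
Proof. by apply: near_neq0; exact: entire_cont. Qed.

Lemma near_dev_num a : N a != 0 -> \forall w \near a, N w != 0.
Proof. by apply: near_neq0; exact: entire_cont. Qed.

Lemma has_deriv_div_dev a : D a != 0 -> has_deriv (fun w => N w / D w) a (W a / D a ^+ 2).
Proof.
move=> Da; apply: has_deriv_eq (has_derivM (entire_deriv a eN) (has_derivV Da (entire_deriv a eD))) _.
rewrite /dev_wronskian; move: (derive1 N a) (derive1 D a) (N a) (D a) Da => x y t v v0.
by field.
Qed.

Lemma has_deriv_inv_dev a : N a != 0 -> has_deriv (fun w => D w / N w) a (- W a / N a ^+ 2).
Proof.
move=> Na; apply: has_deriv_eq (has_derivM (entire_deriv a eD) (has_derivV Na (entire_deriv a eN))) _.
rewrite /dev_wronskian; move: (derive1 N a) (derive1 D a) (D a) (N a) Na => x y t v v0.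
by field.
Qed.

Lemma dev_map_some a : D a != 0 -> f a = Some (N a / D a).
Proof. exact: P1frac_some. Qed.

Lemma dev_map_inv a : N a != 0 -> P1inv (f a) = Some (D a / N a).
Proof. by move=> Na; rewrite P1invE ?Na // P1frac_some. Qed.

Lemma has_deriv_chart0 a : D a != 0 -> has_deriv (chart0 f) a (W a / D a ^+ 2).
Proof.
move=> Da; apply: has_deriv_near (has_deriv_div_dev Da).
by apply: filterS (near_dev_den Da) => w Dw; rewrite /chart0 dev_map_some.
Qed.

Lemma has_deriv_chartoo a : N a != 0 -> has_deriv (chartoo f) a (- W a / N a ^+ 2).
Proof.
move=> Na; apply: has_deriv_near (has_deriv_inv_dev Na).
by apply: filterS (near_dev_num Na) => w Nw; rewrite /chartoo /chart0 dev_map_inv.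
Qed.

Lemma dev_map_holomorphic0 a : D a != 0 -> holomorphic0 f a.
Proof.
move=> Da; apply: filterS (near_dev_den Da) => w Dw; split; first by rewrite dev_map_some.
exact: has_deriv_derivable (has_deriv_chart0 Dw).
Qed.

Lemma dev_map_holomorphicoo a : N a != 0 -> holomorphicoo f a.
Proof.
move=> Na; apply: filterS (near_dev_num Na) => w Nw; split.
  rewrite /dev_map /P1frac; case: eqP => // /eqP Dw [] /eqP.
  by rewrite mulf_eq0 invr_eq0 (negbTE Nw) (negbTE Dw).
exact: has_deriv_derivable (has_deriv_chartoo Nw).
Qed.

Lemma dev_map_meromorphic : meromorphic f.
Proof.
split=> [a|].
  by case/orP: (dev_num_or_den_neq0 tau_gt0 a) => h; [right; exact: dev_map_holomorphicoo|left; exact: dev_map_holomorphic0].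
by exists (tau / 2); rewrite dev_map_half_tau.
Qed.

Lemma dev_wronskian_neq0 z : ~ lattice tau z -> W z != 0.
Proof.
move=> zL; rewrite dev_wronskianE //; apply: mulf_neq0; first exact: wronskian_cst_neq0.
exact: sigma_neq0.
Qed.

Lemma dev_map_etale z : ~ lattice tau z -> etale_at f z.
Proof.
move=> zL; have Wz := dev_wronskian_neq0 zL.
case: (eqVneq (D z) 0) => [Dz|Dz].
  have Nz : N z != 0 by apply/eqP => /(dev_coprime tau_gt0); rewrite Dz eqxx.
  right; split; first exact: dev_map_holomorphicoo.
  rewrite (has_derivE (has_deriv_chartoo Nz)); apply/eqP.
  by rewrite mulf_neq0 ?oppr_eq0 // invr_eq0 expf_neq0.
left; split; first exact: dev_map_holomorphic0.
rewrite (has_derivE (has_deriv_chart0 Dz)); apply/eqP.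
by rewrite mulf_neq0 // invr_eq0 expf_neq0.
Qed.

(** The expression is symmetric and homogeneous in numerator and denominator, hence the same in both
    charts. *)
Lemma dev_density z : spherical_density f z =
  8 * cabs (W z) ^+ 2 / (cabs (N z) ^+ 2 + cabs (D z) ^+ 2) ^+ 2.
Proof.
case: (eqVneq (D z) 0) => [Dz|Dz].
  have Nz : N z != 0 by apply/eqP => /(dev_coprime tau_gt0); rewrite Dz eqxx.
  have fz : f z = None by rewrite /dev_map /P1frac Dz eqxx.
  rewrite /spherical_density fz (has_derivE (has_deriv_chartoo Nz)).
  rewrite /chartoo /chart0 dev_map_inv //= Dz mul0r cabs0 cabs_div cabsN cabsX.
  have : cabs (N z) != 0 by rewrite cabs_eq0.
  by move: (cabs (N z)) (cabs (W z)) => x y x0; field.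
rewrite /spherical_density dev_map_some // (has_derivE (has_deriv_chart0 Dz)).
rewrite /chart0 dev_map_some //= !cabs_div cabsX.
have : cabs (D z) != 0 by rewrite cabs_eq0.
have := cabs_ge0 (N z); have := cabs_ge0 (D z).
move: (cabs (N z)) (cabs (D z)) (cabs (W z)) => x y t y0 x0 yn.
have p1 : 0 < y ^+ 2 by rewrite exprn_gt0 // lt_neqAle eq_sym yn.
have p2 : x ^+ 2 + y ^+ 2 != 0 by rewrite gt_eqF // ltr_wpDl // exprn_ge0.
have p3 : 1 + (x / y) ^+ 2 != 0 by rewrite gt_eqF // ltr_pwDl // exprn_ge0 // divr_ge0.
have -> : 1 + (x / y) ^+ 2 = (x ^+ 2 + y ^+ 2) / y ^+ 2 by field.
by field; rewrite p2 yn.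
Qed.

Lemma dev_density_gt0 z : ~ lattice tau z -> 0 < spherical_density f z.
Proof.
move=> zL; rewrite dev_density divr_gt0 //.
  by rewrite mulr_gt0 // exprn_gt0 // cabs_gt0 dev_wronskian_neq0.
rewrite exprn_gt0 //; case/orP: (dev_num_or_den_neq0 tau_gt0 z) => h.
  by rewrite ltr_pwDl ?exprn_ge0 ?cabs_ge0 // exprn_gt0 // cabs_gt0.
by rewrite ltr_wpDl ?exprn_ge0 ?cabs_ge0 // exprn_gt0 // cabs_gt0.
Qed.

Lemma dev_num_neq0 a : ~ lattice tau (a - 1 / 2) -> N a != 0.
Proof. by move=> aL; apply/eqP => /(dev_num_eq0 tau_gt0). Qed.

Lemma dev_den_neq0 a : ~ lattice tau (a - 1 / 2) -> D a != 0.
Proof. by move=> aL; apply/eqP => /(dev_den_eq0 tau_gt0). Qed.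

Lemma dev_map_order0 : order_zero_off_half tau f.
Proof.
move=> a aL; have Na := dev_num_neq0 aL; have Da := dev_den_neq0 aL.
exists (fun w => N w / D w); split.
- apply: filterS (near_dev_den Da) => w Dw; exact: has_deriv_derivable (has_deriv_div_dev Dw).
- by apply/eqP; rewrite mulf_neq0 // invr_eq0.
- apply: near_punctured; apply: filterS (near_dev_den Da) => w Dw.
  by rewrite expr0z mul1r dev_map_some.
Qed.

Lemma half_half_lattice : lattice tau (1 / 2 - 1 / 2).
Proof. by rewrite subrr; exact: lattice0. Qed.

Lemma half_lattice_not_lattice a : lattice tau (a - 1 / 2) -> ~ lattice tau a.
Proof.
move=> h h'; apply: (half_notin_lattice tau_gt0).
by rewrite (_ : 1 / 2 = a + - (a - 1 / 2)); [exact: latticeD h' (latticeN h)|ring].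
Qed.

Lemma dev_map_order1 : has_order f (1 / 2) 1.
Proof.
have Na := dev_num_half tau_gt0.
have Da : D (1 / 2) != 0 := dev_coprime tau_gt0 Na.
have [N1 [eN1 N1a N1E]] := entire_slope (1 / 2) eN.
have N1a0 : N1 (1 / 2) != 0.
  have := dev_wronskian_neq0 (half_lattice_not_lattice half_half_lattice).
  by rewrite /dev_wronskian Na mul0r subr0 mulf_eq0 negb_or N1a => /andP[].
exists (fun w => N1 w / D w); split.
- apply: filterS (near_dev_den Da) => w Dw; apply: has_deriv_derivable.
  exact: has_derivM (entire_deriv w eN1) (has_derivV Dw (entire_deriv w eD)).
- by apply/eqP; rewrite mulf_neq0 // invr_eq0.
- apply: near_punctured; apply: filterS (near_dev_den Da) => w Dw.
  by rewrite expr1z dev_map_some // N1E Na add0r mulrA.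
Qed.

Lemma dev_map_orderN1 : has_order f (1 / 2 + tau) (-1).
Proof.
set a := 1 / 2 + tau.
have Da : D a = 0 := dev_den_half_tau tau_gt0.
have Na : N a != 0 by apply/eqP => /(dev_coprime tau_gt0); rewrite Da eqxx.
have [D1 [eD1 D1a D1E]] := entire_slope a eD.
have aL : ~ lattice tau a.
  apply: half_lattice_not_lattice; rewrite (_ : a - 1 / 2 = tau); [exact: lattice_tau|by rewrite /a; ring].
have D1a0 : D1 a != 0.
  have := dev_wronskian_neq0 aL.
  by rewrite /dev_wronskian Da mulr0 sub0r oppr_eq0 mulf_eq0 negb_or D1a => /andP[].
have nD1 : \forall w \near a, D1 w != 0 by apply: near_neq0 => //; exact: entire_cont.
exists (fun w => N w / D1 w); split.
- apply: filterS nD1 => w Dw; apply: has_deriv_derivable.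
  exact: has_derivM (entire_deriv w eN) (has_derivV Dw (entire_deriv w eD1)).
- by apply/eqP; rewrite mulf_neq0 // invr_eq0.
- move/nearC: nD1 => [d d0 Hd]; apply/dnearC; exists d => // w wa /Hd Dw.
  have wa0 : w - a != 0 by rewrite subr_eq0.
  have Dwn : D w != 0 by rewrite D1E Da add0r mulf_neq0.
  rewrite dev_map_some // D1E Da add0r; congr Some.
  by rewrite exprN1; move: (N w) (D1 w) Dw => x y y0; field; rewrite y0 wa0.
Qed.

Lemma dev_den0_neq0 : D 0 != 0.
Proof.
apply: dev_den_neq0 => h; apply: (half_notin_lattice tau_gt0).
by rewrite (_ : 1 / 2 = - (0 - 1 / 2)); [exact: latticeN|ring].
Qed.

Lemma dev_map_deriv0 : derive1 (chart0 f) 0 = 0 /\ derive1 (derive1 (chart0 f)) 0 <> 0.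
Proof.
have D0 := dev_den0_neq0.
have W0 : W 0 = 0 by rewrite dev_wronskianE // sigma0 // mulr0.
split; first by rewrite (has_derivE (has_deriv_chart0 D0)) W0 mul0r.
have WE : W = fun z => wronskian_cst tau * wsigma tau z.
  by apply/funext => z; exact: dev_wronskianE.
have hW : has_deriv W 0 (wronskian_cst tau * 1).
  rewrite WE; apply: has_derivZ; rewrite -(dsigma0 tau_gt0); apply: entire_deriv; exact: entire_sigma.
have h : has_deriv (derive1 (chart0 f)) 0 ((wronskian_cst tau * 1) / D 0 ^+ 2).
  apply: has_deriv_near (has_deriv_div_sqr D0 hW (entire_deriv 0 eD) W0).
  by apply: filterS (near_dev_den D0) => w Dw; rewrite (has_derivE (has_deriv_chart0 Dw)).
rewrite (has_derivE h) mulr1; apply/eqP; apply: mulf_neq0; first exact: wronskian_cst_neq0.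
by rewrite invr_eq0 expf_neq0.
Qed.

Lemma dev_map_typeI_properties : typeI_properties tau f.
Proof.
split; first exact: dev_map_order0.
split; first exact: dev_map_deriv0.
split; first exact: dev_map_etale.
split; first exact: dev_map_type_I.
split; first exact: dev_map_even.
split; first exact: dev_map_half_tau.
split; [exact: dev_map_order1|exact: dev_map_orderN1].
Qed.

Lemma dev_map_sigma z : f z =
  P1frac (- cexp (1 / 4 * quasi_period tau tau * (1 + tau)) *
          (wsigma tau (z / 2 - 1 / 4) * wsigma tau (z / 2 + 1 / 4)))
         (wsigma tau (z / 2 - 1 / 4 - tau / 2) * wsigma tau (z / 2 + 1 / 4 + tau / 2)).
Proof. by []. Qed.

Let qaL : ~ lattice tau (1 / 4).
Proof.
move=> h; apply: (half_notin_lattice tau_gt0).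
by rewrite (_ : 1 / 2 = 1 / 4 + 1 / 4); [exact: latticeD|field].
Qed.

Let qbL : ~ lattice tau (1 / 4 + tau / 2).
Proof.
move=> h; apply: (half_notin_lattice tau_gt0).
rewrite (_ : 1 / 2 = (1 / 4 + tau / 2) + (1 / 4 + tau / 2) + - tau); last by field.
by apply: latticeD; [exact: latticeD|apply: latticeN; exact: lattice_tau].
Qed.

Lemma dev_map_wp z : f z =
  P1scale (- cexp (1 / 4 * quasi_period tau tau * (1 + tau)) *
           (wsigma tau (1 / 4) ^+ 2 / wsigma tau (1 / 4 + tau / 2) ^+ 2))
          (wp_ratio tau (1 / 4) (1 / 4 + tau / 2) (z / 2)).
Proof.
have sa : wsigma tau (1 / 4) != 0 := sigma_neq0 tau_gt0 qaL.
have sb : wsigma tau (1 / 4 + tau / 2) != 0 := sigma_neq0 tau_gt0 qbL.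
rewrite /wp_ratio -/(dev_cst tau) /dev_map.
case: asboolP => zL.
  (* At a pole of [wp] only the terms in [wpnum] survive, which matches the value 1 assigned by
     [wp_ratio]. *)
  have T0 : wpden tau (z / 2) = 0.
    by rewrite /wpden (_ : wsigma tau (z / 2) = 0) ?expr0n //; apply/(sigma_eq0 tau_gt0).
  have S0 : wpnum tau (z / 2) != 0.
    have s0 : wsigma tau (z / 2) = 0 by apply/(sigma_eq0 tau_gt0).
    by rewrite /wpnum s0 mul0r subr0 expf_neq0 // dsigma_lattice.
  by rewrite (dev_num_wp tau_gt0) (dev_den_wp tau_gt0) T0; exact: P1frac_pole.
have sz : wsigma tau (z / 2) != 0 := sigma_neq0 tau_gt0 zL.
have T0 : wpden tau (z / 2) != 0 by rewrite expf_neq0.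
have E c : wpnum tau (z / 2) - c * wpden tau (z / 2) = wpden tau (z / 2) * (wp tau (z / 2) - c).
  by rewrite [in RHS]wpE //; move: (wpnum tau (z / 2)) (wpden tau (z / 2)) T0 => x y y0; field.
have EN : N z = dev_cst tau * wsigma tau (1 / 4) ^+ 2 * (wpden tau (z / 2) * (wp tau (z / 2) - wp tau (1 / 4))).
  rewrite (dev_num_wp tau_gt0).
  exact: (congr1 (fun t => dev_cst tau * wsigma tau (1 / 4) ^+ 2 * t) (E (wp tau (1 / 4)))).
have ED : D z = - wsigma tau (1 / 4 + tau / 2) ^+ 2 *
    (wpden tau (z / 2) * (wp tau (z / 2) - wp tau (1 / 4 + tau / 2))).
  rewrite (dev_den_wp tau_gt0).
  exact: (congr1 (fun t => - wsigma tau (1 / 4 + tau / 2) ^+ 2 * t) (E (wp tau (1 / 4 + tau / 2)))).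
by rewrite EN ED; exact: P1frac_rescale.
Qed.

(** The value 1 at [tau / 2] determines the constant in [dev_map_wp], so no identity between the
    exponential and the sigma values has to be proved. *)
Lemma dev_map_wp_normalized z : f z =
  P1scale ((wp tau (tau / 4) - wp tau (1 / 4 + tau / 2)) / (wp tau (tau / 4) - wp tau (1 / 4)))
          (wp_ratio tau (1 / 4) (1 / 4 + tau / 2) (z / 2)).
Proof.
rewrite dev_map_wp; congr (P1scale _ _).
have := dev_map_half_tau tau_gt0; rewrite dev_map_wp /wp_ratio.
have -> : tau / 2 / 2 = tau / 4 by field.
have tL : ~ lattice tau (tau / 4).
  move=> h; apply: (@half_not_lattice _ _ tau_gt0 tau); first by right.
  by rewrite (_ : tau / 2 = tau / 4 + tau / 4); [exact: latticeD|field].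
case: asboolP => // _; rewrite /P1frac; case: eqP => //= /eqP b0 [] E.
exact: normalizing_constant b0 E.
Qed.

End DevelopingMapProperties.

(** * Uniqueness of the type I map with prescribed orders *)

Section Uniqueness.
Context {R : realType}.
Local Notation C := (cplx R).
Local Notation Re := complex.Re.
Local Notation Im := complex.Im.
Implicit Types (z w a c : C) (F G : C -> C) (f h : C -> P1 R) (k : int).

Lemma punctured_eq F G a : {for a, continuous F} -> {for a, continuous G} ->
  (\forall z \near a^', F z = G z) -> F a = G a.
Proof.
move=> /contC cF /contC cG /dnearC [d d0 Hd].
apply/eqP; rewrite -subr_eq0; apply/eqP; apply: cabs_small0 => e e0.
have e20 : 0 < e / 2 by rewrite divr_gt0.
have [d1 d10 H1] := cF _ e20; have [d2 d20 H2] := cG _ e20.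
pose t : R := Num.min d (Num.min d1 d2) / 2.
have m0 : 0 < Num.min d (Num.min d1 d2) by rewrite !lt_min d0 d10.
have t0 : 0 < t by rewrite divr_gt0.
have tm : t < Num.min d (Num.min d1 d2) by rewrite ltr_pdivrMr // ltr_pMr // ltr1n.
move: tm; rewrite !lt_min => /andP[td /andP[td1 td2]].
pose w := a + mkC t 0.
have wa : cabs (w - a) = t by rewrite /w addrAC subrr add0r cabs_real gtr0_norm.
have wa0 : w != a by rewrite -subr_eq0 -cabs_eq0 wa gt_eqF.
have b1 := H1 w; have b2 := H2 w; have E := Hd w wa0.
rewrite wa in b1 b2 E; rewrite -E // in b2.
have {}b1 := b1 td1; have {}b2 := b2 td2.
apply: le_trans (cabs_distD (F w) _ _) _; rewrite cabsC.
by rewrite [e]splitr; apply: lerD; exact: ltW.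
Qed.

Lemma near_shift a c (P : C -> Prop) : (\forall z \near a + c, P z) -> \forall z \near a, P (z + c).
Proof.
move=> /nearC [d d0 Hd]; apply/nearC; exists d => // z za; apply: Hd.
by rewrite opprD addrACA subrr addr0.
Qed.

Lemma dnear_shift a c (P : C -> Prop) : (\forall z \near (a + c)^', P z) -> \forall z \near a^', P (z + c).
Proof.
move=> /dnearC [d d0 Hd]; apply/dnearC; exists d => // z za zd; apply: Hd.
  by rewrite (inj_eq (addIr c)).
by rewrite opprD addrACA subrr addr0.
Qed.

Lemma P1invK : involutive (@P1inv R).
Proof.
case=> [w|] /=; last by rewrite /P1frac eqxx.
rewrite /P1frac; case: (eqVneq w 0) => [-> //|w0] /=.
by rewrite /P1frac mulf_eq0 oner_eq0 invr_eq0 (negbTE w0) /=; congr Some; field.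
Qed.

Lemma P1oppK : involutive (@P1opp R).
Proof. by case=> [w|] //=; rewrite opprK. Qed.

Lemma has_order_shift f a c k : has_order f (a + c) k -> has_order (fun z => f (z + c)) a k.
Proof.
move=> [g [dg ga fg]]; exists (fun z => g (z + c)); split.
- apply: filterS (near_shift dg) => z /derivable_has_deriv dz.
  exact: has_deriv_derivable (has_deriv_shift dz).
- exact: ga.
- apply: filterS (dnear_shift fg) => z ->.
  by rewrite opprD addrACA subrr addr0.
Qed.

Lemma has_order_opp f a k : has_order f a k -> has_order (fun z => P1opp (f z)) a k.
Proof.
move=> [g [dg ga fg]]; exists (fun z => - g z); split.
- apply: filterS dg => z /derivable_has_deriv dz; exact: has_deriv_derivable (has_derivN dz).
- by move/eqP; rewrite oppr_eq0 => /eqP.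
- by apply: filterS fg => z -> /=; rewrite mulrN.
Qed.

Lemma near_derivable_cont (g : C -> C) a : (\forall z \near a, derivable g z 1) -> {for a, continuous g}.
Proof. by move=> /nbhs_singleton /derivable_has_deriv /has_deriv_cont. Qed.

Lemma near_derivable_neq0 (g : C -> C) a : (\forall z \near a, derivable g z 1) -> g a <> 0 -> \forall z \near a, g z != 0.
Proof. by move=> /near_derivable_cont cg /eqP; exact: near_neq0. Qed.

Lemma near_neq a : \forall z \near a^', z != a.
Proof. by apply/dnearC; exists 1. Qed.

Lemma has_order_inv f a k : has_order f a k -> has_order (fun z => P1inv (f z)) a (- k).
Proof.
move=> [g [dg ga fg]]; have gn := near_derivable_neq0 dg ga.
exists (fun z => (g z)^-1); split.
- apply: filterS2 dg gn => z /derivable_has_deriv dz gz.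
  exact: has_deriv_derivable (has_derivV gz dz).
- by move/eqP; rewrite invr_eq0 => /eqP.
- apply: filterS3 fg (near_punctured gn) (near_neq a) => z -> gz za /=.
  have e0 : (z - a) ^ k != 0 by rewrite expfz_neq0 // subr_eq0.
  rewrite P1frac_some ?mulf_neq0 // div1r invfM; congr Some.
  by rewrite invr_expz.
Qed.

Definition regular_typeI (tau : C) h :=
  [/\ meromorphic h, order_zero_off_half tau h, type_I tau h, h (tau / 2) = Some 1 & has_order h (1 / 2) 1].

Section Fixed.
Variable tau : C.
Hypothesis tau_gt0 : 0 < Im tau.

(** One order for all competitors at once, so that the quotient of any two of them has order 0 at
    [a]. *)
Let common_order a := exists k, forall h, regular_typeI tau h -> has_order h a k.

(** Serves both translations: [P1opp] preserves orders and [P1inv] negates them. As involutions they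
    also transport the order backwards. *)
Let common_order_shift c (sigma : P1 R -> P1 R) (e : int -> int) :
  (forall h, regular_typeI tau h -> forall z, h (z + c) = sigma (h z)) ->
  involutive sigma ->
  (forall f a k, has_order f a k -> has_order (fun z => sigma (f z)) a (e k)) ->
  forall a, common_order a -> common_order (a + c) /\ common_order (a - c).
Proof.
move=> hs sK ho a [k hk]; split; exists (e k) => h hh.
- have H := ho _ _ _ (hk h hh).
  rewrite -(addrK c a) in H; have := has_order_shift H.
  by under eq_fun do rewrite -hs // subrK.
- have := hk h hh; rewrite -{1}(subrK c a) => H; have := ho _ _ _ (has_order_shift H).
  by under eq_fun do rewrite hs // sK.
Qed.

Let common_order_half_lattice a : lattice tau (a - 1 / 2) -> common_order a.
Proof.
move=> [m [n E]].
have s1 : forall b, common_order b -> common_order (b + 1) /\ common_order (b - 1).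
  apply: (@common_order_shift 1 (@P1opp R) id) => //; first by move=> h [_ _ [H _] _ _].
    exact: P1oppK.
  exact: has_order_opp.
have s2 : forall b, common_order b -> common_order (b + tau) /\ common_order (b - tau).
  apply: (@common_order_shift tau (@P1inv R) -%R) => //; first by move=> h [_ _ [_ H] _ _].
    exact: P1invK.
  exact: has_order_inv.
have zs c b (l : int) : (forall b, common_order b -> common_order (b + c) /\ common_order (b - c)) ->
    common_order b -> common_order (b + l%:~R * c).
  move=> hc hb; elim/int_rec: l => [|l IH|l IH]; first by rewrite mul0r addr0.
    by rewrite -addn1 PoszD intrD mulrDl mul1r addrA; exact: (proj1 (hc _ IH)).
  by rewrite -addn1 PoszD opprD intrD mulrDl mulN1r addrA; exact: (proj2 (hc _ IH)).
have -> : a = 1 / 2 + m%:~R * 1 + n%:~R * tau by rewrite -[LHS](subrK (1 / 2)) E; ring.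
have h0 : common_order (1 / 2) by exists 1 => h [].
exact: (zs _ _ n s2 (zs _ _ m s1 h0)).
Qed.

Let common_orderP a : common_order a.
Proof.
have [|h] := pselect (lattice tau (a - 1 / 2)); first exact: common_order_half_lattice.
by exists 0 => f [_ H _ _ _]; exact: H.
Qed.

(** [has_order] speaks of punctured neighbourhoods only; the value at the centre comes from
    continuity in the chart at hand. *)
Lemma meromorphic_value f a (g : C -> C) : holomorphic0 f a \/ holomorphicoo f a ->
  {for a, continuous g} -> g a != 0 -> (\forall z \near a^', f z = Some (g z)) -> f a = Some (g a).
Proof.
move=> hf cg ga fg; have gn := near_punctured (near_neq0 cg ga).
case: hf => hf.
- have cf : {for a, continuous (chart0 f)}.
    by apply: near_derivable_cont; apply: filterS hf => z [].
  have E : chart0 f a = g a.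
    by apply: (@punctured_eq (chart0 f) g a cf cg); apply: filterS fg => z; rewrite /chart0 => ->.
  have [fa _] := nbhs_singleton hf.
  by move: E fa; rewrite /chart0; case: (f a) => //= w ->.
- have cf : {for a, continuous (chartoo f)}.
    by apply: near_derivable_cont; apply: filterS hf => z [].
  have cgi : {for a, continuous (fun z => (g z)^-1)} := @continuousV C C g a ga cg.
  have E : chartoo f a = (g a)^-1.
    apply: (@punctured_eq (chartoo f) (fun z => (g z)^-1) a cf cgi).
    apply: filterS2 fg gn => z; rewrite /chartoo /chart0 => -> gz /=.
    by rewrite P1frac_some //= div1r.
  have [fa _] := nbhs_singleton hf.
  move: E fa; rewrite /chartoo /chart0; case: (f a) => [w|] /=.
    rewrite /P1frac; case: (eqVneq w 0) => [-> _ //|w0] /=; rewrite div1r => /invr_inj -> //.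
  by move/eqP; rewrite eq_sym invr_eq0 (negbTE ga).
Qed.

(** In equal charts this is continuity. In opposite charts the product of the two coordinates is 1
    near [a], hence at [a], so neither coordinate vanishes there. *)
Lemma meromorphic_eq_at f h a : holomorphic0 f a \/ holomorphicoo f a ->
  holomorphic0 h a \/ holomorphicoo h a -> (\forall z \near a^', f z = h z) -> f a = h a.
Proof.
have c0 p : holomorphic0 p a -> {for a, continuous (chart0 p)} /\ p a = Some (chart0 p a).
  move=> hp; split; first by apply: near_derivable_cont; apply: filterS hp => z [].
  by have [] := nbhs_singleton hp; rewrite /chart0; case: (p a).
have coo p : holomorphicoo p a -> {for a, continuous (chartoo p)} /\ P1inv (p a) = Some (chartoo p a).
  move=> hp; split; first by apply: near_derivable_cont; apply: filterS hp => z [].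
  have [H _] := nbhs_singleton hp; move: H; rewrite /chartoo /chart0; case: (p a) => //= w.
  by rewrite /P1frac; case: (eqVneq w 0) => // ->.
have mixed p q : holomorphic0 p a -> holomorphicoo q a -> (\forall z \near a^', p z = q z) -> p a = q a.
  move=> hp hq pq; have [cp pa] := c0 _ hp; have [cq qa] := coo _ hq.
  have E : chart0 p a * chartoo q a = 1.
    apply: (@punctured_eq (fun z => chart0 p z * chartoo q z) (fun _ => 1)).
    - exact: (contM cp cq).
    - exact: cont_cst.
    - apply: filterS3 pq (near_punctured hp) (near_punctured hq) => z pz [hpz _] [hqz _].
      rewrite /chartoo /chart0 -pz; move: hpz hqz; rewrite -pz; case: (p z) => //= w _ w0.
      have {}w0 : w != 0 by apply/eqP => w0'; apply: w0; rewrite w0'.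
      by rewrite P1frac_some //= mulrCA divff // mulr1.
  have x0 : chartoo q a != 0 by apply/eqP => x0; move: E; rewrite x0 mulr0 => /eqP; rewrite eq_sym oner_eq0.
  rewrite pa -[q a]P1invK qa /= P1frac_some //; congr Some.
  by apply: (mulIf x0); rewrite E divfK.
move=> [] hf [] hh E.
- have [cf ->] := c0 _ hf; have [ch ->] := c0 _ hh; congr Some.
  by apply: (@punctured_eq (chart0 f) (chart0 h) a cf ch); apply: filterS E => z; rewrite /chart0 => ->.
- exact: mixed.
- by apply/esym/mixed => //; apply: filterS E.
- apply: (inv_inj P1invK); have [cf ->] := coo _ hf; have [ch ->] := coo _ hh; congr Some.
  by apply: (@punctured_eq (chartoo f) (chartoo h) a cf ch); apply: filterS E => z; rewrite /chartoo /chart0 => ->.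
Qed.

Lemma regular_typeI_unique h1 h2 : regular_typeI tau h1 -> regular_typeI tau h2 -> forall z, h1 z = h2 z.
Proof.
move=> H1 H2.
(* At zeros and poles [q] takes junk values, so it is compared with its holomorphic representatives
   on punctured neighbourhoods only. *)
pose q z : C := odflt 0 (h1 z) / odflt 0 (h2 z).
have loc a : exists G, [/\ \forall z \near a, derivable G z 1, G a != 0 & \forall z \near a^', q z = G z].
  have [k hk] := common_orderP a.
  have [g1 [dg1 g1a fg1]] := hk _ H1; have [g2 [dg2 g2a fg2]] := hk _ H2.
  have n2 := near_derivable_neq0 dg2 g2a.
  exists (fun z => g1 z / g2 z); split.
  - apply: filterS3 dg1 dg2 n2 => z /derivable_has_deriv d1 /derivable_has_deriv d2 gz.
    exact: has_deriv_derivable (has_derivM d1 (has_derivV gz d2)).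
  - by apply: mulf_neq0; [exact/eqP|rewrite invr_eq0; exact/eqP].
  - have n2' := near_punctured n2.
    have both : \forall z \near a^', h1 z = Some ((z - a) ^ k * g1 z) /\ h2 z = Some ((z - a) ^ k * g2 z).
      by apply: filterS2 fg1 fg2 => z.
    apply: filterS3 both n2' (near_neq a) => z [E1 E2] gz za.
    rewrite /q E1 E2 /=.
    have e0 : (z - a) ^ k != 0 by rewrite expfz_neq0 // subr_eq0.
    by move: ((z - a) ^ k) e0 => e e0; field; rewrite e0 gz.
have /choice [G hG] := loc.
(* The representative around [a], evaluated at [a]: this removes the singularities of [q]. *)
pose K a := G a a.
have Kloc a : \forall z \near a, K z = G a z.
  have [dG _ qG] := hG a.
  have /dnearC [d d0 Hd] := qG; have /nearC [d' d'0 Hd'] := dG.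
  apply/nearC; exists (Num.min d d'); first by rewrite lt_min d0.
  move=> z; rewrite lt_min => /andP[zd zd'].
  have [->|za] := eqVneq z a; first by [].
  have [dGz _ qGz] := hG z.
  apply: (@punctured_eq (G z) (G a) z).
  - exact: near_derivable_cont.
  - exact: has_deriv_cont (derivable_has_deriv (Hd' _ zd')).
  - have near_d : \forall w \near z^', w != a /\ cabs (w - a) < d.
      apply/dnearC; exists (Num.min (cabs (z - a)) (d - cabs (z - a))).
        by rewrite lt_min cabs_gt0 subr_eq0 za subr_gt0.
      move=> w wz; rewrite lt_min => /andP[w1 w2]; split.
        by apply: contraTneq w1 => ->; rewrite cabsC ltxx.
      by apply: le_lt_trans (cabs_distD z _ _) _; rewrite -ltrBrDr.
    apply: filterS2 qGz near_d => w <- [wa wd]; exact: Hd.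
have eK : entire K.
  move=> a; have [dG _ _] := hG a; exists (derive1 (G a) a).
  apply: has_deriv_near (derivable_has_deriv (nbhs_singleton dG)).
  by apply: filterS (Kloc a) => z ->.
have perK c : (forall z, q (z + c) = q z) -> forall a, K (a + c) = K a.
  move=> hc a; have [dG _ qG] := hG a; have [dGc _ qGc] := hG (a + c).
  apply: (@punctured_eq (fun z => G (a + c) (z + c)) (G a) a).
  - by apply: has_deriv_cont; apply: has_deriv_shift; exact: derivable_has_deriv (nbhs_singleton dGc).
  - exact: near_derivable_cont.
  - by apply: filterS2 (dnear_shift qGc) qG => z <- <-.
have [M1 _ [T1 T1'] v1 _] := H1; have [M2 _ [T2 T2'] v2 _] := H2.
have q1 z : q (z + 1) = q z.
  rewrite /q T1 T2; case: (h1 z) => [x|]; case: (h2 z) => [y|] /=; rewrite ?mul0r ?invr0 ?mulr0 //.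
  by rewrite invrN mulrNN.
have q2 z : q (z + 2 * tau) = q z.
  have -> : z + 2 * tau = z + tau + tau by ring.
  by rewrite /q T1' T2' T1' T2' !P1invK.
have Im2 : 0 < Im (2 * tau) by rewrite mulr_natl mulr2n ImD addr_gt0.
have Kc a b : K a = K b := liouville_periodic a b Im2 eK (perK 1 q1) (perK _ q2).
have tL : ~ lattice tau (tau / 2 - 1 / 2).
  move=> h; have := @quarter_lattice _ _ tau_gt0 (-2) 2.
  have -> : ((-2)%:~R + 2%:~R * tau) / 4 = tau / 2 - 1 / 2 :> C by field.
  by case/(_ h) => m [n [? ?]]; lia.
have K1 : K (tau / 2) = 1.
  have [g1 [dg1 g1a fg1]] : has_order h1 (tau / 2) 0 by case: H1 => _ + _ _ _; apply.
  have [g2 [dg2 g2a fg2]] : has_order h2 (tau / 2) 0 by case: H2 => _ + _ _ _; apply.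
  have E1 : h1 (tau / 2) = Some (g1 (tau / 2)).
    apply: meromorphic_value; [by case: M1|exact: near_derivable_cont|exact/eqP|].
    by apply: filterS fg1 => z ->; rewrite expr0z mul1r.
  have E2 : h2 (tau / 2) = Some (g2 (tau / 2)).
    apply: meromorphic_value; [by case: M2|exact: near_derivable_cont|exact/eqP|].
    by apply: filterS fg2 => z ->; rewrite expr0z mul1r.
  have [dG _ qG] := hG (tau / 2).
  have n2 := near_punctured (near_derivable_neq0 dg2 g2a).
  have : G (tau / 2) (tau / 2) * g2 (tau / 2) = g1 (tau / 2).
    apply: (@punctured_eq (fun z => G (tau / 2) z * g2 z) g1).
    - exact: (contM (near_derivable_cont dG) (near_derivable_cont dg2)).
    - exact: near_derivable_cont.
    - have both : \forall z \near (tau / 2)^', h1 z = Some ((z - tau / 2) ^ 0 * g1 z) /\ h2 z = Some ((z - tau / 2) ^ 0 * g2 z).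
        by apply: filterS2 fg1 fg2 => z.
      apply: filterS3 qG both n2 => z <- [F1 F2] gz.
      by rewrite /q F1 F2 /= !expr0z !mul1r divfK.
  move: E1 E2; rewrite v1 v2 => -[<-] [<-]; by rewrite mulr1.
move=> a; apply: meromorphic_eq_at; [by case: M1|by case: M2|].
have [k hk] := common_orderP a.
have [g1 [dg1 g1a fg1]] := hk _ H1; have [g2 [dg2 g2a fg2]] := hk _ H2.
have [dG _ qG] := hG a.
have n2 := near_punctured (near_derivable_neq0 dg2 g2a).
have qK : \forall z \near a^', q z = 1.
  by apply: filterS2 qG (near_punctured (Kloc a)) => z -> <-; rewrite (Kc z (tau / 2)).
have both : \forall z \near a^', h1 z = Some ((z - a) ^ k * g1 z) /\ h2 z = Some ((z - a) ^ k * g2 z).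
  by apply: filterS2 fg1 fg2 => z.
have nz : \forall z \near a^', g2 z != 0 /\ z != a.
  by apply: filterS2 n2 (near_neq a) => z.
apply: filterS3 qK both nz => z + [E1 E2] [gz za].
rewrite /q E1 E2 /= => Q; congr Some.
have e0 : (z - a) ^ k != 0 by rewrite expfz_neq0 // subr_eq0.
have d0 : (z - a) ^ k * g2 z != 0 by rewrite mulf_neq0.
by rewrite -[LHS](divfK d0) Q mul1r.
Qed.

End Fixed.
End Uniqueness.

(** * Partial derivatives and real smoothness on open sets *)

Section PartialDerivatives.
Context {R : realType}.
Local Notation C := (cplx R).
Local Notation Re := complex.Re.
Local Notation Im := complex.Im.
Implicit Types (z w : C) (u v a b : C -> R) (F : C -> C) (U : set C) (l m : R).

Definition has_dx u z l := has_deriv (fun t : R => u (mkC t (Im z))) (Re z) l.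
Definition has_dy u z l := has_deriv (fun t : R => u (mkC (Re z) t)) (Im z) l.

Lemma has_dxE u z l : has_dx u z l -> dx u z = l.
Proof. exact: has_derivE. Qed.

Lemma has_dyE u z l : has_dy u z l -> dy u z = l.
Proof. exact: has_derivE. Qed.

Lemma cont_horizontal (y x : R) : {for x, continuous (fun t : R => mkC t y)}.
Proof. exact: path_deriv_cont (path_deriv_horizontal y x). Qed.

Lemma cont_vertical (x y : R) : {for y, continuous (fun t : R => mkC x t)}.
Proof. exact: path_deriv_cont (path_deriv_vertical x y). Qed.

Lemma near_horizontal z (P : C -> Prop) :
  (\forall w \near z, P w) -> \forall t \near Re z, P (mkC t (Im z)).
Proof. by rewrite -{1}(mkC_eta z) => h; exact: (@cont_horizontal (Im z) (Re z) _ h). Qed.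

Lemma near_vertical z (P : C -> Prop) :
  (\forall w \near z, P w) -> \forall t \near Im z, P (mkC (Re z) t).
Proof. by rewrite -{1}(mkC_eta z) => h; exact: (@cont_vertical (Re z) (Im z) _ h). Qed.

Lemma has_dx_near u v z l : (\forall w \near z, u w = v w) -> has_dx u z l -> has_dx v z l.
Proof. by move=> /near_horizontal uv; exact: has_deriv_near. Qed.

Lemma has_dy_near u v z l : (\forall w \near z, u w = v w) -> has_dy u z l -> has_dy v z l.
Proof. by move=> /near_vertical uv; exact: has_deriv_near. Qed.

Lemma has_dx_Re F z d : has_deriv F z d -> has_dx (fun w => Re (F w)) z (Re d).
Proof.
rewrite -{1}(mkC_eta z) => h; have [+ _] := path_deriv_comp (path_deriv_horizontal (Im z) (Re z)) h.
by rewrite mulr1.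
Qed.

Lemma has_dx_Im F z d : has_deriv F z d -> has_dx (fun w => Im (F w)) z (Im d).
Proof.
rewrite -{1}(mkC_eta z) => h; have [_ +] := path_deriv_comp (path_deriv_horizontal (Im z) (Re z)) h.
by rewrite mulr1.
Qed.

Lemma has_dy_Re F z d : has_deriv F z d -> has_dy (fun w => Re (F w)) z (- Im d).
Proof.
rewrite -{1}(mkC_eta z) => h; have [+ _] := path_deriv_comp (path_deriv_vertical (Re z) (Im z)) h.
by rewrite ReM /= mulr0 mulr1 sub0r.
Qed.

Lemma has_dy_Im F z d : has_deriv F z d -> has_dy (fun w => Im (F w)) z (Re d).
Proof.
rewrite -{1}(mkC_eta z) => h; have [_ +] := path_deriv_comp (path_deriv_vertical (Re z) (Im z)) h.
by rewrite ImM /= mulr0 mulr1 addr0.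
Qed.

Lemma has_deriv_ln (x : R) : 0 < x -> has_deriv (@ln R) x x^-1.
Proof. by move=> x0; apply/has_deriv_is_derive; exact: is_derive1_ln. Qed.

Lemma has_dx_ln u z l : 0 < u z -> has_dx u z l -> has_dx (fun w => ln (u w)) z (l / u z).
Proof.
move=> u0 h; apply: has_deriv_eq (has_deriv_comp h (has_deriv_ln _)) _; first by rewrite mkC_eta.
by rewrite mkC_eta mulrC.
Qed.

Lemma has_dy_ln u z l : 0 < u z -> has_dy u z l -> has_dy (fun w => ln (u w)) z (l / u z).
Proof.
move=> u0 h; apply: has_deriv_eq (has_deriv_comp h (has_deriv_ln _)) _; first by rewrite mkC_eta.
by rewrite mkC_eta mulrC.
Qed.

Lemma has_dxM u v z l m : has_dx u z l -> has_dx v z m ->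
  has_dx (fun w => u w * v w) z (l * v z + u z * m).
Proof. by move=> hu hv; apply: has_deriv_eq (has_derivM hu hv) _; rewrite mkC_eta. Qed.

Lemma has_dyM u v z l m : has_dy u z l -> has_dy v z m ->
  has_dy (fun w => u w * v w) z (l * v z + u z * m).
Proof. by move=> hu hv; apply: has_deriv_eq (has_derivM hu hv) _; rewrite mkC_eta. Qed.

Lemma has_dxV u z l : u z != 0 -> has_dx u z l -> has_dx (fun w => (u w)^-1) z (- l / u z ^+ 2).
Proof.
move=> u0 hu; apply: has_deriv_eq (@has_derivV _ (fun t => u (mkC t (Im z))) _ _ _ hu) _; rewrite mkC_eta //.
Qed.

Lemma has_dyV u z l : u z != 0 -> has_dy u z l -> has_dy (fun w => (u w)^-1) z (- l / u z ^+ 2).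
Proof.
move=> u0 hu; apply: has_deriv_eq (@has_derivV _ (fun t => u (mkC (Re z) t)) _ _ _ hu) _; rewrite mkC_eta //.
Qed.

Section Smooth.
Variable U : set C.
Hypothesis openU : forall z, U z -> \forall w \near z, U w.

Lemma Ck_cont k u z : Ck k U u -> U z -> {for z, continuous u}.
Proof. by case: k => [|k] [cu _] Uz; exact: cu. Qed.

Lemma Ck_has_dx k u z : Ck k.+1 U u -> U z -> has_dx u z (dx u z).
Proof. by move=> [_ [h _ _ _]] Uz; exact: derivable_has_deriv (h _ Uz). Qed.

Lemma Ck_has_dy k u z : Ck k.+1 U u -> U z -> has_dy u z (dy u z).
Proof. by move=> [_ [_ h _ _]] Uz; exact: derivable_has_deriv (h _ Uz). Qed.

Lemma Ck_dx k u : Ck k.+1 U u -> Ck k U (dx u).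
Proof. by move=> [_ []]. Qed.

Lemma Ck_dy k u : Ck k.+1 U u -> Ck k U (dy u).
Proof. by move=> [_ []]. Qed.

(** On an open set equality holds near each point, hence passes to the partial derivatives. *)
Lemma Ck_ext k u v : (forall z, U z -> u z = v z) -> Ck k U u -> Ck k U v.
Proof.
elim: k u v => [|k IH] u v uv hu.
  split=> // z Uz; have cu := Ck_cont hu Uz.
  have h : \forall w \near z, u w = v w by apply: filterS (openU Uz).
  apply/cont_epsP => e e0; have /cont_epsP /(_ e e0) H := cu.
  by apply: filterS2 h H => w <-; rewrite uv.
have near z : U z -> \forall w \near z, u w = v w by move=> Uz; apply: filterS (openU Uz).
have hx z (Uz : U z) : has_dx v z (dx u z) := has_dx_near (near z Uz) (Ck_has_dx hu Uz).
have hy z (Uz : U z) : has_dy v z (dy u z) := has_dy_near (near z Uz) (Ck_has_dy hu Uz).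
split; last split.
- move=> z Uz; have cu := Ck_cont hu Uz.
  apply/cont_epsP => e e0; have /cont_epsP /(_ e e0) H := cu.
  by apply: filterS2 (near z Uz) H => w <-; rewrite uv.
- by move=> z Uz; exact: has_deriv_derivable (hx z Uz).
- by move=> z Uz; exact: has_deriv_derivable (hy z Uz).
- by apply: IH (Ck_dx hu) => z Uz; rewrite (has_dxE (hx z Uz)).
- by apply: IH (Ck_dy hu) => z Uz; rewrite (has_dyE (hy z Uz)).
Qed.

(** Introduction rule with explicit candidates for the partial derivatives, which have to be correct
    on [U] only. *)
Lemma CkS k u a b : (forall z, U z -> {for z, continuous u}) ->
  (forall z, U z -> has_dx u z (a z)) -> (forall z, U z -> has_dy u z (b z)) ->
  Ck k U a -> Ck k U b -> Ck k.+1 U u.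
Proof.
move=> cu hx hy ha hb; split=> //; split.
- by move=> z Uz; exact: has_deriv_derivable (hx z Uz).
- by move=> z Uz; exact: has_deriv_derivable (hy z Uz).
- by apply: Ck_ext ha => z Uz; rewrite (has_dxE (hx z Uz)).
- by apply: Ck_ext hb => z Uz; rewrite (has_dyE (hy z Uz)).
Qed.

Lemma Ck_pred k u : Ck k.+1 U u -> Ck k U u.
Proof.
elim: k u => [|k IH] u [cu [hx hy kx ky]]; first exact: (conj cu I).
by split; [exact: cu|split; [exact: hx|exact: hy|exact: IH kx|exact: IH ky]].
Qed.

Lemma Ck_cst k l : Ck k U (fun _ => l).
Proof.
elim: k l => [|k IH] l; first by split=> // z _; exact: cont_cst.
apply: (@CkS _ _ (fun _ => 0) (fun _ => 0)) => // z _.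
- exact: cont_cst.
- exact: has_deriv_cst.
- exact: has_deriv_cst.
Qed.

Lemma CkD k u v : Ck k U u -> Ck k U v -> Ck k U (fun z => u z + v z).
Proof.
elim: k u v => [|k IH] u v hu hv.
  by split=> // z Uz; exact: contD (Ck_cont hu Uz) (Ck_cont hv Uz).
apply: (@CkS _ _ (fun z => dx u z + dx v z) (fun z => dy u z + dy v z)) => [z Uz|z Uz|z Uz||].
- exact: contD (Ck_cont hu Uz) (Ck_cont hv Uz).
- exact: has_derivD (Ck_has_dx hu Uz) (Ck_has_dx hv Uz).
- exact: has_derivD (Ck_has_dy hu Uz) (Ck_has_dy hv Uz).
- exact: IH (Ck_dx hu) (Ck_dx hv).
- exact: IH (Ck_dy hu) (Ck_dy hv).
Qed.

Lemma CkM k u v : Ck k U u -> Ck k U v -> Ck k U (fun z => u z * v z).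
Proof.
elim: k u v => [|k IH] u v hu hv.
  by split=> // z Uz; exact: contM (Ck_cont hu Uz) (Ck_cont hv Uz).
apply: (@CkS _ _ (fun z => dx u z * v z + u z * dx v z) (fun z => dy u z * v z + u z * dy v z)) => [z Uz|z Uz|z Uz||].
- exact: contM (Ck_cont hu Uz) (Ck_cont hv Uz).
- exact: has_dxM (Ck_has_dx hu Uz) (Ck_has_dx hv Uz).
- exact: has_dyM (Ck_has_dy hu Uz) (Ck_has_dy hv Uz).
- by apply: CkD; apply: IH; [exact: Ck_dx hu|exact: Ck_pred hv|exact: Ck_pred hu|exact: Ck_dx hv].
- by apply: CkD; apply: IH; [exact: Ck_dy hu|exact: Ck_pred hv|exact: Ck_pred hu|exact: Ck_dy hv].
Qed.

Lemma Ck_inv k u : (forall z, U z -> u z != 0) -> Ck k U u -> Ck k U (fun z => (u z)^-1).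
Proof.
move=> u0; elim: k => [|k IH] hu.
  by split=> // z Uz; apply: continuousV; [exact: u0|exact: Ck_cont hu Uz].
have hi := IH (Ck_pred hu); have hii := CkM (Ck_cst k (-1)) (CkM hi hi).
apply: (@CkS _ _ (fun z => dx u z * (-1 * ((u z)^-1 * (u z)^-1))) (fun z => dy u z * (-1 * ((u z)^-1 * (u z)^-1)))) => [z Uz|z Uz|z Uz||].
- by apply: continuousV; [exact: u0|exact: Ck_cont hu Uz].
- apply: has_deriv_eq (has_dxV (u0 z Uz) (Ck_has_dx hu Uz)) _.
  by rewrite mulN1r mulrN mulNr -invfM -expr2.
- apply: has_deriv_eq (has_dyV (u0 z Uz) (Ck_has_dy hu Uz)) _.
  by rewrite mulN1r mulrN mulNr -invfM -expr2.
- exact: CkM (Ck_dx hu) hii.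
- exact: CkM (Ck_dy hu) hii.
Qed.

Lemma Ck_ln k u : (forall z, U z -> 0 < u z) -> Ck k U u -> Ck k U (fun z => ln (u z)).
Proof.
move=> u0 hu.
have cu z : U z -> {for z, continuous (fun w => ln (u w))}.
  move=> Uz; exact: contcomp (Ck_cont hu Uz) (continuous_ln (u0 z Uz)).
case: k hu => [|k] hu; first by split.
have hi : Ck k U (fun z => (u z)^-1).
  by apply: Ck_inv (Ck_pred hu) => z /u0 h; rewrite gt_eqF.
apply: (@CkS _ _ (fun z => dx u z * (u z)^-1) (fun z => dy u z * (u z)^-1)) => // [z Uz|z Uz||].
- exact: has_dx_ln (u0 z Uz) (Ck_has_dx hu Uz).
- exact: has_dy_ln (u0 z Uz) (Ck_has_dy hu Uz).
- exact: CkM (Ck_dx hu) hi.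
- exact: CkM (Ck_dy hu) hi.
Qed.

(** By the Cauchy-Riemann equations the partial derivatives are, up to sign, the real and imaginary
    parts of [derive1 F], which is again entire. *)
Lemma Ck_ReIm k F : entire F -> Ck k U (fun z => Re (F z)) /\ Ck k U (fun z => Im (F z)).
Proof.
have cRI G z : entire G -> {for z, continuous (fun w => Re (G w))} /\ {for z, continuous (fun w => Im (G w))}.
  by move=> eG; apply/contC_ReIm; exact: entire_cont.
elim: k F => [|k IH] F eF.
  by split; split=> // z _; have [] := cRI F z eF.
have [h1 h2] := IH _ (entire_derive1 eF).
have h2' := CkM (Ck_cst k (-1)) h2.
split.
- apply: (CkS _ _ _ h1 h2') => z _; first by have [] := cRI F z eF.
    exact: has_dx_Re (entire_deriv z eF).
  by apply: has_deriv_eq (has_dy_Re (entire_deriv z eF)) _; rewrite mulN1r.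
- apply: (CkS _ _ _ h2 h1) => z _; first by have [] := cRI F z eF.
    exact: has_dx_Im (entire_deriv z eF).
  exact: has_dy_Im (entire_deriv z eF).
Qed.

End Smooth.

Definition sqnorm F z : R := Re (F z) * Re (F z) + Im (F z) * Im (F z).

Lemma sqnormE F z : sqnorm F z = cabs (F z) ^+ 2.
Proof. by rewrite cabs2 !expr2. Qed.

Lemma Ck_sqnorm k U F : (forall z, U z -> \forall w \near z, U w) -> entire F -> Ck k U (sqnorm F).
Proof.
move=> oU eF; have [h1 h2] := Ck_ReIm oU k eF.
exact: CkD oU _ _ _ (CkM oU h1 h1) (CkM oU h2 h2).
Qed.

Lemma has_dx_sqnorm F z d : has_deriv F z d ->
  has_dx (sqnorm F) z (2 * (Re (F z) * Re d + Im (F z) * Im d)).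
Proof.
move=> h; have h1 := has_dx_Re h; have h2 := has_dx_Im h.
by apply: has_deriv_eq (has_derivD (has_dxM h1 h1) (has_dxM h2 h2)) _; ring.
Qed.

Lemma has_dy_sqnorm F z d : has_deriv F z d ->
  has_dy (sqnorm F) z (2 * (Im (F z) * Re d - Re (F z) * Im d)).
Proof.
move=> h; have h1 := has_dy_Re h; have h2 := has_dy_Im h.
by apply: has_deriv_eq (has_derivD (has_dyM h1 h1) (has_dyM h2 h2)) _; ring.
Qed.

End PartialDerivatives.

(** * Rules for the Laplacian *)

Section Laplacian.
Context {R : realType}.
Local Notation C := (cplx R).
Local Notation Re := complex.Re.
Local Notation Im := complex.Im.
Implicit Types (z w : C) (u v : C -> R) (F : C -> C) (l : R).

Section OnOpen.
Variable U : set C.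
Hypothesis openU : forall z, U z -> \forall w \near z, U w.

Lemma laplacian_eq u a b z l m : U z -> (forall w, U w -> has_dx u w (a w)) ->
  (forall w, U w -> has_dy u w (b w)) -> has_dx a z l -> has_dy b z m -> laplacian u z = l + m.
Proof.
move=> Uz hx hy ha hb; rewrite /laplacian; congr (_ + _).
- apply: has_dxE; apply: has_dx_near ha; apply: filterS (openU Uz) => w Uw; exact/esym/has_dxE/hx.
- apply: has_dyE; apply: has_dy_near hb; apply: filterS (openU Uz) => w Uw; exact/esym/has_dyE/hy.
Qed.

Lemma laplacian_ext u v z : U z -> (forall w, U w -> u w = v w) -> Ck 2 U u ->
  laplacian v z = laplacian u z.
Proof.
move=> Uz uv hu; have near w : U w -> \forall x \near w, u x = v x by move=> Uw; apply: filterS (openU Uw).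
apply: (laplacian_eq Uz (a := dx u) (b := dy u)) => [w Uw|w Uw||].
- exact: has_dx_near (near w Uw) (Ck_has_dx hu Uw).
- exact: has_dy_near (near w Uw) (Ck_has_dy hu Uw).
- exact: Ck_has_dx (Ck_dx hu) Uz.
- exact: Ck_has_dy (Ck_dy hu) Uz.
Qed.

Lemma laplacianD u v z : U z -> Ck 2 U u -> Ck 2 U v ->
  laplacian (fun w => u w + v w) z = laplacian u z + laplacian v z.
Proof.
move=> Uz hu hv; rewrite {2 3}/laplacian addrACA.
apply: (laplacian_eq Uz (a := fun w => dx u w + dx v w) (b := fun w => dy u w + dy v w)) => [w Uw|w Uw||].
- exact: has_derivD (Ck_has_dx hu Uw) (Ck_has_dx hv Uw).
- exact: has_derivD (Ck_has_dy hu Uw) (Ck_has_dy hv Uw).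
- exact: has_derivD (Ck_has_dx (Ck_dx hu) Uz) (Ck_has_dx (Ck_dx hv) Uz).
- exact: has_derivD (Ck_has_dy (Ck_dy hu) Uz) (Ck_has_dy (Ck_dy hv) Uz).
Qed.

Lemma laplacianZ c u z : U z -> Ck 2 U u -> laplacian (fun w => c * u w) z = c * laplacian u z.
Proof.
move=> Uz hu; rewrite {2}/laplacian mulrDr.
apply: (laplacian_eq Uz (a := fun w => c * dx u w) (b := fun w => c * dy u w)) => [w Uw|w Uw||].
- exact: has_derivZ (Ck_has_dx hu Uw).
- exact: has_derivZ (Ck_has_dy hu Uw).
- exact: has_derivZ (Ck_has_dx (Ck_dx hu) Uz).
- exact: has_derivZ (Ck_has_dy (Ck_dy hu) Uz).
Qed.

Lemma laplacian_cst c z : laplacian (fun _ : C => c) z = 0.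
Proof.
have d0 w : has_dx (fun _ : C => c) w 0 by exact: has_deriv_cst.
have d0' w : has_dy (fun _ : C => c) w 0 by exact: has_deriv_cst.
have e1 : dx (fun _ : C => c) = fun _ => 0 by apply/funext => w; exact: has_dxE (d0 w).
have e2 : dy (fun _ : C => c) = fun _ => 0 by apply/funext => w; exact: has_dyE (d0' w).
have h1 : dx (fun _ : C => 0 : R) z = 0 by apply: has_dxE; exact: has_deriv_cst.
have h2 : dy (fun _ : C => 0 : R) z = 0 by apply: has_dyE; exact: has_deriv_cst.
by rewrite /laplacian e1 e2 h1 h2 addr0.
Qed.

Lemma laplacian_ln u z : U z -> (forall w, U w -> 0 < u w) -> Ck 2 U u ->
  laplacian (fun w => ln (u w)) z = (u z * laplacian u z - dx u z ^+ 2 - dy u z ^+ 2) / u z ^+ 2.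
Proof.
move=> Uz u0 hu; have uz := u0 z Uz; have uz0 : u z != 0 by rewrite gt_eqF.
have hx := has_dxM (Ck_has_dx (Ck_dx hu) Uz) (has_dxV uz0 (Ck_has_dx hu Uz)).
have hy := has_dyM (Ck_has_dy (Ck_dy hu) Uz) (has_dyV uz0 (Ck_has_dy hu Uz)).
rewrite (laplacian_eq Uz _ _ hx hy).
- rewrite /laplacian; move: (dx (dx u) z) (dy (dy u) z) (dx u z) (dy u z) (u z) uz0 => a b c d e e0.
  by field.
- by move=> w Uw; exact: has_dx_ln (u0 w Uw) (Ck_has_dx hu Uw).
- by move=> w Uw; exact: has_dy_ln (u0 w Uw) (Ck_has_dy hu Uw).
Qed.

End OnOpen.

Lemma laplacian_sqnorm F z : entire F -> laplacian (sqnorm F) z = 4 * sqnorm (derive1 F) z.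
Proof.
move=> eF; have eF' := entire_derive1 eF.
have h w := entire_deriv w eF; have h' := entire_deriv z eF'.
have a1 := has_derivZ 2 (has_derivD (has_dxM (has_dx_Re (h z)) (has_dx_Re h')) (has_dxM (has_dx_Im (h z)) (has_dx_Im h'))).
have b1 := has_derivZ 2 (has_derivB (has_dyM (has_dy_Im (h z)) (has_dy_Re h')) (has_dyM (has_dy_Re (h z)) (has_dy_Im h'))).
pose a w := 2 * (Re (F w) * Re (derive1 F w) + Im (F w) * Im (derive1 F w)).
pose b w := 2 * (Im (F w) * Re (derive1 F w) - Re (F w) * Im (derive1 F w)).
have openT w : [set: C] w -> \forall x \near w, [set: C] x by move=> _; exact: filterT.
have hx w : [set: C] w -> has_dx (sqnorm F) w (a w) by move=> _; exact: has_dx_sqnorm (h w).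
have hy w : [set: C] w -> has_dy (sqnorm F) w (b w) by move=> _; exact: has_dy_sqnorm (h w).
rewrite (laplacian_eq openT (I : [set: C] z) hx hy a1 b1).
rewrite /sqnorm; move: (derive1 (derive1 F) z) (derive1 F z) (F z) => x y t.
by move: (Re x) (Im x) (Re y) (Im y) (Re t) (Im t) => *; ring.
Qed.

End Laplacian.

(** * The spherical density in homogeneous coordinates *)

Section SphericalDensity.
Context {R : realType}.
Local Notation C := (cplx R).
Local Notation Re := complex.Re.
Local Notation Im := complex.Im.
Variables N D : C -> C.
Hypotheses (eN : entire N) (eD : entire D).
Hypothesis coprimeND : forall z, (N z != 0) || (D z != 0).

(** Its logarithm is the potential of the Fubini-Study metric, pulled back in the homogeneous
    coordinates [(N, D)]. *)
Definition fs_potential z : R := sqnorm N z + sqnorm D z.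
Definition wronskian z : C := derive1 N z * D z - N z * derive1 D z.
Definition fs_density z : R := 8 * sqnorm wronskian z / fs_potential z ^+ 2.

Lemma fs_potential_gt0 z : 0 < fs_potential z.
Proof.
rewrite /fs_potential !sqnormE; case/orP: (coprimeND z) => h.
  by apply: ltr_pwDl; rewrite ?sqr_ge0 // exprn_gt0 // cabs_gt0.
by apply: ltr_wpDl; rewrite ?sqr_ge0 // exprn_gt0 // cabs_gt0.
Qed.

Lemma entire_wronskian : entire wronskian.
Proof. by apply: entireB; apply: entireM => //; exact: entire_derive1. Qed.

Variable U : set C.
Hypothesis openU : forall z, U z -> \forall w \near z, U w.

Lemma Ck_fs_potential k : Ck k U fs_potential.
Proof. by apply: CkD => //; exact: Ck_sqnorm. Qed.

Lemma Ck_fs_density k : Ck k U fs_density.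
Proof.
rewrite (_ : fs_density = fun z => 8 * sqnorm wronskian z * ((fs_potential z)^-1 * (fs_potential z)^-1)).
  have h : Ck k U (fun z => (fs_potential z)^-1).
    by apply: Ck_inv (Ck_fs_potential k) => // z _; rewrite gt_eqF ?fs_potential_gt0.
  apply: CkM; [exact: openU| |exact: CkM].
  apply: CkM; [exact: openU|exact: Ck_cst|exact: Ck_sqnorm entire_wronskian].
by apply/funext => z; rewrite -invfM.
Qed.

Hypothesis wronskianU : forall z, U z -> wronskian z != 0.

Let Q z : R := sqnorm wronskian z.

Let Q0 z : U z -> 0 < Q z.
Proof. by move=> /wronskianU h; rewrite /Q sqnormE exprn_gt0 // cabs_gt0. Qed.

Lemma fs_density_gt0 z : U z -> 0 < fs_density z.
Proof. by move=> /Q0 h; rewrite divr_gt0 ?exprn_gt0 ?fs_potential_gt0 // mulr_gt0. Qed.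

Let ln_fs_density z : U z -> ln 8 + ln (Q z) + (-2) * ln (fs_potential z) = ln (fs_density z).
Proof.
move=> /Q0 Qz; have P0 := fs_potential_gt0 z.
rewrite /fs_density ln_div ?posrE ?mulr_gt0 ?exprn_gt0 // lnM ?posrE // lnXn //.
by rewrite mulNr mulr_natl.
Qed.

(* Away from the zeros of the Wronskian, [ln] of its squared norm is harmonic;
   the other term is evaluated by Lagrange's identity. *)
Lemma laplacian_ln_fs_density z : U z -> laplacian (fun w => ln (fs_density w)) z = - fs_density z.
Proof.
move=> Uz.
have kQ : Ck 2 U Q := Ck_sqnorm 2 openU entire_wronskian.
have klQ : Ck 2 U (fun w => ln (Q w)) := Ck_ln openU Q0 kQ.
have kP := Ck_fs_potential 2.
have P0 w : U w -> 0 < fs_potential w by move=> _; exact: fs_potential_gt0.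
have klP := CkM openU (Ck_cst openU 2 (-2)) (Ck_ln openU P0 kP).
have k8 := CkD openU (Ck_cst openU 2 (ln 8)) klQ.
rewrite (laplacian_ext openU Uz ln_fs_density (CkD openU k8 klP)).
rewrite (laplacianD openU Uz k8 klP) (laplacianD openU Uz (Ck_cst openU 2 (ln 8)) klQ) laplacian_cst add0r.
rewrite (laplacianZ openU _ Uz (Ck_ln openU P0 kP)) (laplacian_ln openU Uz Q0 kQ) (laplacian_ln openU Uz P0 kP).
rewrite /Q (laplacian_sqnorm z entire_wronskian) (laplacianD openU Uz (Ck_sqnorm 2 openU eN) (Ck_sqnorm 2 openU eD)).
rewrite (laplacian_sqnorm z eN) (laplacian_sqnorm z eD).
rewrite (has_dxE (has_dx_sqnorm (entire_deriv z entire_wronskian))).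
rewrite (has_dyE (has_dy_sqnorm (entire_deriv z entire_wronskian))).
have hx : has_dx fs_potential z _ := has_derivD (has_dx_sqnorm (entire_deriv z eN)) (has_dx_sqnorm (entire_deriv z eD)).
have hy : has_dy fs_potential z _ := has_derivD (has_dy_sqnorm (entire_deriv z eN)) (has_dy_sqnorm (entire_deriv z eD)).
rewrite (has_dxE hx) (has_dyE hy).
have -> : sqnorm wronskian z * (4 * sqnorm (derive1 wronskian) z) -
  (2 * (Re (wronskian z) * Re (derive1 wronskian z) + Im (wronskian z) * Im (derive1 wronskian z))) ^+ 2 -
  (2 * (Im (wronskian z) * Re (derive1 wronskian z) - Re (wronskian z) * Im (derive1 wronskian z))) ^+ 2 = 0.
  rewrite /sqnorm; move: (wronskian z) (derive1 wronskian z) => x y.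
  by move: (Re x) (Im x) (Re y) (Im y) => *; ring.
rewrite mul0r add0r /fs_density [LHS]mulrA -[RHS]mulNr; congr (_ / _).
rewrite /fs_potential /sqnorm /wronskian.
move: (derive1 N z) (derive1 D z) (N z) (D z) => a b c d.
rewrite !ReD !ImD !ReN !ImN !ReM !ImM.
by move: (Re a) (Im a) (Re b) (Im b) (Re c) (Im c) (Re d) (Im d) => *; ring.
Qed.

End SphericalDensity.

(** * Invariance of the spherical density *)

Section DensityInvariance.
Context {R : realType}.
Local Notation C := (cplx R).
Implicit Types (N D m : C -> C) (z w : C).

Lemma fs_densityE N D z :
  fs_density N D z = 8 * cabs (wronskian N D z) ^+ 2 / (cabs (N z) ^+ 2 + cabs (D z) ^+ 2) ^+ 2.
Proof. by rewrite /fs_density /fs_potential (sqnormE (wronskian N D)) (sqnormE N) (sqnormE D). Qed.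

Lemma fs_density_shift N D z w : entire N -> entire D ->
  fs_density N D (z + w) = fs_density (fun x => N (x + w)) (fun x => D (x + w)) z.
Proof.
move=> eN eD; rewrite /fs_density /sqnorm /wronskian.
have h F : entire F -> derive1 (fun x => F (x + w)) z = derive1 F (z + w).
  by move=> eF; apply: has_derivE; apply: has_deriv_shift; exact: entire_deriv.
by rewrite !h.
Qed.

Lemma fs_densityC N D z : fs_density N D z = fs_density D N z.
Proof.
have E : wronskian N D z = - wronskian D N z.
  by rewrite /wronskian; move: (derive1 N z) (derive1 D z) (N z) (D z) => *; ring.
by rewrite !fs_densityE E cabsN [cabs (N z) ^+ 2 + _]addrC.
Qed.

Lemma fs_densityN N D z : entire D -> fs_density N (fun x => - D x) z = fs_density N D z.
Proof.
move=> eD; have dD : derive1 (fun x => - D x) z = - derive1 D z.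
  by apply: has_derivE; apply: has_derivN; exact: entire_deriv.
have E2 : wronskian N (fun x => - D x) z = - wronskian N D z 
    by rewrite /wronskian dD; move: (derive1 N z) (derive1 D z) (N z) (D z) => *; ring.
by rewrite !fs_densityE E2 !cabsN.
Qed.

(** The derivative of [m] cancels in the Wronskian, which is multiplied by [m ^+ 2], so all powers
    of [m] cancel in the density. This is why multipliers do not spoil periodicity. *)
Lemma fs_densityM m N D z : entire m -> entire N -> entire D -> m z != 0 ->
  fs_density (fun x => m x * N x) (fun x => m x * D x) z = fs_density N D z.
Proof.
move=> em eN eD mz.
have h F : entire F -> derive1 (fun x => m x * F x) z = derive1 m z * F z + m z * derive1 F z.
  by move=> eF; apply: has_derivE; apply: has_derivM; exact: entire_deriv.
have E : wronskian (fun x => m x * N x) (fun x => m x * D x) z = m z ^+ 2 * wronskian N D z.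
  rewrite /wronskian !h //; move: (derive1 m z) (derive1 N z) (derive1 D z) (m z) (N z) (D z) => *.
  by ring.
have mc : cabs (m z) != 0 by rewrite cabs_eq0.
rewrite !fs_densityE E (cabsM (m z ^+ 2)) cabsX (cabsM (m z) (N z)) (cabsM (m z) (D z)).
move: (cabs (m z)) (cabs (wronskian N D z)) (cabs (N z)) (cabs (D z)) mc => a b c d a0.
have a4 : (a ^+ 2) ^+ 2 != 0 by rewrite !expf_neq0.
rewrite [(a * c) ^+ 2]exprMn [(a * d) ^+ 2]exprMn -mulrDr.
rewrite [(a ^+ 2 * b) ^+ 2]exprMn [(a ^+ 2 * (_ + _)) ^+ 2]exprMn invfM.
move: ((a ^+ 2) ^+ 2) a4 (((_ + _) ^+ 2)^-1) => A A0 q.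
by field.
Qed.

End DensityInvariance.

(** * The density on the torus and its zero at the origin *)

Section Density.
Context {R : realType}.
Local Notation C := (cplx R).
Local Notation Re := complex.Re.
Local Notation Im := complex.Im.
Variable tau : C.
Hypothesis tau_gt0 : 0 < Im tau.
Local Notation N := (dev_num tau).
Local Notation D := (dev_den tau).
Local Notation s := (wsigma tau).
Implicit Types (z w : C).

Let eN : entire N := entire_dev_num tau_gt0.
Let eD : entire D := entire_dev_den tau_gt0.

Definition torus_density : C -> R := fs_density N D.
Local Notation E := torus_density.

Lemma torus_density_spherical z : spherical_density (dev_map tau) z = E z.
Proof. by rewrite dev_density // /E fs_densityE. Qed.

Let entire_mult1 : entire (dev_mult1 tau).
Proof.
rewrite (_ : dev_mult1 tau = fun z => - cexp (quasi_period tau 1 * (1 / 2 * z + 1 / 4))).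
  apply: entireN; apply: (@entire_comp _ (@cexp R)); first exact: entire_cexp.
  by apply: entireM (entire_cst _) (entire_affine _ _).
by apply/funext => z; rewrite /dev_mult1; congr (- cexp (_ * _)); field.
Qed.

Let entire_mult_tau : entire (dev_mult_tau tau).
Proof.
rewrite (_ : dev_mult_tau tau = fun z => dev_cst tau * cexp (quasi_period tau tau * (1 / 2 * z + - (1 / 4)))).
  apply: entireM (entire_cst _) _; apply: (@entire_comp _ (@cexp R)); first exact: entire_cexp.
  by apply: entireM (entire_cst _) (entire_affine _ _).
by apply/funext => z; rewrite /dev_mult_tau; congr (_ * cexp (_ * _)); field.
Qed.

Let density_shift1 z : E (z + 1) = E z.
Proof.
rewrite /E (fs_density_shift _ _ eN eD).
rewrite (_ : (fun x => N (x + 1)) = fun x => dev_mult1 tau x * N x); last by apply/funext => x; exact: dev_num_shift1.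
rewrite (_ : (fun x => D (x + 1)) = fun x => - (dev_mult1 tau x * D x)); last by apply/funext => x; exact: dev_den_shift1.
rewrite fs_densityN; last exact: entireM.
by rewrite fs_densityM // /dev_mult1 oppr_eq0 cexp_neq0.
Qed.

Let density_shift_tau z : E (z + tau) = E z.
Proof.
rewrite /E (fs_density_shift _ _ eN eD).
rewrite (_ : (fun x => N (x + tau)) = fun x => dev_mult_tau tau x * D x); last by apply/funext => x; exact: dev_num_shift_tau.
rewrite (_ : (fun x => D (x + tau)) = fun x => dev_mult_tau tau x * N x); last by apply/funext => x; exact: dev_den_shift_tau.
rewrite fs_densityM //; first exact: fs_densityC.
by rewrite /dev_mult_tau mulf_neq0 ?cexp_neq0 // /dev_cst cexp_neq0.
Qed.

Lemma torus_density_periodic z w : lattice tau w -> E (z + w) = E z.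
Proof.
move=> [m [n ->]]; rewrite addrA (int_shift_ind density_shift_tau).
by rewrite -[m%:~R]mulr1 (int_shift_ind density_shift1).
Qed.

Lemma wronskian_sigma z : wronskian N D z = wronskian_cst tau * s z.
Proof. exact: dev_wronskianE. Qed.

Lemma open_off_lattice z : ~ lattice tau z -> \forall w \near z, ~ lattice tau w.
Proof.
move=> /(sigma_neq0 tau_gt0) h.
have := near_neq0 (entire_cont (z := z) (entire_sigma tau_gt0)) h.
by apply: filterS => w wz /(sigma_eq0 tau_gt0) /eqP; rewrite (negbTE wz).
Qed.

Let ND z : (N z != 0) || (D z != 0) := dev_num_or_den_neq0 tau_gt0 z.

Let W0 z : ~ lattice tau z -> wronskian N D z != 0.
Proof. by move=> zL; rewrite wronskian_sigma mulf_neq0 ?sigma_neq0 // wronskian_cst_neq0. Qed.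

Lemma torus_density_gt0 z : ~ lattice tau z -> 0 < E z.
Proof. by move=> zL; apply: (fs_density_gt0 ND (U := ~` lattice tau)) => //; exact: W0. Qed.

Lemma Ck_torus_density k (U : set C) : (forall z, U z -> \forall w \near z, U w) -> Ck k U E.
Proof. by move=> oU; exact: Ck_fs_density. Qed.

Lemma torus_density_cont z : {for z, continuous E}.
Proof. by apply: (@Ck_cont _ setT 0%N) => //; apply: Ck_torus_density => w _; exact: filterT. Qed.

Lemma Ck_ln_torus_density k : Ck k (~` lattice tau) (fun z => ln (E z)).
Proof.
apply: Ck_ln; [exact: open_off_lattice|exact: torus_density_gt0|].
by apply: Ck_torus_density; exact: open_off_lattice.
Qed.

Lemma laplacian_ln_torus_density z : ~ lattice tau z -> laplacian (fun w => ln (E w)) z = - E z.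
Proof. exact: (@laplacian_ln_fs_density _ _ _ eN eD ND (~` lattice tau) open_off_lattice W0). Qed.

(** Meets the lattice only in 0, and contains the rectangle of half this size to which every point
    reduces modulo the lattice. *)
Definition central_cell : set C := [set z | `|Re z| < 1 /\ `|Im z| < Im tau].

Lemma open_central_cell z : central_cell z -> \forall w \near z, central_cell w.
Proof.
move=> [h1 h2]; apply/nearC; exists (Num.min (1 - `|Re z|) (Im tau - `|Im z|)).
  by rewrite lt_min !subr_gt0 h1 h2.
move=> w; rewrite lt_min => /andP[w1 w2]; split.
- have := Re_le_cabs (w - z); rewrite ReD ReN => h3.
  have := ler_normD (Re w - Re z) (Re z); rewrite subrK => h4; lra.
- have := Im_le_cabs (w - z); rewrite ImD ImN => h3.
  have := ler_normD (Im w - Im z) (Im z); rewrite subrK => h4; lra.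
Qed.

Lemma central_cell_lattice z : central_cell z -> lattice tau z -> z = 0.
Proof.
move=> [h1 h2] /latticeP [[m n] E]; move: h1 h2; rewrite E Re_lat Im_lat /= normrM (gtr0_norm tau_gt0).
rewrite gtr_pMl // -intr_norm -[1]/(1%:~R) ltr_int => h1 h2; have n0 : n = 0 by lia.
move: h1; rewrite n0 mul0r addr0 -intr_norm -[1]/(1%:~R) ltr_int => h1; have m0 : m = 0 by lia.
by rewrite /lat m0 /= mul0r addr0.
Qed.

(** The factor [r] is formed like the density, with [wsigma z / z] in place of [wsigma z]; this
    quotient has no zero in the cell, as its value at 0 is 1. *)
Lemma torus_density_local : exists r : C -> R,
  [/\ forall k, Ck k central_cell r, forall z, central_cell z -> 0 < r z &
      forall z, E z = (Re z ^+ 2 + Im z ^+ 2) * r z].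
Proof.
have [g [eg g0 sg]] := entire_slope 0 (entire_sigma tau_gt0).
pose h z := wronskian_cst tau * g z; have eh : entire h := entireM (entire_cst _) eg.
have P0 := fs_potential_gt0 ND.
pose r z := 8 * sqnorm h z * ((fs_potential N D z)^-1 * (fs_potential N D z)^-1).
have gn z : central_cell z -> g z != 0.
  move=> zV; have [->|z0] := eqVneq z 0; first by rewrite g0 dsigma0 // oner_eq0.
  have zL : ~ lattice tau z by move=> /(central_cell_lattice zV) /eqP; rewrite (negbTE z0).
  have := sigma_neq0 tau_gt0 zL; rewrite sg sigma0 // add0r subr0 mulf_eq0 negb_or => /andP[]//.
exists r; split.
- move=> k; have oV := open_central_cell.
  have kP : Ck k central_cell (fun z => (fs_potential N D z)^-1).
    apply: Ck_inv (Ck_fs_potential eN eD oV k) => //; first by move=> z _; rewrite gt_eqF.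
  apply: CkM => //; last exact: CkM.
  by apply: CkM => //; [exact: Ck_cst|exact: Ck_sqnorm].
- move=> z zV; rewrite /r mulr_gt0 ?mulr_gt0 ?invr_gt0 ?P0 //.
  by rewrite sqnormE exprn_gt0 // cabs_gt0 /h mulf_neq0 ?gn // wronskian_cst_neq0.
- move=> z; rewrite /E /fs_density /r -cabs2 -invfM -expr2 mulrA; congr (_ / _).
  rewrite (sqnormE (wronskian N D)) (sqnormE h) wronskian_sigma sg sigma0 // add0r subr0 /h !cabsM !exprMn.
  by move: (cabs _ ^+ 2) (cabs _ ^+ 2) (cabs _ ^+ 2) => x y t; ring.
Qed.

End Density.

(** * Integrals of continuous functions on the line *)

Section LineIntegral.
Context {R : realType}.
Local Notation mu := (@lebesgue_measure R).
Implicit Types (f g G : R -> R) (a b c x y : R).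

(* Meaningful when [g] is continuous on the whole line. *)
Definition lint a b g : R :=
  let G := xget (fun _ => 0) [set G : R -> R | forall x, has_deriv G x (g x)] in G b - G a.

Lemma lintE G g a b : (forall x, has_deriv G x (g x)) -> lint a b g = G b - G a.
Proof.
move=> hG; rewrite /lint.
have := @xgetPex _ (fun _ => 0) [set G : R -> R | forall x, has_deriv G x (g x)] (ex_intro _ G hG).
move: (xget _ _) => H /= hH.
have := @deriv0_const R (fun x => H x - G x) a b.
move=> K; have {K} : H b - G b = H a - G a.
  by apply: K => x _; rewrite -(subrr (g x)); exact: has_derivB.
lra.
Qed.

Lemma lintD f g a b : continuous f -> continuous g ->
  lint a b (fun x => f x + g x) = lint a b f + lint a b g.
Proof.
move=> /exists_primitive [F hF] /exists_primitive [G hG].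
rewrite (lintE (G := fun x => F x + G x) a b _); last by move=> x; exact: has_derivD.
by rewrite (lintE a b hF) (lintE a b hG); ring.
Qed.

Lemma lintZ c g a b : continuous g -> lint a b (fun x => c * g x) = c * lint a b g.
Proof.
move=> /exists_primitive [G hG].
rewrite (lintE (G := fun x => c * G x) a b _); last by move=> x; exact: has_derivZ.
by rewrite (lintE a b hG); ring.
Qed.

Lemma lintB f g a b : continuous f -> continuous g ->
  lint a b (fun x => f x - g x) = lint a b f - lint a b g.
Proof.
move=> /exists_primitive [F hF] /exists_primitive [G hG].
rewrite (lintE (G := fun x => F x - G x) a b _); last by move=> x; exact: has_derivB.
by rewrite (lintE a b hF) (lintE a b hG); ring.
Qed.

Lemma lint_cst c a b : lint a b (fun _ => c) = c * (b - a).
Proof.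
rewrite (lintE (G := fun x => c * x) a b _) ?mulrBr // => x.
by apply: has_deriv_eq (has_derivZ c (has_deriv_id x)) _; rewrite mulr1.
Qed.

Lemma le_lint f g a b : a <= b -> continuous f -> continuous g ->
  (forall x, a <= x <= b -> f x <= g x) -> lint a b f <= lint a b g.
Proof.
move=> ab cf cg fg; rewrite -subr_le0 -lintB //.
have [H hH] := exists_primitive (fun x => contB (cf x) (cg x)).
rewrite (lintE a b hH); apply: le_trans (mvt_real_le (M := 0) ab (fun x _ => hH x) _) _.
  by move=> x /fg; rewrite subr_le0.
by rewrite mul0r.
Qed.

Lemma lint_abs f g a b : a <= b -> continuous f -> continuous g ->
  (forall x, a <= x <= b -> `|f x| <= g x) -> `|lint a b f| <= lint a b g.
Proof.
move=> ab cf cg fg; rewrite ler_norml; apply/andP; split.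
- rewrite -mulN1r -lintZ //; apply: le_lint => // [x|x xab].
    exact: (@contM R R (fun _ => -1) g x (@cont_cst R R (-1) x) (cg x)).
  by have := fg x xab; rewrite ler_norml mulN1r => /andP[].
- apply: le_lint => // x xab; apply: le_trans (ler_norm _) _; exact: fg.
Qed.

Lemma lint_shift g a b c : continuous g -> lint a b (fun x => g (x + c)) = lint (a + c) (b + c) g.
Proof.
move=> /exists_primitive [G hG]; rewrite (lintE (a + c) (b + c) hG).
rewrite (lintE (G := fun x => G (x + c)) a b _) // => x.
apply: has_deriv_eq (has_deriv_comp (g := fun y => y + c) _ (hG _)) (mulr1 _).
by rewrite -[X in has_deriv _ _ X]addr0; exact: has_derivD (has_deriv_id x) (has_deriv_cst c x).
Qed.

Lemma lint_periodic g a b : continuous g -> (forall x, g (x + 1) = g x) -> lint a (a + 1) g = lint b (b + 1) g.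
Proof.
move=> cg per; have [G hG] := exists_primitive cg.
rewrite !(lintE _ _ hG).
apply: (@deriv0_const R (fun x => G (x + 1) - G x)) => x _.
rewrite -(subrr (g x)); apply: has_derivB (hG x); rewrite -(per x).
apply: has_deriv_eq (has_deriv_comp (g := fun y => y + 1) _ (hG _)) (mulr1 _).
by rewrite -[X in has_deriv _ _ X]addr0; exact: has_derivD (has_deriv_id x) (has_deriv_cst 1 x).
Qed.

Lemma lint_FTC g G a b : (forall x, a <= x <= b -> has_deriv G x (g x)) -> a < b ->
  {within `[a, b], continuous g} -> (\int[mu]_(x in `[a, b]) (g x)%:E = (G b - G a)%:E)%E.
Proof.
move=> hG ab cg; rewrite (@continuous_FTC2 R g G a b ab cg) ?EFinB //.
- have h x : a <= x <= b -> G y @[y --> x] --> G x by move=> /hG /has_deriv_cont.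
  split.
  + by move=> x; rewrite in_itv /= => /andP[xa xb]; apply: has_deriv_derivable (hG x _); rewrite !ltW.
  + by apply: cvg_at_right_filter; apply: h; rewrite lexx ltW.
  + by apply: cvg_at_left_filter; apply: h; rewrite lexx ltW.
- by move=> x; rewrite in_itv /= => /andP[xa xb]; apply: has_derivE; apply: hG; rewrite !ltW.
Qed.

Lemma lint_lebesgue g a b : a < b -> continuous g -> (\int[mu]_(x in `[a, b]) (g x)%:E = (lint a b g)%:E)%E.
Proof.
move=> ab cg; have [G hG] := exists_primitive cg.
rewrite (lintE a b hG); apply: lint_FTC => //; exact: continuous_subspaceT.
Qed.

Lemma eps_has_deriv f x l : (forall e : R, 0 < e -> exists2 d : R, 0 < d &
  forall y, `|y - x| < d -> `|f y - f x - l * (y - x)| <= e * `|y - x|) -> has_deriv f x l.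
Proof.
move=> h; exists (fun y => if y == x then l else (f y - f x) / (y - x)); split; last 1 first.
- move=> y; case: eqVneq => [->|yx]; first by rewrite subrr mulr0 addr0.
  by rewrite divfK ?subr_eq0 // addrC subrK.
- apply/contRR => e e0; have e20 : 0 < e / 2 by rewrite divr_gt0.
  have [d d0 Hd] := h _ e20; exists d => // y yd; rewrite eqxx; case: eqVneq => [_|yx].
    by rewrite subrr normr0.
  have y0 : y - x != 0 by rewrite subr_eq0.
  rewrite -[l in X in `|_ - X|](mulfK y0) -mulrBl normrM normfV ltr_pdivrMr ?normr_gt0 //.
  apply: le_lt_trans (Hd _ yd) _.
  by rewrite ltr_pM2r ?normr_gt0 // ltr_pdivrMr // ltr_pMr // ltr1n.
- by rewrite eqxx.
Qed.

End LineIntegral.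

(** * Integration over a horizontal period *)

Section HorizontalIntegral.
Context {R : realType}.
Local Notation C := (cplx R).
Local Notation Re := complex.Re.
Local Notation Im := complex.Im.
Implicit Types (u v : C -> R) (z w : C).

(** The period is placed so that the lattice point 0 lies over its centre. *)
Definition hint u (y : R) : R := lint (- (1 / 2)) (1 / 2) (fun x => u (mkC x y)).

Definition line_cont u (y : R) := forall x, {for mkC x y, continuous u}.

Lemma line_cont_line u y : line_cont u y -> continuous (fun x => u (mkC x y)).
Proof. by move=> h x; exact: (@contcomp R C R u (fun t => mkC t y) x (@cont_horizontal R y x) (h x)). Qed.

(** Compactness of the segment makes continuity across it uniform, as needed under the integral
    sign. *)
Lemma tube u (a b y0 e : R) : (forall x, a <= x <= b -> {for mkC x y0, continuous u}) -> 0 < e ->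
  exists2 d : R, 0 < d & forall x y, a <= x <= b -> `|y - y0| < d -> `|u (mkC x y) - u (mkC x y0)| < e.
Proof.
move=> cu e0.
have K := @segment_compact R a b.
have /(@compact_near_coveringP R) NC := K.
have e20 : 0 < e / 2 by rewrite divr_gt0.
have H : \forall y \near y0, `[a, b] `<=` (fun x => `|u (mkC x y) - u (mkC x y0)| < e).
  apply: (NC R (nbhs y0) (fun y x => `|u (mkC x y) - u (mkC x y0)| < e) _) => x; rewrite /= in_itv /= => xab.
  have /contCR /(_ _ e20) [d d0 Hd] := cu x xab.
  exists (ball x (d / 2), ball y0 (d / 2)); first by split; apply: nbhsx_ballx; rewrite divr_gt0.
  move=> [x' y'] [/= Hx Hy].
  have h (t : R) : `|t - y0| < d / 2 -> `|u (mkC x' t) - u (mkC x y0)| < e / 2.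
    move=> ht; apply: Hd; apply: le_lt_trans (cabs_le_ReIm _) _ => /=.
    by rewrite [d]splitr; apply: ltrD; rewrite // distrC.
  have h1 : `|u (mkC x' y') - u (mkC x y0)| < e / 2 by apply: h; rewrite distrC.
  have h2 : `|u (mkC x' y0) - u (mkC x y0)| < e / 2 by apply: h; rewrite subrr normr0 divr_gt0.
  have := ler_normB (u (mkC x' y') - u (mkC x y0)) (u (mkC x' y0) - u (mkC x y0)).
  by rewrite opprB addrA subrK => h3; lra.
have /nbhs_ballP [d d0 Hd] := H; exists d => // x y xab yd; apply: Hd; last by rewrite /= in_itv.
by rewrite /ball /= distrC.
Qed.

Let half_le : - (1 / 2) <= 1 / 2 :> R. Proof. lra. Qed.

(** Differentiation under the integral: the mean value inequality for [u - u' (mkC x y0) * t] on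
    vertical segments, with an error uniform in [x] by [tube]. *)
Lemma hint_deriv u u' y0 (d : R) : 0 < d ->
  (forall y, `|y - y0| < d -> line_cont u y /\ line_cont u' y) ->
  (forall x y, `|y - y0| < d -> has_dy u (mkC x y) (u' (mkC x y))) ->
  has_deriv (hint u) y0 (hint u' y0).
Proof.
move=> d0 cu hu; apply: eps_has_deriv => e e0.
have y0d : `|y0 - y0| < d by rewrite subrr normr0.
have [cu0 cu0'] := cu _ y0d.
have [d1 d10 H1] := tube (a := - (1 / 2)) (b := 1 / 2) (fun x _ => cu0' x) e0.
exists (Num.min d d1); first by rewrite lt_min d0.
move=> y; rewrite lt_min => /andP[yd yd1].
have [cy _] := cu _ yd.
have c1 := line_cont_line cu0; have c2 := line_cont_line cu0'; have c3 := line_cont_line cy.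
have c4 : continuous (fun x => (y - y0) * u' (mkC x y0)).
  by move=> x; exact: (@contM R R (fun _ => y - y0) _ x (@cont_cst R R (y - y0) x) (c2 x)).
rewrite /hint [lint _ _ _ * _]mulrC -(lintZ (y - y0)) // -lintB // -lintB; last 2 first.
- by move=> x; exact: contB (c3 x) (c1 x).
- exact: c4.
have -> : e * `|y - y0| = lint (- (1 / 2)) (1 / 2) (fun _ => e * `|y - y0|).
  by rewrite lint_cst; lra.
apply: lint_abs => // [x|x|x xab].
- exact: contB (contB (c3 x) (c1 x)) (c4 x).
- exact: cont_cst.
have seg t : Num.min y0 y <= t <= Num.max y0 y -> `|t - y0| <= `|y - y0|.
  case: (leP y0 y) => h /andP[h1 h2]; first by rewrite !ger0_norm; lra.
  by rewrite !ler0_norm; lra.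
have := @path_mvt_dist R (fun t => mkC (u (mkC x t) - u' (mkC x y0) * t) 0) (fun t => mkC (u' (mkC x t) - u' (mkC x y0)) 0) y0 y e.
have p1 t : Num.min y0 y <= t <= Num.max y0 y -> path_deriv (fun t => mkC (u (mkC x t) - u' (mkC x y0) * t) 0)
    t (mkC (u' (mkC x t) - u' (mkC x y0)) 0).
  move=> /seg ty; split=> /=; last exact: has_deriv_cst.
  apply: has_derivB; first by apply: (hu x t); exact: le_lt_trans ty yd.
  by apply: has_deriv_eq (has_derivZ _ (has_deriv_id t)) _; rewrite mulr1.
move=> /(_ p1) K.
have p2 t : Num.min y0 y <= t <= Num.max y0 y -> cabs (mkC (u' (mkC x t) - u' (mkC x y0)) 0) <= e.
  by move=> /seg ty; rewrite cabs_real ltW // H1 //; exact: le_lt_trans ty yd1.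
move: K => /(_ p2); rewrite (_ : _ - _ = mkC (u (mkC x y) - u (mkC x y0) - (y - y0) * u' (mkC x y0)) 0) ?cabs_real //.
by apply: cplx_ext; rewrite ?ReD ?ImD ?ReN ?ImN /=; ring.
Qed.

Lemma hint_cont u y0 (d : R) : 0 < d -> (forall y, `|y - y0| < d -> line_cont u y) ->
  {for y0, continuous (hint u)}.
Proof.
move=> d0 cu; apply/contRR => e e0; have e20 : 0 < e / 2 by rewrite divr_gt0.
have y0d : `|y0 - y0| < d by rewrite subrr normr0.
have [d1 d10 H1] := tube (a := - (1 / 2)) (b := 1 / 2) (fun x _ => cu _ y0d x) e20.
exists (Num.min d d1); first by rewrite lt_min d0.
move=> y; rewrite lt_min => /andP[yd yd1].
have c1 := line_cont_line (cu _ yd); have c2 := line_cont_line (cu _ y0d).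
rewrite /hint -lintB //; apply: le_lt_trans (lint_abs (g := fun _ => e / 2) half_le _ _ _) _.
- by move=> x; exact: contB (c1 x) (c2 x).
- by move=> x; exact: cont_cst.
- by move=> x xab; rewrite ltW // H1.
- by rewrite lint_cst; lra.
Qed.

End HorizontalIntegral.

(** * The kernel [2 e / (x^2 + e^2)] and a logarithmic bound *)

Section PoissonKernel.
Context {R : realType}.
Implicit Types (x e : R).

Lemma sqrD_gt0 x e : 0 < e -> 0 < x ^+ 2 + e ^+ 2.
Proof. by move=> e0; apply: ltr_wpDl; rewrite ?sqr_ge0 // exprn_gt0. Qed.

Lemma poisson_cont e : 0 < e -> continuous (fun x : R => 2 * e / (x ^+ 2 + e ^+ 2)).
Proof.
move=> e0; suff H (x : R) : {for x, continuous (fun x : R => 2 * e / (x ^+ 2 + e ^+ 2))} by move=> x; exact: H.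
apply: contM; first exact: cont_cst.
apply: continuousV; first by rewrite gt_eqF ?sqrD_gt0.
apply: contD; last exact: cont_cst.
exact: (contM (@cont_id R x) (@cont_id R x)).
Qed.

Lemma lint_poisson e : 0 < e ->
  lint (- (1 / 2)) (1 / 2) (fun x : R => 2 * e / (x ^+ 2 + e ^+ 2)) = 4 * atan (1 / 2 * e^-1).
Proof.
move=> e0; have e0' : e != 0 by rewrite gt_eqF.
rewrite (lintE (G := fun x => 2 * atan (x * e^-1))).
  by rewrite mulNr atanN; ring.
move=> x; have hid : has_deriv (fun y : R => y * e^-1) x e^-1.
  by apply: has_deriv_eq (has_derivM (has_deriv_id x) (has_deriv_cst e^-1 x)) _; ring.
have ha y : has_deriv (@atan R) y (1 + y ^+ 2)^-1 by apply/has_deriv_is_derive; exact: is_derive1_atan.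
apply: has_deriv_eq (has_derivZ 2 (has_deriv_comp hid (ha _))) _.
have q0 : x ^+ 2 + e ^+ 2 != 0 by rewrite gt_eqF ?sqrD_gt0.
by field; rewrite e0' q0.
Qed.

(** As the height tends to 0 the mass of the kernel tends to [2 pi]; each side of the real axis
    contributes one such mass to the jump of the flux. *)
Lemma poisson_mass e : 0 < e -> exists2 d : R, 0 < d & forall t, 0 < t -> t < d ->
  `|4 * atan (1 / 2 * t^-1) - 2 * pi| <= e.
Proof.
move=> e0; have e40 : 0 < e / 4 by rewrite divr_gt0.
have /cvgrPdist_lt /(_ _ e40) [M [_ HM]] := @cvgy_atan R.
pose M' := Num.max M 1; have M'0 : 0 < M' by rewrite lt_max ltr01 orbT.
exists (1 / 2 / M'); first by rewrite !divr_gt0.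
move=> t t0; rewrite ltr_pdivlMr // => tM.
have h : M < 1 / 2 * t^-1.
  apply: le_lt_trans (_ : M' < _); first by rewrite le_max lexx.
  by rewrite ltr_pdivlMr // mulrC.
have {HM} /ltW := HM _ h.
have -> : 4 * atan (1 / 2 * t^-1) - 2 * pi = - 4 * (pi / 2 - atan (1 / 2 * t^-1)) by field.
by rewrite normrM normrN (ger0_norm (ler0n R 4)); lra.
Qed.

(** Writing the height as [s ^+ 2] turns the crude inequality [ln x <= x], applied to the inverse of
    [s], into a bound that still vanishes with [s]. *)
Lemma ln_sqr_bound x (s : R) : `|x| <= 1 / 2 -> 0 < s -> s <= 1 / 2 ->
  s ^+ 2 * `|ln (x ^+ 2 + (s ^+ 2) ^+ 2)| <= 4 * s.
Proof.
move=> x1 s0 s1.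
have s20 : 0 < s ^+ 2 by rewrite exprn_gt0.
have u0 := sqrD_gt0 x s20.
have s4 : (s ^+ 2) ^+ 2 <= x ^+ 2 + (s ^+ 2) ^+ 2 by rewrite lerDr sqr_ge0.
have u1 : x ^+ 2 + (s ^+ 2) ^+ 2 <= 1.
  have : x ^+ 2 <= 1 / 4 by rewrite -real_normK ?num_real //; have := normr_ge0 x; nra.
  have : s ^+ 2 <= 1 / 4 by nra.
  by move: (s ^+ 2) s20 => y *; nra.
rewrite ler0_norm ?ln_le0 //.
have h : ln ((s ^+ 2) ^+ 2) <= ln (x ^+ 2 + (s ^+ 2) ^+ 2) by rewrite ler_ln ?posrE ?exprn_gt0.
have e4 : ln ((s ^+ 2) ^+ 2) = - (4 * ln s^-1).
  by rewrite -exprM lnXn // lnV ?posrE // mulrN opprK mulr_natl.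
have h2 : ln s^-1 <= s^-1.
  have := @le_ln1Dx R (s^-1 - 1); rewrite [1 + _]addrC subrK => H.
  have si : 0 < s^-1 by rewrite invr_gt0.
  by apply: le_trans (H _) _; lra.
have h3 : - ln (x ^+ 2 + (s ^+ 2) ^+ 2) <= 4 * s^-1 by lra.
apply: le_trans (ler_wpM2l (ltW s20) h3) _.
by rewrite mulrCA expr2 -mulrA divff ?mulr1 // gt_eqF.
Qed.

End PoissonKernel.

(** * The flux across the real axis *)

Section BoundaryTerm.
Context {R : realType}.
Local Notation C := (cplx R).
Local Notation Re := complex.Re.
Local Notation Im := complex.Im.
Variable tau : C.
Hypothesis tau_gt0 : 0 < Im tau.
Implicit Types (u h : C -> R) (z w : C).

Definition log_density z : R := ln (torus_density tau z).
Local Notation v := log_density.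

(** The [y] component of the field [v grad h - h grad v] of Green's second identity. *)
Definition green_flux h z : R := v z * dy h z - h z * dy v z.

Lemma strip_off_lattice z : 0 < `|Im z| < Im tau -> ~ lattice tau z.
Proof.
move=> /andP[h1 h2] /latticeP [[m n] E]; move: h1 h2; rewrite E Im_lat /= normrM (gtr0_norm tau_gt0).
rewrite gtr_pMl // -intr_norm -[1]/(1%:~R) ltr_int => h1 h2; have n0 : n = 0 by lia.
by move: h1; rewrite n0 normr0 mul0r ltxx.
Qed.

Lemma log_density_C k : Ck k (~` lattice tau) v.
Proof. exact: Ck_ln_torus_density. Qed.

Lemma green_flux_cont h z : (forall k, Ck k setT h) -> ~ lattice tau z -> {for z, continuous (green_flux h)}.
Proof.
move=> kh zL; apply: contB; apply: contM.
- exact: Ck_cont (log_density_C 0) zL.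
- exact: Ck_cont (Ck_dy (kh 1%N)) I.
- exact: Ck_cont (kh 0%N) I.
- exact: Ck_cont (Ck_dy (log_density_C 1)) zL.
Qed.

(** The bookkeeping of [flux_jump], with [X] and [Y] the fluxes below and above the axis and [a] the
    arctangent in the kernel mass. The terms in [e1], the term [K * s] and the missing kernel mass
    cost at most [e / 4] each. *)
Let jump_estimate (X Y a h0 B e e1 K s : R) : 0 < e -> 0 <= B -> `|h0| <= B -> 0 <= K -> 0 <= e1 ->
  (4 * pi + 4) * e1 = e / 4 -> s <= e / 4 / (K + 1) -> a < pi / 2 ->
  `|4 * a - 2 * pi| <= e / 4 / (2 * B + 1) ->
  `|X - Y - 2 * h0 * (4 * a)| <= 2 * e1 * (4 * a) + (K * s + 2 * e1) * (1 / 2 - - (1 / 2)) ->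
  `|X - Y - 4 * pi * h0| <= e.
Proof.
move=> e0 B0 h0B K0 e10 e1E sK a1 H main.
have -> : X - Y - 4 * pi * h0 = (X - Y - 2 * h0 * (4 * a)) + 2 * h0 * (4 * a - 2 * pi) by ring.
apply: le_trans (ler_normD _ _) _; rewrite [`|2 * h0 * _|]normrM normrM (ger0_norm (ler0n R 2)).
have m1 : 2 * `|h0| * `|4 * a - 2 * pi| <= (2 * B + 1) * (e / 4 / (2 * B + 1)).
  by apply: ler_pM; rewrite ?mulr_ge0 //; lra.
have E1 : (2 * B + 1) * (e / 4 / (2 * B + 1)) = e / 4 by field; rewrite gt_eqF //; lra.
have m2 : K * s <= e / 4.
  have h : K * (e / 4 / (K + 1)) <= (K + 1) * (e / 4 / (K + 1)).
    by apply: ler_wpM2r; [rewrite !divr_ge0 //; lra|lra].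
  have E : (K + 1) * (e / 4 / (K + 1)) = e / 4 by field; rewrite gt_eqF //; lra.
  have h' := ler_wpM2l K0 sK; lra.
have m3 : e1 * (4 * a) <= e1 * (2 * pi) by apply: ler_wpM2l => //; lra.
lra.
Qed.

(* Near the origin [v = ln |z|^2 + smooth], so the flux through the two sides
   of the real axis differs by a Poisson kernel up to a vanishing error. *)
Lemma flux_jump h (e : R) : (forall k, Ck k setT h) -> 0 < e ->
  exists2 d : R, 0 < d & forall s : R, 0 < s -> s < d ->
    `|hint (green_flux h) (- s ^+ 2) - hint (green_flux h) (s ^+ 2) - 4 * pi * h 0| <= e.
Proof.
move=> kh e0.
have [r [kr r0 rE]] := torus_density_local tau_gt0.
have ch : continuous h by move=> z; exact: Ck_cont (kh 0%N) I.
have chyy : continuous (dy (dy h)) by move=> z; exact: Ck_cont (Ck_dy (Ck_dy (kh 2%N))) I.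
(* The flux belonging to the smooth summand [ln (r z)] of [v], continuous across the axis. *)
pose q z := ln (r z) * dy h z - h z * (dy r z * (r z)^-1).
have cq z : central_cell tau z -> {for z, continuous q}.
  move=> zV; apply: contB; apply: contM.
  - exact: contcomp (Ck_cont (kr 0%N) zV) (continuous_ln (r0 z zV)).
  - exact: Ck_cont (Ck_dy (kh 1%N)) I.
  - exact: ch.
  - apply: contM; first exact: Ck_cont (Ck_dy (kr 1%N)) zV.
    by apply: continuousV; [rewrite gt_eqF ?r0|exact: Ck_cont (kr 0%N) zV].
have fluxE (x y : R) : `|x| < 1 -> 0 < `|y| < Im tau ->
    green_flux h (mkC x y) = ln (x ^+ 2 + y ^+ 2) * dy h (mkC x y) + q (mkC x y)
      - 2 * y / (x ^+ 2 + y ^+ 2) * h (mkC x y).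
  move=> x1 /andP[y0 y1]; set z := mkC x y.
  have zV : central_cell tau z by [].
  have u0 : 0 < x ^+ 2 + y ^+ 2.
    by apply: ltr_wpDl; rewrite ?sqr_ge0 // -real_normK ?num_real // exprn_gt0.
  have rz := r0 z zV.
  have hu : has_dy (fun w => Re w ^+ 2 + Im w ^+ 2) z (2 * y).
    rewrite /has_dy /=; apply: has_deriv_eq (has_derivD (has_deriv_cst _ _) (has_derivM (has_deriv_id _) (has_deriv_id _))) _.
    by rewrite /=; ring.
  have hv : has_dy v z (2 * y / (x ^+ 2 + y ^+ 2) + dy r z / r z).
    have Ez : torus_density tau z = (x ^+ 2 + y ^+ 2) * r z by rewrite rE.
    have hE : has_dy (torus_density tau) z (2 * y * r z + (x ^+ 2 + y ^+ 2) * dy r z).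
      rewrite (_ : torus_density tau = fun w => (Re w ^+ 2 + Im w ^+ 2) * r w); last by apply/funext.
      exact: has_dyM hu (Ck_has_dy (kr 1%N) zV).
    apply: has_deriv_eq (has_dy_ln _ hE) _; rewrite Ez ?mulr_gt0 //.
    by move: (dy r z) (r z) rz => a b b0; field; rewrite !gt_eqF.
  rewrite /green_flux (has_dyE hv) /v rE /= lnM ?posrE // /q.
  by move: (ln _) (ln _) (dy h z) (h z) (dy r z / r z) (2 * y / _) => *; ring.
pose A : R := 4 * pi + 4; have pi0 := @pi_gt0 R.
have A0 : 0 < A by rewrite /A; lra.
pose e1 := e / (4 * A); have e10 : 0 < e1 by rewrite divr_gt0 // mulr_gt0.
have e1E : A * e1 = e / 4 by rewrite /e1; field; rewrite gt_eqF.
have cq0 x : - (1 / 2) <= x <= 1 / 2 -> {for mkC x 0, continuous q}.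
  by move=> /andP[x1 x2]; apply: cq; split; rewrite /= ?normr0 // ltr_norml; apply/andP; split; lra.
have [d1 d10 H1] := tube cq0 e10.
have /contCR /(_ _ e10) [d2 d20 H2] := ch 0.
have [M M0 HM] := disc_bounded 2 chyy.
have [B B0 HB] := disc_bounded 2 ch.
have h00 : `|h 0| <= B by apply: HB; rewrite cabs0.
have e20 : 0 < e / 4 / (2 * B + 1) by rewrite !divr_gt0 //; lra.
have [d3 d30 H3] := poisson_mass e20.
(* The first summand bounds the logarithmic term, the second the kernel at distance at least
   [d2 / 2] from the origin. *)
pose K := 8 * M + 32 * B / d2 ^+ 2; have K0 : 0 <= K.
  by apply: addr_ge0; [apply: mulr_ge0|apply: divr_ge0; [apply: mulr_ge0|exact: sqr_ge0]].
have e30 : 0 < e / 4 / (K + 1) by rewrite !divr_gt0 //; lra.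
exists (Num.min (Num.min (1 / 2) (Im tau)) (Num.min (Num.min d1 d3) (Num.min (d2 / 2) (e / 4 / (K + 1))))).
  by rewrite !lt_min tau_gt0 d10 d30 e30 divr_gt0 //= andbT; lra.
move=> s s0; rewrite !lt_min => /andP[/andP[s1 sT] /andP[/andP[sd1 sd3] /andP[sd2 sK]]].
pose t := s ^+ 2; have t0 : 0 < t by rewrite exprn_gt0.
have ts : t < s by rewrite /t expr2 gtr_pMl //; lra.
rewrite -/t.
pose k x := 2 * t / (x ^+ 2 + t ^+ 2).
have k0 x : 0 <= k x by rewrite divr_ge0 ?mulr_ge0 ?ltW ?sqrD_gt0.
have ck : continuous k := poisson_cont t0.
have lc y : `|y| = t -> line_cont (green_flux h) y.
  by move=> yt x; apply: green_flux_cont => //; apply: strip_off_lattice; rewrite /= yt t0 (lt_trans ts).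
have c1 := line_cont_line (lc (- t) _); have c2 := line_cont_line (lc t _).
have {}c1 := c1 (etrans (normrN t) (gtr0_norm t0)); have {}c2 := c2 (gtr0_norm t0).
have c12 : continuous (fun x => green_flux h (mkC x (- t)) - green_flux h (mkC x t)) by move=> x; exact: contB (c1 x) (c2 x).
have ck2 : continuous (fun x => 2 * h 0 * k x) by move=> x; exact: (@contM R R (fun _ => 2 * h 0) k x (@cont_cst R R _ x) (ck x)).
pose bnd x := 2 * e1 * k x + (K * s + 2 * e1).
have cb : continuous bnd.
  have H (x : R) : {for x, continuous bnd}.
    by apply: contD; [exact: (contM (@cont_cst R R (2 * e1) x) (ck x))|exact: cont_cst].
  by move=> x; exact: H.
have half_le : - (1 / 2) <= 1 / 2 :> R by lra.
have main : `|lint (- (1 / 2)) (1 / 2) (fun x => green_flux h (mkC x (- t)) - green_flux h (mkC x t) - 2 * h 0 * k x)| <= lint (- (1 / 2)) (1 / 2) bnd.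
  apply: lint_abs => //; first by move=> x; exact: contB (c12 x) (ck2 x).
  move=> x xab; have x12 : `|x| <= 1 / 2 by rewrite ler_norml.
  have x1 : `|x| < 1 by lra.
  have tT : t < Im tau by lra.
  rewrite !fluxE // ?normrN ?(gtr0_norm t0) ?t0 // sqrrN.
  (* The logarithm is even in the height, so in the difference it multiplies this small quantity. *)
  have bound3 : `|dy h (mkC x (- t)) - dy h (mkC x t)| <= M * (2 * t).
    have := @path_mvt R (fun y => mkC (dy h (mkC x y)) 0) (fun y => mkC (dy (dy h) (mkC x y)) 0) (- t) t M.
    have -> : t - - t = 2 * t by ring.
    have -> : mkC (dy h (mkC x t)) 0 - mkC (dy h (mkC x (- t))) 0 = mkC (dy h (mkC x t) - dy h (mkC x (- t))) 0.
      by apply: cplx_ext; rewrite ?ReD ?ImD ?ReN ?ImN /= ?subrr.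
    rewrite cabs_real distrC; apply; first by lra.
    - by move=> y _; split=> /=; [exact: (Ck_has_dy (Ck_dy (kh 2%N)) (I : setT (mkC x y)))|exact: has_deriv_cst].
    - move=> y /andP[y1 y2]; rewrite cabs_real; apply: HM; apply: le_trans (cabs_le_ReIm _) _ => /=.
      have : `|y| <= t by rewrite ler_norml y1.
      lra.
  have bL := ln_sqr_bound x12 s0 (ltW s1).
  have bq : `|q (mkC x (- t)) - q (mkC x t)| <= 2 * e1.
    have b1 := H1 x (- t) xab; have b2 := H1 x t xab; rewrite subr0 normrN (gtr0_norm t0) in b1.
    rewrite subr0 (gtr0_norm t0) in b2.
    have td1 : t < d1 by lra.
    have -> : q (mkC x (- t)) - q (mkC x t) = (q (mkC x (- t)) - q (mkC x 0)) - (q (mkC x t) - q (mkC x 0)) by ring.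
    apply: le_trans (ler_normB _ _) _.
    by have := b1 td1; have := b2 td1; lra.
  (* Near the origin [h] is within [e1] of [h 0]; away from it the kernel itself is small. *)
  have bh : `|k x * (h (mkC x (- t)) + h (mkC x t) - 2 * h 0)| <= 2 * e1 * k x + 32 * B / d2 ^+ 2 * s.
    rewrite normrM (ger0_norm (k0 x)).
    have B2 : 0 <= 32 * B / d2 ^+ 2 * s.
      by apply: mulr_ge0; [apply: divr_ge0; [apply: mulr_ge0|exact: sqr_ge0]|exact: ltW].
    case: (ltP `|x| (d2 / 2)) => xd.
      have near0 y : `|y| = t -> `|h (mkC x y) - h 0| < e1.
        move=> yt; apply: H2; rewrite subr0; apply: le_lt_trans (cabs_le_ReIm _) _ => /=.
        by rewrite yt; lra.
      have b1 := near0 (- t) (etrans (normrN t) (gtr0_norm t0)); have b2 := near0 t (gtr0_norm t0).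
      have b : `|h (mkC x (- t)) + h (mkC x t) - 2 * h 0| <= 2 * e1.
        have -> : h (mkC x (- t)) + h (mkC x t) - 2 * h 0 = (h (mkC x (- t)) - h 0) + (h (mkC x t) - h 0) by ring.
        by apply: le_trans (ler_normD _ _) _; lra.
      have := ler_wpM2l (k0 x) b; rewrite [k x * (2 * e1)]mulrC; lra.
    have bd y : `|y| = t -> `|h (mkC x y)| <= B.
      by move=> yt; apply: HB; apply: le_trans (cabs_le_ReIm _) _; rewrite /= yt; lra.
    have b : `|h (mkC x (- t)) + h (mkC x t) - 2 * h 0| <= 4 * B.
      have b1 := bd (- t) (etrans (normrN t) (gtr0_norm t0)); have b2 := bd t (gtr0_norm t0).
      apply: le_trans (ler_normB _ _) _; rewrite normrM (ger0_norm (ler0n R 2)).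
      by have := ler_normD (h (mkC x (- t))) (h (mkC x t)); lra.
    have kx : k x <= 8 * s / d2 ^+ 2.
      have d22 : 0 < d2 ^+ 2 by rewrite exprn_gt0.
      rewrite /k ler_pdivrMr ?sqrD_gt0 // mulrAC ler_pdivlMr //.
      have xx : d2 ^+ 2 / 4 <= x ^+ 2.
        by rewrite -[x ^+ 2]real_normK ?num_real // (_ : d2 ^+ 2 / 4 = (d2 / 2) ^+ 2); [rewrite lerXn2r ?nnegrE ?divr_ge0 // ltW|field].
      have tt := sqr_ge0 t; have : t * d2 ^+ 2 <= s * d2 ^+ 2 by rewrite ler_pM2r // ltW.
      have : s * (d2 ^+ 2 / 4) <= s * (x ^+ 2 + t ^+ 2) by rewrite ler_pM2l //; lra.
      by move: (d2 ^+ 2) (x ^+ 2) (t ^+ 2) => a b' c; lra.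
    apply: le_trans (_ : 32 * B / d2 ^+ 2 * s <= _); last by rewrite lerDr mulr_ge0 // mulr_ge0 // ltW.
    apply: le_trans (ler_pM (k0 x) (normr_ge0 _) kx b) _.
    by rewrite (_ : 8 * s / d2 ^+ 2 * (4 * B) = 32 * B / d2 ^+ 2 * s) //; move: (_^-1) => y; ring.
  have -> : forall L a1 a2 q1 q2 h1 h2 : R, L * a1 + q1 - 2 * - t / (x ^+ 2 + t ^+ 2) * h1 -
      (L * a2 + q2 - 2 * t / (x ^+ 2 + t ^+ 2) * h2) - 2 * h 0 * k x =
      L * (a1 - a2) + (q1 - q2) + k x * (h1 + h2 - 2 * h 0).
    by rewrite /k; move: ((x ^+ 2 + t ^+ 2)^-1) => y *; ring.
  apply: le_trans (ler_normD _ _) _; rewrite /bnd /K.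
  apply: le_trans (lerD (ler_normD _ _) bh) _; rewrite normrM.
  have b4 := ler_wpM2l (normr_ge0 (ln (x ^+ 2 + t ^+ 2))) bound3.
  have b5 := ler_wpM2l M0 bL.
  have b6 : `|ln (x ^+ 2 + t ^+ 2)| * (M * (2 * t)) <= 8 * M * s by move: b5; rewrite -/t; lra.
  rewrite mulrDl; lra.
move: main; rewrite (lintB _ _ c12 ck2) (lintB _ _ c1 c2) (lintZ _ _ _ ck).
have ck1 : continuous (fun x => 2 * e1 * k x).
  by move=> x; exact: (@contM R R (fun _ => 2 * e1) k x (@cont_cst R R _ x) (ck x)).
have cc : continuous (fun _ : R => K * s + 2 * e1) by move=> x; exact: cont_cst.
rewrite /bnd (lintD _ _ ck1 cc).
have lk : lint (- (1 / 2)) (1 / 2) k = 4 * atan (1 / 2 * t^-1) := lint_poisson t0.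
rewrite (lintZ _ _ _ ck) lint_cst lk {lk}.
have Hpi := H3 t t0 (lt_trans ts sd3); have api := atan_ltpi2 (1 / 2 * t^-1).
move=> main; exact: (jump_estimate e0 B0 h00 K0 (ltW e10) e1E (ltW sK) api Hpi main).
Qed.

End BoundaryTerm.

(** * Derivatives of periodic functions *)

Section PeriodicDerivatives.
Context {R : realType}.
Local Notation C := (cplx R).
Local Notation Re := complex.Re.
Local Notation Im := complex.Im.
Implicit Types (u : C -> R) (z w : C).

Lemma derive1_translate (f : R -> R) (c x : R) : derive1 (fun t => f (t - c)) (x + c) = derive1 f x.
Proof.
rewrite /derive1.
suff -> : (fun k : R => k^-1 *: (f (k + (x + c) - c) - f (x + c - c))) = (fun k => k^-1 *: (f (k + x) - f x)) by [].
by apply/funext => k; rewrite addrA !addrK.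
Qed.

Lemma dx_periodic u w : (forall z, u (z + w) = u z) -> forall z, dx u (z + w) = dx u z.
Proof.
move=> per z; rewrite /dx -(derive1_translate (fun t => u (mkC t (Im z))) (Re w)) ReD ImD.
suff -> : (fun t => u (mkC t (Im z + Im w))) = (fun t => u (mkC (t - Re w) (Im z))) by [].
by apply/funext => t; rewrite -[RHS]per; congr u; apply: cplx_ext; rewrite ?ReD ?ImD /= ?subrK.
Qed.

Lemma dy_periodic u w : (forall z, u (z + w) = u z) -> forall z, dy u (z + w) = dy u z.
Proof.
move=> per z; rewrite /dy -(derive1_translate (fun t => u (mkC (Re z) t)) (Im w)) ReD ImD.
suff -> : (fun t => u (mkC (Re z + Re w) t)) = (fun t => u (mkC (Re z) (t - Im w))) by [].
by apply/funext => t; rewrite -[RHS]per; congr u; apply: cplx_ext; rewrite ?ReD ?ImD /= ?subrK.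
Qed.

Lemma laplacian_periodic u w : (forall z, u (z + w) = u z) -> forall z, laplacian u (z + w) = laplacian u z.
Proof.
by move=> per z; rewrite /laplacian (dx_periodic (dx_periodic per)) (dy_periodic (dy_periodic per)).
Qed.

End PeriodicDerivatives.

(** * Green's identity in horizontal slices *)

Section GreenIdentity.
Context {R : realType}.
Local Notation C := (cplx R).
Local Notation Re := complex.Re.
Local Notation Im := complex.Im.
Local Notation mu := (@lebesgue_measure R).
Variable tau : C.
Hypothesis tau_gt0 : 0 < Im tau.
Local Notation v := (log_density tau).
Variable h : C -> R.
Hypothesis kh : forall k, Ck k setT h.
Hypothesis per_h : forall z w, lattice tau w -> h (z + w) = h z.
Implicit Types (z w : C) (x y : R).

Definition weak_integrand z : R := v z * laplacian h z + expR (v z) * h z.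

Let kv k := log_density_C tau_gt0 k.

Lemma log_density_periodic z w : lattice tau w -> v (z + w) = v z.
Proof. by move=> wL; rewrite /log_density torus_density_periodic. Qed.

Lemma weak_integrand_periodic z w : lattice tau w -> weak_integrand (z + w) = weak_integrand z.
Proof.
move=> wL; rewrite /weak_integrand (log_density_periodic _ wL) (per_h _ wL).
by rewrite (laplacian_periodic (fun z => per_h z wL)).
Qed.

Lemma green_flux_periodic z w : lattice tau w -> green_flux tau h (z + w) = green_flux tau h z.
Proof.
move=> wL; rewrite /green_flux (log_density_periodic _ wL) (per_h _ wL).
by rewrite (dy_periodic (fun z => per_h z wL)) (dy_periodic (fun z => log_density_periodic z wL)).
Qed.

Lemma laplacian_log_density z : ~ lattice tau z -> laplacian v z = - expR (v z).
Proof.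
move=> zL; rewrite laplacian_ln_torus_density // /log_density lnK // posrE.
exact: torus_density_gt0.
Qed.

(** The equation for [v] off the lattice replaces [expR (v z)] by [- laplacian v z]; what results
    separates into an [x] and a [y] part of Green's identity. *)
Let weak_integrandE z : ~ lattice tau z ->
  weak_integrand z = (v z * dx (dx h) z - h z * dx (dx v) z) + (v z * dy (dy h) z - h z * dy (dy v) z).
Proof.
move=> zL; rewrite /weak_integrand -[expR _]opprK -laplacian_log_density // /laplacian.
by move: (v z) (h z) (dx (dx h) z) (dy (dy h) z) (dx (dx v) z) (dy (dy v) z) => *; ring.
Qed.

Let strip x y : 0 < `|y| < Im tau -> ~ lattice tau (mkC x y).
Proof. by move=> H; exact: strip_off_lattice. Qed.

Let flux_xx z : R := v z * dx (dx h) z - h z * dx (dx v) z.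
Let flux_yy z : R := v z * dy (dy h) z - h z * dy (dy v) z.

Let flux_xx_cont z : ~ lattice tau z -> {for z, continuous flux_xx}.
Proof.
move=> zL; apply: contB; apply: contM.
- exact: Ck_cont (kv 0) zL.
- exact: Ck_cont (Ck_dx (Ck_dx (kh 2%N))) I.
- exact: Ck_cont (kh 0%N) I.
- exact: Ck_cont (Ck_dx (Ck_dx (kv 2))) zL.
Qed.

Let flux_yy_cont z : ~ lattice tau z -> {for z, continuous flux_yy}.
Proof.
move=> zL; apply: contB; apply: contM.
- exact: Ck_cont (kv 0) zL.
- exact: Ck_cont (Ck_dy (Ck_dy (kh 2%N))) I.
- exact: Ck_cont (kh 0%N) I.
- exact: Ck_cont (Ck_dy (Ck_dy (kv 2))) zL.
Qed.

Lemma weak_integrand_cont z : ~ lattice tau z -> {for z, continuous weak_integrand}.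
Proof.
move=> zL; apply: contD; apply: contM.
- exact: Ck_cont (kv 0) zL.
- apply: contD; first exact: Ck_cont (Ck_dx (Ck_dx (kh 2%N))) I.
  exact: Ck_cont (Ck_dy (Ck_dy (kh 2%N))) I.
- by apply: contcomp (Ck_cont (kv 0) zL) _; exact: continuous_expR.
- exact: Ck_cont (kh 0%N) I.
Qed.

Let line_off y u : (forall z, ~ lattice tau z -> {for z, continuous u}) -> 0 < `|y| < Im tau -> @line_cont R u y.
Proof. by move=> H hy x; apply: H; exact: strip. Qed.

Lemma weak_integrand_line y : 0 < `|y| < Im tau -> line_cont weak_integrand y.
Proof. by apply: line_off => z; exact: weak_integrand_cont. Qed.

(** An [x] derivative of a function of period 1, integrated over a period. *)
Let hint_xx y : 0 < `|y| < Im tau -> hint flux_xx y = 0.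
Proof.
move=> hy; rewrite /hint.
rewrite (lintE (G := fun x => v (mkC x y) * dx h (mkC x y) - h (mkC x y) * dx v (mkC x y))) => [|x].
  have -> : mkC (1 / 2) y = mkC (- (1 / 2)) y + 1.
    by apply: cplx_ext; rewrite ?ReD ?ImD /= ?addr0 //; lra.
  rewrite (dx_periodic (fun z => log_density_periodic z (lattice1 tau))) (dx_periodic (fun z => per_h z (lattice1 tau))).
  by rewrite (log_density_periodic _ (lattice1 tau)) (per_h _ (lattice1 tau)) subrr.
have zL : ~ lattice tau (mkC x y) := strip hy.
have hv := Ck_has_dx (kv 1) zL; have hvx := Ck_has_dx (Ck_dx (kv 2)) zL.
have hh := Ck_has_dx (kh 1%N) (I : setT (mkC x y)); have hhx := Ck_has_dx (Ck_dx (kh 2%N)) (I : setT (mkC x y)).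
apply: has_deriv_eq (has_derivB (has_derivM hv hhx) (has_derivM hh hvx)) _.
rewrite /flux_xx /=; set z := mkC x y.
by move: (v z) (h z) (dx v z) (dx h z) (dx (dx v) z) (dx (dx h) z) => *; ring.
Qed.

Lemma hint_flux_deriv y : 0 < y < Im tau -> has_deriv (hint (green_flux tau h)) y (hint weak_integrand y).
Proof.
move=> /andP[y0 y1].
have hy : 0 < `|y| < Im tau by rewrite gtr0_norm ?y0.
have E : hint weak_integrand y = hint flux_yy y.
  have E1 : hint weak_integrand y = hint flux_xx y + hint flux_yy y.
    rewrite /hint -lintD; last 2 first.
    - by apply: line_cont_line; exact: line_off flux_xx_cont hy.
    - by apply: line_cont_line; exact: line_off flux_yy_cont hy.
    by congr lint; apply/funext => x; rewrite weak_integrandE //; exact: strip.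
  exact: etrans E1 (etrans (congr1 (fun c => c + hint flux_yy y) (hint_xx hy)) (add0r _)).
apply: has_deriv_eq _ (esym E).
have d0 : 0 < Num.min y (Im tau - y) by rewrite lt_min y0 subr_gt0.
have dy' t : `|t - y| < Num.min y (Im tau - y) -> 0 < `|t| < Im tau.
  rewrite lt_min !ltr_norml => /andP[/andP[a b] /andP[c d]].
  have t0 : 0 < t by lra.
  by rewrite gtr0_norm // t0; lra.
apply: (hint_deriv d0) => [t /dy' ht|x t /dy' ht].
  split; [apply: line_off ht => z zL|exact: line_off flux_yy_cont ht].
  exact: green_flux_cont.
have zL : ~ lattice tau (mkC x t) := strip ht.
have hv := Ck_has_dy (kv 1) zL; have hvy := Ck_has_dy (Ck_dy (kv 2)) zL.
have hh := Ck_has_dy (kh 1%N) (I : setT (mkC x t)); have hhy := Ck_has_dy (Ck_dy (kh 2%N)) (I : setT (mkC x t)).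
apply: has_deriv_eq (has_derivB (has_dyM hv hhy) (has_dyM hh hvy)) _.
rewrite /flux_yy; set z := mkC x t.
by move: (v z) (h z) (dy v z) (dy h z) (dy (dy v) z) (dy (dy h) z) => *; ring.
Qed.

(** Translation by [tau] also moves the segment horizontally by [Re tau], which periodicity in [x]
    undoes. *)
Lemma hint_shift (u : C -> R) y : (forall z w, lattice tau w -> u (z + w) = u z) -> line_cont u y ->
  hint u (y + Im tau) = hint u y.
Proof.
move=> per cu; have cl := line_cont_line cu.
have p1 x : u (mkC (x + 1) y) = u (mkC x y).
  by rewrite -[RHS](per _ _ (lattice1 tau)); congr u; apply: cplx_ext; rewrite ?ReD ?ImD /= ?addr0.
have E : hint u (y + Im tau) = lint (- (1 / 2)) (1 / 2) (fun x => u (mkC (x + - Re tau) y)).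
  congr lint; apply/funext => x; rewrite -[RHS](per _ _ (lattice_tau tau)); congr u.
  by apply: cplx_ext; rewrite ?ReD ?ImD /= ?subrK.
have := @lint_periodic R (fun x => u (mkC x y)) (- (1 / 2) + - Re tau) (- (1 / 2)) cl p1.
have -> : - (1 / 2) + - Re tau + 1 = 1 / 2 + - Re tau by field.
have -> : - (1 / 2) + 1 = 1 / 2 :> R by field.
by rewrite E (@lint_shift R (fun x => u (mkC x y)) _ _ _ cl).
Qed.

Lemma hint_weak_cont y : 0 < y < Im tau -> {for y, continuous (hint weak_integrand)}.
Proof.
move=> /andP[y0 y1].
have d0 : 0 < Num.min y (Im tau - y) by rewrite lt_min y0 subr_gt0.
apply: (hint_cont d0) => t; rewrite lt_min !ltr_norml => /andP[/andP[a b] /andP[c d]].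
apply: weak_integrand_line; have t0 : 0 < t by lra.
by rewrite gtr0_norm // t0; lra.
Qed.

(** By periodicity the flux at the upper end [Im tau - t] is the flux at [- t], so the two ends of
    the strip become the two sides of the real axis. *)
Lemma hint_weak_FTC (t : R) : 0 < t -> t < Im tau / 2 ->
  (\int[mu]_(y in `[t, (Im tau - t)%R]) (hint weak_integrand y)%:E =
   (hint (green_flux tau h) (- t) - hint (green_flux tau h) t)%R%:E)%E.
Proof.
move=> t0 t1; have T0 := tau_gt0.
rewrite (lint_FTC (G := hint (green_flux tau h))) => [|x /andP[a b]||]; last 3 first.
- by apply: hint_flux_deriv; apply/andP; split; lra.
- by lra.
- apply: continuous_in_subspaceT => x; rewrite inE /= in_itv /= => /andP[a b].
  by apply: hint_weak_cont; apply/andP; split; lra.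
have lc : line_cont (green_flux tau h) (- t).
  move=> x; apply: green_flux_cont => //; apply: strip.
  by rewrite normrN gtr0_norm // t0; lra.
have E := hint_shift green_flux_periodic lc; rewrite addrC in E.
exact: (congr1 (fun c => (c - hint (green_flux tau h) t)%R%:E) E).
Qed.

End GreenIdentity.

(** * Measurability of continuous functions on the plane *)

Section PlaneMeasurability.
Context {R : realType}.
Local Notation C := (cplx R).
Implicit Types (u : C -> R) (x y a : R).

(** Freezes the first coordinate on cells of width [1 / a]. Preimages are then countable unions of
    rectangles, and [u] is the pointwise limit for growing [a]. *)
Let step u a (p : R * R) : R := u (mkC ((Num.floor (a * p.1))%:~R / a) p.2).

Let measurable_step u a : 0 < a -> continuous u -> measurable_fun [set: R * R] (step u a).
Proof.
move=> a0 cu _ Y mY; rewrite setTI.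
pose F (k : int) : set (R * R) :=
  `[k%:~R / a, (k + 1)%:~R / a[ `*` ((fun y => u (mkC (k%:~R / a) y)) @^-1` Y).
have -> : step u a @^-1` Y = \bigcup_k F k.
  have cell x (k : int) : (k%:~R / a <= x < (k + 1)%:~R / a) = (Num.floor (a * x) == k).
    rewrite ler_pdivrMr // ltr_pdivlMr // [x * a]mulrC; apply/idP/eqP => [h|<-].
      by apply: Num.Theory.floor_def; exact: h.
    exact: Num.Theory.floor_itv.
  apply/seteqP; split => [[x y] /= h|[x y] [k _ [/=]]].
    by exists (Num.floor (a * x)) => //; split=> //=; rewrite in_itv /= cell.
  by rewrite in_itv /= cell /step => /eqP ->.
apply: countable_bigcupT_measurable => [|k]; first exact: countableP.
apply: measurableX; first exact: measurable_itv.
have cy : continuous (fun y => u (mkC (k%:~R / a) y)).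
  by move=> y; exact: (@contcomp R C R u (fun t => mkC (k%:~R / a) t) y (@cont_vertical R _ y) (cu _)).
by rewrite -[_ @^-1` _]setTI; exact: (continuous_measurable_fun cy).
Qed.

Lemma continuous_measurable_plane u : continuous u -> measurable_fun [set: R * R] (fun p => u (mkC p.1 p.2)).
Proof.
move=> cu; apply: (@measurable_fun_cvg _ _ R setT (fun n => step u n.+1%:R)) => [n|[x y] _ /=].
  exact: measurable_step.
apply/cvgrPdist_lt => e e0; have /contCR /(_ _ e0) [d d0 Hd] := cu (mkC x y).
near=> n; rewrite distrC; apply: Hd.
have n0 : 0 < n.+1%:R :> R by rewrite ltr0n.
have -> : mkC ((Num.floor (n.+1%:R * x))%:~R / n.+1%:R) y - mkC x y = mkC ((Num.floor (n.+1%:R * x))%:~R / n.+1%:R - x) 0.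
  by apply: cplx_ext; rewrite ?ReD ?ImD ?ReN ?ImN /= ?subrr.
rewrite cabs_real.
have /andP[h1 h2] := Num.Theory.floor_itv (n.+1%:R * x).
have -> : (Num.floor (n.+1%:R * x))%:~R / n.+1%:R - x = ((Num.floor (n.+1%:R * x))%:~R - n.+1%:R * x) / n.+1%:R.
  by rewrite mulrBl [n.+1%:R * x]mulrC mulfK // gt_eqF.
rewrite normrM [`|_^-1|]gtr0_norm ?invr_gt0 // ltr_pdivrMr //.
have nd : n.+1%:R^-1 < d by near: n; exact: (near_infty_natSinv_lt (PosNum d0)).
have : 1 < d * n.+1%:R by rewrite -ltr_pdivrMr // div1r.
rewrite intrD in h2; rewrite ler0_norm ?subr_le0 //; lra.
Unshelve. all: by end_near.
Qed.

End PlaneMeasurability.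

(** * Fubini's theorem on a sheared strip *)

Section StripIntegral.
Context {R : realType}.
Local Notation mu := (@lebesgue_measure R).
Local Notation mu2 := (@lebesgue2 R).
Variables (T al : R).
Implicit Types (x y : R).

(** With [T = Im tau] and [al = Re tau / Im tau], the period parallelogram without its lower edge;
    each horizontal slice has length 1. *)
Definition strip_set : set (R * R) := [set p | 0 < p.2 < T /\ 0 <= p.1 - al * p.2 < 1].

Let sheared : R * R -> R := fun p => p.1 - al * p.2.

Lemma measurable_sheared : measurable_fun [set: R * R] sheared.
Proof.
apply: measurable_funB; first exact: measurable_fst.
by apply: measurable_funM; [exact: measurable_cst|exact: measurable_snd].
Qed.

Lemma measurable_strip_set : measurable strip_set.
Proof.
have -> : strip_set = (snd @^-1` `]0, T[) `&` (sheared @^-1` `[0, 1[).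
  by apply/seteqP; split => [] [x y]; rewrite /strip_set /sheared /= !in_itv /=.
apply: measurableI.
- by rewrite -[_ @^-1` _]setTI; apply: measurable_snd.
- by rewrite -[_ @^-1` _]setTI; apply: measurable_sheared.
Qed.

Lemma strip_slice (f : R * R -> \bar R) y :
  (\int[mu]_x (f \_ strip_set) (x, y))%E =
  ((fun y => (\int[mu]_(x in `[(al * y)%R, (al * y + 1)%R[) f (x, y))%E) \_ `]0%R, T[) y.
Proof.
rewrite patchE; case: ifPn => [|] yT.
  rewrite [RHS]integral_mkcond; apply: eq_integral => x _; rewrite !patchE.
  have -> // : ((x, y) \in strip_set) = (x \in [set` `[al * y, al * y + 1[]).
  have {}yT : 0 < y < T by move/set_mem: yT; rewrite /= in_itv.
  apply/idP/idP => H; apply: mem_set; move: (set_mem H); rewrite /strip_set /= in_itv /=.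
    by move=> [_]; lra.
  by move=> h; split=> //; lra.
rewrite -[RHS](integral0 mu [set: R]); apply: eq_integral => x _; rewrite patchE.
suff -> : ((x, y) \in strip_set) = false by [].
by apply: contraNF yT => /set_mem [/= h _]; apply: mem_set; rewrite /= in_itv.
Qed.

(** The slices have length 1, so Tonelli's theorem reduces the double integral to the one in [y]. *)
Lemma strip_integrable_snd (ka : R -> R) : measurable_fun [set: R] ka ->
  (forall y, 0 < y < T -> 0 <= ka y) -> (\int[mu]_(y in `]0%R, T[) (ka y)%:E < +oo)%E ->
  mu2.-integrable strip_set (fun p => (ka p.2)%:E).
Proof.
move=> mk k0 fin; rewrite /lebesgue2; apply/(@integrable_mkcond _ _ R (mu \x mu)%E strip_set _ measurable_strip_set).
apply/(integrable21ltyP mu mu).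
  apply/(measurable_restrictT _ measurable_strip_set); apply: measurable_funTS.
  by apply/measurable_EFinP; exact: measurableT_comp mk measurable_snd.
apply: le_lt_trans fin; rewrite [leRHS]integral_mkcond le_eqVlt; apply/orP; left; apply/eqP.
apply: eq_integral => y _.
have -> : (\int[mu]_x `|((fun p : R * R => (ka p.2)%:E) \_ strip_set) (x, y)| =
    \int[mu]_x ((fun p : R * R => `|(ka p.2)%:E|) \_ strip_set) (x, y))%E.
  by apply: eq_integral => x _; rewrite !patchE; case: ifPn => // _; rewrite abse0.
rewrite strip_slice !patchE; case: ifPn => // yT.
have yT' : 0 < y < T by move/set_mem: yT; rewrite /= in_itv.
rewrite /= (eq_integral (fun _ => (ka y)%:E)); last by move=> x _; rewrite ger0_norm // k0.
have m1 : mu `[al * y, al * y + 1[ = 1%E.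
  by rewrite lebesgue_measure_itv /= lte_fin ltrDl ltr01 -EFinD addrAC subrr add0r.
rewrite integral_cst //; exact: etrans (congr1 (mule (ka y)%:E) m1) (mule1 _).
Qed.

Lemma strip_fubini (g : R * R -> R) : mu2.-integrable strip_set (fun p => (g p)%:E) ->
  (\int[mu2]_(p in strip_set) (g p)%:E =
   \int[mu]_(y in `]0%R, T[) \int[mu]_(x in `[(al * y)%R, (al * y + 1)%R[) (g (x, y))%:E)%E.
Proof.
rewrite /lebesgue2 => /(@integrable_mkcond _ _ R (mu \x mu)%E strip_set _ measurable_strip_set) gi.
rewrite [LHS]integral_mkcond -(integral21_prod_meas1 gi) [RHS]integral_mkcond.
by apply: eq_integral => y _; rewrite /fubini_G strip_slice.
Qed.

End StripIntegral.

(** * From the strip to the fundamental parallelogram *)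

Section FundamentalDomain.
Context {R : realType}.
Local Notation C := (cplx R).
Local Notation Re := complex.Re.
Local Notation Im := complex.Im.
Local Notation mu := (@lebesgue_measure R).
Local Notation mu2 := (@lebesgue2 R).
Variable tau : C.
Hypothesis tau_gt0 : 0 < Im tau.
Local Notation strip := (strip_set (Im tau) (Re tau / Im tau)).
Local Notation real_axis := ([set: R] `*` [set (0 : R)]).
Implicit Types (g : R * R -> R).

Let T0 : Im tau != 0. Proof. by rewrite gt_eqF. Qed.

Lemma fundamental_domainE :
  fundamental_domain tau = [set p | 0 <= p.2 < Im tau /\ 0 <= p.1 - Re tau / Im tau * p.2 < 1].
Proof.
apply/seteqP; split => [] [x y] /=.
- move=> [s [t [s01 /andP[t0 t1] E]]].
  have Ex : x = s + t * Re tau by move: (congr1 (fun w : C => Re w) E); rewrite ReD ReM /= => ->; ring.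
  have Ey : y = t * Im tau by move: (congr1 (fun w : C => Im w) E); rewrite ImD ImM /= => ->; ring.
  rewrite Ey; split; first by rewrite mulr_ge0 ?(ltW tau_gt0) //= gtr_pMl.
  by have -> : x - Re tau / Im tau * (t * Im tau) = s by rewrite Ex; field.
- move=> [/andP[y0 y1] s01]; exists (x - Re tau / Im tau * y), (y / Im tau); split=> //.
    by rewrite divr_ge0 ?(ltW tau_gt0) //= ltr_pdivrMr // mul1r.
  by apply: cplx_ext; rewrite ?ReD ?ImD ?ReM ?ImM /=; field.
Qed.

Lemma measurable_fundamental_domain : measurable (fundamental_domain tau).
Proof.
rewrite fundamental_domainE.
have -> : [set p : R * R | 0 <= p.2 < Im tau /\ 0 <= p.1 - Re tau / Im tau * p.2 < 1] =
    (snd @^-1` `[0, Im tau[) `&` ((fun p : R * R => p.1 - Re tau / Im tau * p.2) @^-1` `[0, 1[).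
  by apply/seteqP; split => [] [x y]; rewrite /= !in_itv /=.
apply: measurableI; rewrite -[_ @^-1` _]setTI.
- exact: measurable_snd.
- exact: measurable_sheared.
Qed.

Lemma real_axis_null : mu2 real_axis = 0%E.
Proof.
have m0 : mu [set (0 : R)] = 0%E := lebesgue_measure_set1 0.
rewrite /lebesgue2 product_measure1E; [|exact: measurableT|exact: measurable_set1].
exact: etrans (congr1 (mule _) m0) (mule0 _).
Qed.

Lemma measurable_real_axis : measurable real_axis.
Proof. by apply: measurableX; [exact: measurableT|exact: measurable_set1]. Qed.

Lemma fundamental_domain_off_axis : fundamental_domain tau `\` real_axis = strip.
Proof.
rewrite fundamental_domainE; apply/seteqP; split => [] [x y]; rewrite /strip_set /=.
- move=> [[/andP[y0 y1] h] ny]; split=> //; rewrite y1 andbT lt_neqAle y0 andbT.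
  by apply/eqP => y0'; apply: ny.
- move=> [/andP[y0 y1] h]; split; first by rewrite (ltW y0).
  by move=> [_ y0']; move: y0; rewrite y0' ltxx.
Qed.

(** The edge on the real axis, where the estimates in [y] fail, is a null set. *)
Lemma torus_integrable g : measurable_fun [set: R * R] g ->
  mu2.-integrable strip (fun p => (g p)%:E) ->
  mu2.-integrable (fundamental_domain tau) (fun p => (g p)%:E).
Proof.
move=> mg; rewrite -fundamental_domain_off_axis /lebesgue2 => gi.
apply/(@negligible_integrable _ _ R (mu \x mu)%E _ real_axis) => //.
- exact: measurable_real_axis.
- exact: measurable_fundamental_domain.
- by apply: measurable_funTS; apply/measurable_EFinP.
- exact: real_axis_null.
Qed.

Lemma torus_integral g : measurable_fun [set: R * R] g ->
  mu2.-integrable strip (fun p => (g p)%:E) ->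
  (\int[mu2]_(p in fundamental_domain tau) (g p)%:E = \int[mu2]_(p in strip) (g p)%:E)%E.
Proof.
move=> mg gi; have := torus_integrable mg gi; rewrite -fundamental_domain_off_axis /lebesgue2 => gi'.
apply: (@negligible_integral _ _ R (mu \x mu)%E _ real_axis) => //.
- exact: measurable_real_axis.
- exact: measurable_fundamental_domain.
- exact: real_axis_null.
Qed.

End FundamentalDomain.

(** * An integrable majorant with logarithmic ends *)

Section LogWeight.
Context {R : realType}.
Local Notation mu := (@lebesgue_measure R).
Variable T : R.
Hypothesis T0 : 0 < T.
Implicit Types (y : R) (n : nat).

Let c : R := `|ln T| + 1.

(** Singular at the heights 0 and [T], the two heights at the ends of the strip that carry lattice
    points; [c] is chosen to make both summands at least 1. *)
Definition log_weight y : R := (c - ln y) + (c - ln (T - y)).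

Lemma log_weight_ge y : 0 < y < T -> [/\ 1 <= c - ln y, 1 <= c - ln (T - y) & 2 <= log_weight y].
Proof.
move=> /andP[y0 y1].
have h z : 0 < z -> z < T -> 1 <= c - ln z.
  move=> z0 zT; have : ln z <= ln T by rewrite ler_ln ?posrE // ltW.
  by have := ler_norm (ln T); rewrite /c; lra.
have h1 := h _ y0 y1; have h2 : 1 <= c - ln (T - y) by apply: h; lra.
by split=> //; rewrite /log_weight; lra.
Qed.

Lemma measurable_log_weight : measurable_fun [set: R] log_weight.
Proof.
have ml : measurable_fun [set: R] (fun y => c - ln y).
  by apply: measurable_funB; [exact: measurable_cst|exact: measurable_ln].
apply: measurable_funD => //.
apply: (measurableT_comp ml); apply: measurable_funB; [exact: measurable_cst|exact: measurable_id].
Qed.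

(** The offset 3 keeps the interval nondegenerate from [n = 0] on. *)
Definition inner_itv n : set R := `[T / n.+3%:R, T - T / n.+3%:R].

Lemma inner_itv_bounds n : 0 < T / n.+3%:R /\ T / n.+3%:R < T / 2.
Proof.
split; first by rewrite divr_gt0.
by rewrite ltr_pM2l // ltf_pV2 ?posrE // ltr_nat.
Qed.

Lemma bigcup_inner_itv : \bigcup_n inner_itv n = [set` `]0, T[].
Proof.
apply/seteqP; split => [y [n _]|y]; rewrite /inner_itv /= !in_itv /=.
  have [] := inner_itv_bounds n; move: (T / n.+3%:R) => a a0 a1 /andP[y0 y1]; apply/andP; split; lra.
move=> /andP[y0 y1]; pose m := Num.min y (T - y).
have m0 : 0 < m by rewrite lt_min y0 subr_gt0.
pose n := Num.truncn (T / m); exists n => //=; rewrite in_itv /=.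
have : T / n.+3%:R <= m.
  rewrite ler_pdivrMr // mulrC -ler_pdivrMr //; apply: ltW.
  apply: lt_trans (truncnS_gt _) _; by rewrite ltr_nat.
rewrite le_min; move: (T / n.+3%:R) => a /andP[a1 a2]; apply/andP; split; lra.
Qed.

Lemma nondecreasing_inner_itv : {homo inner_itv : n m / (n <= m)%N >-> (n <= m)%O}.
Proof.
move=> n m nm; apply/subsetPset => y; rewrite /inner_itv /= !in_itv /=.
have : T / m.+3%:R <= T / n.+3%:R by rewrite ler_pM2l // lef_pV2 ?posrE // ler_nat !ltnS.
by move: (T / m.+3%:R) (T / n.+3%:R) => a b ab /andP[y0 y1]; apply/andP; split; lra.
Qed.

Let F y := (c + 1) * y - y * ln y.

Let F_deriv y : 0 < y -> has_deriv F y (c - ln y).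
Proof.
move=> y0; apply: has_deriv_eq (has_derivB (has_derivZ (c + 1) (has_deriv_id y))
  (has_derivM (has_deriv_id y) (has_deriv_ln y0))) _.
by field; rewrite gt_eqF.
Qed.

(** The primitive of [c - ln y] stays bounded up to the ends, which bounds the integrals over all
    inner intervals at once. *)
Let F_bounds y : 0 < y < T -> 0 <= F y <= (c + 1) * T + 1.
Proof.
move=> /andP[y0 y1]; have [|h1 _ _] := @log_weight_ge y; first by rewrite y0.
have l : - ln y <= y^-1.
  have yi : 0 < y^-1 by rewrite invr_gt0.
  have := @le_ln1Dx R (y^-1 - 1); rewrite [1 + _]addrC subrK lnV ?posrE // => H.
  by apply: le_trans (H _) _; lra.
have l2 : y * - ln y <= 1 by apply: le_trans (ler_wpM2l (ltW y0) l) _; rewrite divff ?gt_eqF.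
have c0 : 0 <= c + 1 by rewrite /c; have := normr_ge0 (ln T); lra.
have := ler_wpM2l c0 (ltW y1); have : 0 <= y * (c + 1 - ln y) by apply: mulr_ge0; lra.
by rewrite /F; lra.
Qed.

Lemma integral_log_weight_inner n : (\int[mu]_(y in inner_itv n) (log_weight y)%:E <= (2 * ((c + 1) * T + 1))%:E)%E.
Proof.
have [a0 a1] := inner_itv_bounds n; have T0' := T0; rewrite /inner_itv; move: (T / n.+3%:R) a0 a1 => a a0 a1.
rewrite (lint_FTC (G := fun y => F y - F (T - y))).
- rewrite lee_fin subKr.
  have /andP[? ?] : 0 <= F a <= (c + 1) * T + 1 by apply: F_bounds; apply/andP; split; lra.
  have /andP[? ?] : 0 <= F (T - a) <= (c + 1) * T + 1 by apply: F_bounds; apply/andP; split; lra.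
  lra.
- move=> x /andP[x0 x1]; rewrite /log_weight -[c - ln (T - x)]opprK.
  apply: has_derivB; first by apply: F_deriv; lra.
  have h : has_deriv (fun y => T - y) x (-1).
    by apply: has_deriv_eq (has_derivB (has_deriv_cst T x) (has_deriv_id x)) _; rewrite sub0r.
  have Tx : 0 < T - x by lra.
  by apply: has_deriv_eq (has_deriv_comp h (F_deriv Tx)) _; rewrite mulrN1.
- lra.
- apply: continuous_in_subspaceT => x; rewrite inE /= in_itv /= => /andP[x0 x1].
  have x00 : 0 < x by lra. have Tx : 0 < T - x by lra.
  have cT : {for x, continuous (fun y : R => T - y)} := contB (@cont_cst R R T x) (@cont_id R x).
  have cl := @contcomp R R R (@ln R) (fun y => T - y) x cT (continuous_ln Tx).
  exact: (contD (contB (@cont_cst R R c x) (continuous_ln x00)) (contB (@cont_cst R R c x) cl)).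
Qed.

(** Monotone convergence along the inner intervals, whose integrals share a bound. *)
Lemma integral_log_weight : (\int[mu]_(y in `]0%R, T[) (log_weight y)%:E < +oo)%E.
Proof.
rewrite -bigcup_inner_itv.
have ge0 n y : inner_itv n y -> (0 <= (log_weight y)%:E)%E.
  move=> h; have : (\bigcup_n inner_itv n) y by exists n.
  rewrite bigcup_inner_itv /= in_itv /= => /log_weight_ge [_ _ k2]; rewrite lee_fin; lra.
have mi n : measurable (inner_itv n) by exact: measurable_itv.
have mk n : measurable_fun (inner_itv n) (fun y => (log_weight y)%:E).
  by apply: measurable_funTS; apply/measurable_EFinP; exact: measurable_log_weight.
have H := @ge0_nondecreasing_set_cvg_integral _ (measurableTypeR R) R inner_itv _ mu nondecreasing_inner_itv mi mk ge0.
rewrite -(cvg_lim _ H) //; apply: le_lt_trans (ltry (2 * ((c + 1) * T + 1))).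
apply: lime_le; first by apply/cvg_ex; eexists; exact: H.
by apply: nearW => n; exact: integral_log_weight_inner.
Qed.

Lemma integrable_log_weight (A : R) : mu.-integrable `]0, T[ (fun y => (A * log_weight y)%:E).
Proof.
have i1 : mu.-integrable `]0, T[ (fun y => (log_weight y)%:E).
  apply/integrableP; split.
    by apply: measurable_funTS; apply/measurable_EFinP; exact: measurable_log_weight.
  apply: le_lt_trans integral_log_weight; rewrite le_eqVlt; apply/orP; left; apply/eqP.
  apply: eq_integral => y; rewrite inE /= in_itv /= => /log_weight_ge [_ _ k2].
  by rewrite ger0_norm //; lra.
have -> : (fun y => (A * log_weight y)%:E) = (fun y => A%:E * (log_weight y)%:E)%E by apply/funext => y; exact: EFinM.
by apply: integrableZl => //; exact: measurable_itv.
Qed.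

End LogWeight.

(** * Bounds and integrability of the logarithmic density *)

Section Solution.
Context {R : realType}.
Local Notation C := (cplx R).
Local Notation Re := complex.Re.
Local Notation Im := complex.Im.
Local Notation mu := (@lebesgue_measure R).
Local Notation mu2 := (@lebesgue2 R).
Variable tau : C.
Hypothesis tau_gt0 : 0 < Im tau.
Local Notation T := (Im tau).
Local Notation al := (Re tau / Im tau).
Local Notation v := (log_density tau).
Implicit Types (u g h : C -> R) (z w : C) (x y : R).

Lemma lattice_reduce z : exists2 w, lattice tau w & `|Re (z + w)| <= 1 / 2 /\ `|Im (z + w)| <= T / 2.
Proof.
have red a : exists k : int, `|a + k%:~R| <= 1 / 2 :> R.
  exists (- Num.floor (a + 1 / 2)); have /andP[h1 h2] := Num.Theory.floor_itv (a + 1 / 2).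
  by rewrite intrN ler_norml; rewrite intrD in h2; apply/andP; split; lra.
have [n hn] := red (Im z / T); have [m hm] := red (Re z + n%:~R * Re tau).
exists (lat tau (m, n)); first exact: lattice_lat.
rewrite ReD ImD Re_lat Im_lat /=; split; first by rewrite [m%:~R + _]addrC addrA.
have -> : Im z + n%:~R * T = (Im z / T + n%:~R) * T by field; rewrite gt_eqF.
by rewrite normrM (gtr0_norm tau_gt0); have := ler_wpM2r (ltW tau_gt0) hn; lra.
Qed.

Lemma periodic_bounded u : continuous u -> (forall z w, lattice tau w -> u (z + w) = u z) ->
  exists2 M, 0 <= M & forall z, `|u z| <= M.
Proof.
move=> cu per; have T2 : 0 <= T / 2 by rewrite divr_ge0 // ltW.
have [|M M0 HM] := @rectangle_bounded R u (1 / 2) (T / 2) _ T2 (fun x y _ _ => cu _); first by rewrite divr_ge0.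
exists M => // z; have [w wL [h1 h2]] := lattice_reduce z.
by rewrite -(per _ _ wL) -(mkC_eta (z + w)) HM.
Qed.

Let int01 (n : int) : -2 < n -> n < 1 -> n = 0 \/ n = -1.
Proof. by move=> *; lia. Qed.

(** Reduction to the central cell, where [v] is [ln |z|^2] plus a bounded term and [|z|] is at least
    [|Im z|]. The reduced height is [y] or [T - y], whence the two summands of [log_weight]. *)
Lemma log_density_bounds : exists A : R, 0 <= A /\ forall x y, 0 < y < T ->
  `|v (mkC x y)| <= A * log_weight T y /\ v (mkC x y) <= A.
Proof.
have T0 := tau_gt0.
have [r [kr r0 rE]] := torus_density_local tau_gt0.
have T2 : 0 <= T / 2 by rewrite divr_ge0 // ltW.
have cell x y : `|x| <= 1 / 2 -> `|y| <= T / 2 -> central_cell tau (mkC x y).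
  by move=> h1 h2; split=> /=; lra.
have [||x y h1 h2|M M0 HM] := @rectangle_bounded R (fun z => ln (r z)) (1 / 2) (T / 2).
- by rewrite divr_ge0.
- exact: T2.
- have zV := cell _ _ h1 h2.
  exact: contcomp (Ck_cont (kr 0%N) zV) (continuous_ln (r0 _ zV)).
(* [B] bounds [|z|^2], hence its logarithm, at the reduced points. *)
pose c := `|ln T| + 1; pose B := 1 / 4 + T ^+ 2 / 4.
have B0 : 0 <= B by rewrite addr_ge0 ?divr_ge0 ?sqr_ge0.
have key z : `|Re z| <= 1 / 2 -> 0 < `|Im z| -> `|Im z| <= T / 2 ->
    `|v z| <= (M + B + 2) * (c - ln `|Im z|) /\ v z <= M + B + 2.
  move=> h1 h3 h2; have zV : central_cell tau z by rewrite -(mkC_eta z); exact: cell.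
  have hM := HM _ _ h1 h2; rewrite mkC_eta in hM.
  have y2 : 0 < Im z ^+ 2 by rewrite -real_normK ?num_real // exprn_gt0.
  have u0 : 0 < Re z ^+ 2 + Im z ^+ 2 by rewrite ltr_wpDl ?sqr_ge0.
  have vE : v z = ln (Re z ^+ 2 + Im z ^+ 2) + ln (r z) by rewrite /log_density rE lnM ?posrE // r0.
  have l1 : ln (Re z ^+ 2 + Im z ^+ 2) <= B.
    have : Re z ^+ 2 <= 1 / 4.
      by rewrite -real_normK ?num_real //; have := normr_ge0 (Re z); nra.
    have : Im z ^+ 2 <= T ^+ 2 / 4.
      by rewrite -real_normK ?num_real //; move: (`|Im z|) h3 h2 => t *; nra.
    have := @le_ln1Dx R (Re z ^+ 2 + Im z ^+ 2 - 1); rewrite [1 + _]addrC subrK => H.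
    by have := H _; rewrite /B; lra.
  have l2 : 2 * ln `|Im z| <= ln (Re z ^+ 2 + Im z ^+ 2).
    have -> : 2 * ln `|Im z| = ln (Im z ^+ 2) by rewrite -real_normK ?num_real // lnXn // mulr_natl.
    by rewrite ler_ln ?posrE // lerDr sqr_ge0.
  have yT : 0 < `|Im z| < T by apply/andP; split=> //; lra.
  have [k1 _ _] := log_weight_ge T0 yT; rewrite -/c in k1.
  have c1 : 1 <= c by rewrite lerDr normr_ge0.
  move: hM; rewrite ler_norml => /andP[m1 m2].
  have k2 : M + B <= (M + B) * (c - ln `|Im z|) by rewrite ler_peMr // addr_ge0.
  split; last by lra.
  by rewrite ler_norml; apply/andP; split; lra.
exists (M + B + 2); split; first by lra.
move=> x y /andP[y0 y1]; have [w wL [h1 h2]] := lattice_reduce (mkC x y).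
rewrite -(log_density_periodic tau_gt0 (mkC x y) wL).
have [k1 k2 _] : [/\ 1 <= c - ln y, 1 <= c - ln (T - y) & 2 <= log_weight T y] by apply: log_weight_ge; rewrite ?y0.
have Mb : 0 <= M + B + 2 by lra.
have p1 : 0 <= (M + B + 2) * (c - ln y) by apply: mulr_ge0; lra.
have p2 : 0 <= (M + B + 2) * (c - ln (T - y)) by apply: mulr_ge0; lra.
have lwE : (M + B + 2) * log_weight T y = (M + B + 2) * (c - ln y) + (M + B + 2) * (c - ln (T - y)) by rewrite -mulrDr.
(* Bringing a height between 0 and [T] to modulus at most [T / 2] can only add 0 or [- T]. *)
have [E|E] : `|Im (mkC x y + w)| = y \/ `|Im (mkC x y + w)| = T - y.
  have [[m n] wE] := latticeP wL; move: h2; rewrite wE ImD Im_lat /= ler_norml => /andP[a b].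
  have n1 : -2 < n%:~R :> R by rewrite -(ltr_pM2r tau_gt0); lra.
  have n2 : n%:~R < 1 :> R by rewrite -(ltr_pM2r tau_gt0); lra.
  have : n = 0 \/ n = -1.
    move: n1 n2; rewrite -[1]/(1%:~R) ltr_int (_ : -2 = (-2)%:~R :> R) ?ltr_int; last by rewrite intrN.
    exact: int01.
  case=> ->; rewrite ?mul0r ?addr0 ?mulN1r; first by left; rewrite gtr0_norm.
  by right; rewrite ltr0_norm ?opprB //; lra.
- have [] := key _ h1 _ h2; rewrite E //; lra.
- have [] := key _ h1 _ h2; rewrite E ?subr_gt0 //; lra.
Qed.

Lemma measurable_log_density : measurable_fun [set: R * R] (fun p => v (mkC p.1 p.2)).
Proof.
apply: (measurableT_comp (@measurable_ln R)); apply: continuous_measurable_plane.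
by move=> z; exact: torus_density_cont.
Qed.

Lemma strip_dominated g (A : R) : measurable_fun [set: R * R] (fun p => g (mkC p.1 p.2)) ->
  (forall x y, 0 < y < T -> `|g (mkC x y)| <= A * log_weight T y) ->
  mu2.-integrable (strip_set T al) (fun p => (g (mkC p.1 p.2))%:E).
Proof.
move=> mg hg.
have mS := measurable_strip_set T al.
have k0 y : 0 < y < T -> 0 <= A * log_weight T y by move=> h; apply: le_trans (hg 0 y h); exact: normr_ge0.
have mk : measurable_fun [set: R] (fun y => A * log_weight T y).
  by apply: measurable_funM; [exact: measurable_cst|exact: measurable_log_weight].
have ik := strip_integrable_snd al mk k0.
apply: (@le_integrable _ _ R (mu \x mu)%E _ mS _ (fun p => (A * log_weight T p.2)%:E)).
- by apply: measurable_funTS; apply/measurable_EFinP.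
- move=> [x y] [/= hy _]; rewrite lee_fin; apply: le_trans (hg x y hy) _; exact: ler_norm.
- apply: ik; have /integrableP [_] := integrable_log_weight tau_gt0 A.
  apply: le_lt_trans; rewrite le_eqVlt; apply/orP; left; apply/eqP; apply: eq_integral => y.
  by rewrite inE /= in_itv /= => /k0 h; rewrite ger0_norm.
Qed.

End Solution.

(** * The logarithmic density solves the mean field equation *)

Section IsSolution.
Context {R : realType}.
Local Notation C := (cplx R).
Local Notation Re := complex.Re.
Local Notation Im := complex.Im.
Local Notation mu := (@lebesgue_measure R).
Local Notation mu2 := (@lebesgue2 R).
Variable tau : C.
Hypothesis tau_gt0 : 0 < Im tau.
Local Notation T := (Im tau).
Local Notation al := (Re tau / Im tau).
Local Notation v := (log_density tau).
Implicit Types (z w : C) (x y : R) (n : nat).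

Lemma integrable_log_density :
  mu2.-integrable (fundamental_domain tau) (fun p => (v (mkC p.1 p.2))%:E).
Proof.
have [A [A0 hA]] := log_density_bounds tau_gt0; have mv := measurable_log_density tau_gt0.
apply: (torus_integrable tau_gt0 mv); apply: (strip_dominated tau_gt0 (A := A) mv).
by move=> x y /(hA x) [].
Qed.

Lemma integrable_exp_log_density :
  mu2.-integrable (fundamental_domain tau) (fun p => (expR (v (mkC p.1 p.2)))%:E).
Proof.
have [A [A0 hA]] := log_density_bounds tau_gt0.
have mv : measurable_fun [set: R * R] (fun p => expR (v (mkC p.1 p.2))).
  exact: (measurableT_comp (@measurable_expR R)) (measurable_log_density tau_gt0).
apply: (torus_integrable tau_gt0 mv).
apply: (@strip_dominated R tau tau_gt0 (fun z => expR (v z)) (expR A) mv) => x y hy.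
have [_ h] := hA x y hy; have [_ _ k2] := log_weight_ge tau_gt0 hy.
rewrite ger0_norm ?expR_ge0 //; have eA : expR (v (mkC x y)) <= expR A by rewrite ler_expR.
apply: le_trans eA _; rewrite ler_peMr ?expR_ge0 //; lra.
Qed.

Section Weak.
Variable h : C -> R.
Hypothesis per_h : forall z w, lattice tau w -> h (z + w) = h z.
Hypothesis kh : forall k, Ck k setT h.
Local Notation g := (weak_integrand tau h).

Let ch : continuous h. Proof. by move=> z; exact: Ck_cont (kh 0%N) I. Qed.

Let claph : continuous (laplacian h).
Proof.
move=> z; apply: contD; first exact: Ck_cont (Ck_dx (Ck_dx (kh 2%N))) I.
exact: Ck_cont (Ck_dy (Ck_dy (kh 2%N))) I.
Qed.

Lemma measurable_weak_integrand : measurable_fun [set: R * R] (fun p => g (mkC p.1 p.2)).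
Proof.
have mv := measurable_log_density tau_gt0.
have m1 := continuous_measurable_plane claph; have m2 := continuous_measurable_plane ch.
apply: measurable_funD; apply: measurable_funM => //.
exact: (measurableT_comp (@measurable_expR R)) mv.
Qed.

Lemma weak_integrand_bound : exists A : R, forall x y, 0 < y < T -> `|g (mkC x y)| <= A * log_weight T y.
Proof.
have [A [A0 hA]] := log_density_bounds tau_gt0.
have [M1 M10 H1] := periodic_bounded tau_gt0 claph (fun z w wL => laplacian_periodic (fun z' => per_h z' wL) z).
have [M2 M20 H2] := periodic_bounded tau_gt0 ch per_h.
exists (A * M1 + expR A * M2) => x y hy.
have [h1 h2] := hA x y hy; have [_ _ k2] := log_weight_ge tau_gt0 hy.
have eA : expR (v (mkC x y)) <= expR A by rewrite ler_expR.
apply: le_trans (ler_normD _ _) _; rewrite !normrM [`|expR _|]ger0_norm ?expR_ge0 //.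
have b1 := ler_pM (normr_ge0 _) (normr_ge0 _) h1 (H1 (mkC x y)).
have b2 := ler_pM (expR_ge0 _) (normr_ge0 _) eA (H2 (mkC x y)).
have b3 : expR A * M2 <= expR A * M2 * log_weight T y.
  by rewrite ler_peMr ?mulr_ge0 ?expR_ge0 //; lra.
rewrite mulrDl; apply: lerD; last exact: le_trans b2 b3.
by rewrite mulrAC in b1.
Qed.

Let g_line y : 0 < y < T -> line_cont g y.
Proof.
move=> /andP[y0 y1]; apply: weak_integrand_line => //.
by rewrite gtr0_norm // y0.
Qed.

(** The slice of the parallelogram starts at [al * y]; periodicity in [x] moves it to the centred
    period of [hint]. *)
Lemma integral_weak_slices :
  (\int[mu2]_(p in fundamental_domain tau) (g (mkC p.1 p.2))%:E =
   \int[mu]_(y in `]0%R, T[) (hint g y)%:E)%E.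
Proof.
have [A hA] := weak_integrand_bound; have mg := measurable_weak_integrand.
have gi := strip_dominated tau_gt0 mg hA.
rewrite (torus_integral tau_gt0 mg gi) (strip_fubini gi); apply: eq_integral => y.
rewrite inE /= in_itv /= => hy.
have cl := line_cont_line (g_line hy).
have p1 x : g (mkC (x + 1) y) = g (mkC x y).
  rewrite -[RHS](weak_integrand_periodic tau_gt0 per_h _ (lattice1 tau)); congr g.
  by apply: cplx_ext; rewrite ?ReD ?ImD /= ?addr0.
rewrite integral_itv_bndo_bndc; last first.
  apply/measurable_EFinP; apply: measurable_funTS; exact: continuous_measurable_fun.
have lt1 : al * y < al * y + 1 by lra.
rewrite (lint_lebesgue lt1 cl); congr (_%:E).
rewrite (@lint_periodic R (fun x => g (mkC x y)) (al * y) (- (1 / 2)) cl p1) /hint.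
by congr lint; lra.
Qed.

Let flux_limit : (fun n => hint (green_flux tau h) (- (T / n.+3%:R)) - hint (green_flux tau h) (T / n.+3%:R))
  @ \oo --> (4 * pi * h 0 : R).
Proof.
apply/cvgrPdist_le => e e0; have [d d0 Hd] := flux_jump tau_gt0 kh e0.
near=> n; have [a0 a1] := inner_itv_bounds tau_gt0 n.
(* [flux_jump] takes the height in the form of a square. *)
rewrite distrC -(sqr_sqrtr (ltW a0)); apply: Hd; first by rewrite sqrtr_gt0.
rewrite -[d]gtr0_norm // -sqrtr_sqr ltr_sqrt ?exprn_gt0 //.
rewrite ltr_pdivrMr // mulrC -ltr_pdivrMr ?exprn_gt0 //.
near: n; exists (Num.truncn (T / d ^+ 2)) => // n /= hn.
apply: lt_trans (truncnS_gt _) _; by rewrite ltr_nat !ltnS; exact: leqW.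
Unshelve. all: by end_near.
Qed.

(** The integrals over the inner intervals converge to the left side by domination with
    [log_weight], and as differences of fluxes they converge to the right side. *)
Lemma weak_equation :
  (\int[mu2]_(p in fundamental_domain tau) (g (mkC p.1 p.2))%:E = (4 * pi * h 0)%:E)%E.
Proof.
rewrite integral_weak_slices; have T0 := tau_gt0.
have [A hA] := weak_integrand_bound.
pose F n : R -> \bar R := (fun y => (hint g y)%:E) \_ (inner_itv T n).
have half_le : - (1 / 2) <= 1 / 2 :> R by lra.
have Fb y : 0 < y < T -> `|hint g y| <= A * log_weight T y.
  move=> hy; have -> : A * log_weight T y = lint (- (1 / 2)) (1 / 2) (fun _ => A * log_weight T y).
    by rewrite lint_cst; lra.
  apply: lint_abs => //; first exact: line_cont_line (g_line hy).
    by move=> x; exact: cont_cst.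
  by move=> x _; exact: hA.
have mh : measurable_fun `]0, T[ (hint g).
  apply: open_continuous_measurable_fun; first exact: interval_open.
  by move=> y; rewrite inE /= in_itv /= => hy; exact: hint_weak_cont.
have mF n : measurable_fun `]0, T[ (F n).
  apply/(measurable_restrict _ (measurable_itv _) (measurable_itv _)).
  by apply/measurable_EFinP; apply: measurable_funS mh => //; exact: measurable_itv.
have cF y : `]0, T[%classic y -> F ^~ y @ \oo --> (hint g y)%:E.
  rewrite -(bigcup_inner_itv T0) => -[n _ hn]; apply: cvg_near_cst.
  exists n => // m /= nm; rewrite /F patchE mem_set //.
  by have /subsetPset := nondecreasing_inner_itv T0 nm; apply.
have bF n y : `]0, T[%classic y -> (`|F n y| <= (A * log_weight T y)%:E)%E.
  rewrite /= in_itv /= => hy; rewrite /F patchE; case: ifPn => _; first by rewrite lee_fin Fb.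
  by rewrite abse0 lee_fin; apply: le_trans (Fb _ hy).
have fin y : `]0, T[%classic y -> (A * log_weight T y)%:E \is a fin_num by [].
have H := @dominated_cvg _ (measurableTypeR R) R mu _ (measurable_itv `]0, T[) F _ _ mF cF fin (integrable_log_weight T0 A) bF.
apply: (cvg_unique _ H) => //.
have E n : (\int[mu]_(y in `]0%R, T[) F n y)%E = (hint (green_flux tau h) (- (T / n.+3%:R)) - hint (green_flux tau h) (T / n.+3%:R))%:E.
  have [a0 a1] := inner_itv_bounds T0 n.
  rewrite /F -integral_mkcondr -(hint_weak_FTC tau_gt0 kh per_h a0 a1); congr (integral _ _ _).
  apply/setIidPr => y hy; rewrite -(bigcup_inner_itv T0); by exists n.
apply: (@cvg_trans _ ((fun n => (hint (green_flux tau h) (- (T / n.+3%:R)) - hint (green_flux tau h) (T / n.+3%:R))%:E) @ \oo)).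
  by apply: near_eq_cvg; apply: nearW => n; exact: esym (E n).
by apply: cvg_EFin; [exact: nearW|exact: flux_limit].
Qed.

End Weak.

Lemma log_density_solution : is_solution tau v.
Proof.
split.
- by move=> z w wL _; exact: log_density_periodic.
- exact: log_density_C.
- exact: integrable_log_density.
- exact: integrable_exp_log_density.
- by move=> h per_h kh; exact: weak_equation.
Qed.

End IsSolution.

(** * The developing map of the given solution *)

Theorem proposition4p2 (R : realType) (tau : cplx R) (u : cplx R -> R)
  (tau_gt0 : 0 < complex.Im tau) (hu : is_the_solution tau u) :
  exists f : cplx R -> P1 R,
    [/\ [/\ developing_map tau u f, type_I tau f & typeI_properties tau f],
        (forall g : cplx R -> P1 R,
           developing_map tau u g -> type_I tau g -> typeI_properties tau g ->
           forall z, g z = f z),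
        (forall h : cplx R -> P1 R,
           meromorphic h ->
           order_zero_off_half tau h ->
           type_I tau h ->
           h (tau / 2) = Some 1 ->
           has_order h (1 / 2) 1 ->
           forall z, h z = f z) &
        [/\ (forall z, f z =
               P1frac
                 (- cexp (1 / 4 * quasi_period tau tau * (1 + tau)) *
                  (wsigma tau (z / 2 - 1 / 4) * wsigma tau (z / 2 + 1 / 4)))
                 (wsigma tau (z / 2 - 1 / 4 - tau / 2) *
                  wsigma tau (z / 2 + 1 / 4 + tau / 2))),
            (forall z, f z =
               P1scale
                 (- cexp (1 / 4 * quasi_period tau tau * (1 + tau)) *
                  (wsigma tau (1 / 4) ^+ 2 / wsigma tau (1 / 4 + tau / 2) ^+ 2))
                 (wp_ratio tau (1 / 4) (1 / 4 + tau / 2) (z / 2))) &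
            (forall z, f z =
               P1scale
                 ((wp tau (tau / 4) - wp tau (1 / 4 + tau / 2)) /
                  (wp tau (tau / 4) - wp tau (1 / 4)))
                 (wp_ratio tau (1 / 4) (1 / 4 + tau / 2) (z / 2)))]].
Proof.
(* The uniqueness contained in [hu] identifies the given solution with [log_density] off the
   lattice. *)
have vu z : ~ lattice tau z -> log_density tau z = u z := hu.2 _ (log_density_solution tau_gt0) z.
have props := dev_map_typeI_properties tau_gt0.
have dev : developing_map tau u (dev_map tau).
  split; first exact: dev_map_meromorphic.
  move=> z zL; split; first exact: dev_density_gt0.
  by rewrite -(vu z zL) torus_density_spherical.
have reg : regular_typeI tau (dev_map tau).
  by case: dev props => mer _ [ord [_ [_ [per [_ [half [ord1 _]]]]]]].
exists (dev_map tau); split.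
- by split; [exact: dev|exact: dev_map_type_I|exact: props].
(* Uniqueness in (a) is an instance of the characterization in (b). *)
- move=> g [mer _] per [ord [_ [_ [_ [_ [half [ord1 _]]]]]]] z.
  by apply: (regular_typeI_unique tau_gt0 _ reg).
- by move=> h mer ord per half ord1 z; apply: (regular_typeI_unique tau_gt0 _ reg).
- split=> z; [exact: dev_map_sigma|exact: dev_map_wp|exact: dev_map_wp_normalized].
Qed.
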